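(* For $n=3,5,7,9,\ldots$, let $x_n$ be the unique solution in $(1,+\infty)$ of $T_n(x)=nx$, let $y_n$ be the positive number $$y_n=\frac{1}{\sqrt{x_n^2-1}}\,\frac{T_{(n+1)/2}(x_n)}{U_{(n-3)/2}(x_n)},$$ and let $\rho_c=iy_n$. Let $K_n(\rho)=\left[\rho^{|j-k|}\right]_{j,k=1}^n$. (1) The matrix $K_n(iy_n)$ possesses the double eigenvalue $\lambda_c=-n$. This double eigenvalue is of type-1 when $n=5,9,13,17,\ldots$ and of type-2 when $n=3,7,11,15,\ldots$. (2) The associated Puiseux-series parameters $a=a_ne^{i\theta_a}$, $b=b_ne^{i\theta_b}$ (with $a_n=|a|$, $b_n=|b|$) and $\Theta=\theta_b-2\theta_a$ can be found from $$\theta_a=\frac{3\pi}{4},\quad \theta_b=-\frac{\pi}{2},\quad \Theta=-2\pi,$$ $$a_n=\sqrt{\frac2n}\,\frac{(x_n^2-1)^{1/4}}{x_n}\sqrt{[U_{n-1}(x_n)-1][T_{n-1}(x_n)-1]},$$ $$6nx_n^2\sqrt{x_n^2-1}\,[U_{n-1}(x_n)-1]\,b_n=12+4(n+1)T_{n-1}^2(x_n)-(5n^2+5n+12)x_n^2-3(n-7)(x_n^2-1)U_{n-1}(x_n)+4(n-2)(n^2x_n^2-1)+(n+1)(4x_n^2-3)T_{n-1}(x_n).$$ (3) The associated cusp bisector is $\theta=-\pi/2$, i.e. the ray that starts from the point $\rho=iy_n$, lies on the imaginary axis, and points downward. Sufficiently close to this ray, the local level curve is given by the polar equation $$|\epsilon|=|\epsilon|(\theta)=\frac{8a_n^2(1+\sin\theta)}{[a_n^2+(4b_n-a_n^2)\sin\theta]^2}\qquad(\epsilon=\rho-iy_n=|\epsilon|e^{i\theta}),$$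 and is symmetric with respect to the imaginary axis. (4) Let $\rho=iy$ with $y>0$ and let $d=y-y_n$. Then as $y\to y_n$, $$\mathrm{Re}\left\{\frac{\lambda(\rho)}{\lambda_c}\right\}=\begin{cases}1-|d|b_n+O\left(|d|^{3/2}\right),& d\le 0,\\ 1\pm a_n\sqrt d+d\,b_n+O\left(d^{3/2}\right),& d\ge 0;\end{cases}$$ $$\mathrm{Im}\left\{\frac{\lambda(\rho)}{\lambda_c}\right\}=\begin{cases}\pm a_n\sqrt{|d|}+O\left(|d|^{3/2}\right),& d\le 0,\\ O\left(d^{3/2}\right),& d\ge 0;\end{cases}$$ $$\left|\frac{\lambda(\rho)}{\lambda_c}\right|=\begin{cases}1+|d|\,\frac12\left(a_n^2-2b_n\right)+O\left(|d|^{3/2}\right),& d\le 0,\\ 1\pm a_n\sqrt d+d\,b_n+O\left(d^{3/2}\right),& d\ge 0.\end{cases}$$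
   Context: $T_k$ and $U_k$ are the Chebyshev polynomials of the first and second kinds. Square roots and fourth roots of positive numbers are the positive ones. Each eigenvalue of $K_n(\rho)$ is of type-1 or type-2: type-1 (type-2) eigenvalues are those associated with skew-symmetric (symmetric) eigenvectors, i.e. eigenvectors $(v_0,\dots,v_{n-1})$ with $v_{n-1-j}=-v_j$ (respectively $v_{n-1-j}=v_j$). ''Double eigenvalue'' means an eigenvalue of algebraic multiplicity $2$. Puiseux-series parameters: $\lambda(\rho)$ denotes the two eigenvalues of $K_n(\rho)$ that coalesce to $\lambda_c=-n$ at $\rho=\rho_c$, and $a,b\in\mathbb{C}$ are defined by the convergent Puiseux series $\lambda(\rho)=\lambda_c\left[1\pm a\epsilon^{1/2}+b\epsilon+O(\epsilon^{3/2})\right]$ as $\epsilon=\rho-\rho_c\to0$, the $\pm$ sign corresponding to the two eigenvalues (so $a$ is determined up to sign, and its sign may be chosen; arguments are determined modulo $2\pi$). Local level curve: the locus of points $\rho$ near $\rho_c$ such that $|\lambda(\rho)/\lambda_c|=1+O(|\epsilon|^{3/2})$ as $\epsilon\to 0$. Precisely: expanding $|\lambda(\rho)/\lambda_c|=1\pm|\epsilon|^{1/2}m_1(\theta)+|\epsilon|\,m_2(\theta)+O(|\epsilon|^{3/2})$ with $\epsilon=|\epsilon|e^{i\theta}$, it consists of those $\rho$ for which $\pm|\epsilon|^{1/2}m_1(\theta)+|\epsilon|\,m_2(\theta)=0$ for at least one choice of sign. Cusp bisector: the ray $\theta=\arg(\rho-\rho_c)=\pi-2\theta_a$ emanating from $\rho_c$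 (the local level curve has a cusp at $\rho_c$ and this ray is tangent to both of its branches there). *)

(* Defs.v *)
From HB Require Import structures.
From mathcomp Require Import all_boot all_order all_algebra.
From mathcomp Require Import all_classical all_reals all_analysis.
From mathcomp Require Import complex.

Set Implicit Arguments.
Unset Strict Implicit.
Unset Printing Implicit Defensive.

Import Order.TTheory GRing.Theory Num.Theory.
Import numFieldNormedType.Exports.

Local Open Scope classical_set_scope.
Local Open Scope complex_scope.
Local Open Scope ring_scope.

Fixpoint chebT (R : realType) (n : nat) : {poly R} :=
  match n with
  | 0 => 1
  | 1 => 'X
  | (n''.+1 as n').+1 => 2 *: ('X * chebT R n') - chebT R n''
  end.

Fixpoint chebU (R : realType) (n : nat) : {poly R} :=
  match n with
  | 0 => 1
  | 1 => 2 *: 'X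
  | (n''.+1 as n').+1 => 2 *: ('X * chebU R n') - chebU R n''
  end.

(* [Normc.normc z : R] is the modulus as a real number, whereas [`|z|] has    *)
(* type [R[i]].                                                               *)
Definition cis (R : realType) (t : R) : R[i] := cos t +i* sin t.

Definition KMS (R : realType) (n : nat) (rho : R[i]) : 'M[R[i]]_n :=
  \matrix_(j < n, k < n) rho ^+ (`|j - k|%N).

Definition skew_symmetric_vec (R : realType) (n : nat) (v : 'rV[R[i]]_n) :=
  forall j : 'I_n, v 0 (rev_ord j) = - v 0 j.

Definition symmetric_vec (R : realType) (n : nat) (v : 'rV[R[i]]_n) :=
  forall j : 'I_n, v 0 (rev_ord j) = v 0 j.

(* MathComp's eigenspaces consist of row vectors; this is immaterial here     *)
(* because [KMS n rho] is symmetric.  Every eigenvector of the eigenvalue is  *)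
(* required to have the stated symmetry: as the matrix commutes with the      *)
(* flip [j |-> n - 1 - j], this says that the whole generalized eigenspace    *)
(* has that symmetry.                                                         *)
Definition type1_eigenvalue (R : realType) (n : nat) (A : 'M[R[i]]_n)
    (l : R[i]) : Prop :=
  eigenvalue A l /\
  forall v : 'rV_n, (v <= eigenspace A l)%MS -> skew_symmetric_vec v.

Definition type2_eigenvalue (R : realType) (n : nat) (A : 'M[R[i]]_n)
    (l : R[i]) : Prop :=
  eigenvalue A l /\
  forall v : 'rV_n, (v <= eigenspace A l)%MS -> symmetric_vec v.

Definition double_eigenvalue (R : realType) (n : nat) (A : 'M[R[i]]_n)
    (l : R[i]) : Prop :=
  mup l (char_poly A) = 2%N.

(* Counted with algebraic multiplicity, the eigenvalues of [KMS n rho] in the *)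
(* open disc of center [lc] and radius [eta] are exactly [l1] and [l2].  For  *)
(* a small fixed [eta] and [rho] close to [rhoc], these are the two           *)
(* eigenvalues that coalesce to [lc] at [rhoc].                               *)
Definition eigenvalue_pair_near (R : realType) (n : nat) (lc : R[i]) (eta : R)
    (rho l1 l2 : R[i]) : Prop :=
  [/\ Normc.normc (l1 - lc) < eta, Normc.normc (l2 - lc) < eta
    & exists q : {poly R[i]},
        char_poly (KMS n rho) = ('X - l1%:P) * ('X - l2%:P) * q /\
        forall l, Normc.normc (l - lc) < eta -> ~~ root q l].

(* The Puiseux series [lc * \sum_k c k * eps^(k/2)] of the two coalescing     *)
(* eigenvalues.  Here [z] is a square root of [eps = rho - rhoc]; its two     *)
(* determinations [z] and [- z] yield the two eigenvalues.                    *)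
Definition puiseux_series (R : realType) (n : nat) (rhoc lc : R[i])
    (c : nat -> R[i]) : Prop :=
  c 0%N = 1 /\
  exists (eta del : R) (f : R[i] -> R[i]),
    [/\ 0 < eta, 0 < del
      & forall z : R[i], Normc.normc z < del ->
          (series (fun k => c k * z ^+ k : R[i]^o) @ \oo --> (f z : R[i]^o)) /\
          eigenvalue_pair_near n lc eta (rhoc + z ^+ 2)
            (lc * f z) (lc * f (- z))].

Definition puiseux_parameters (R : realType) (n : nat) (rhoc lc a b : R[i])
    : Prop :=
  exists c, [/\ puiseux_series n rhoc lc c, c 1%N = a & c 2%N = b].

(* [|lambda / lc| = 1 +- |eps|^(1/2) m1(theta) + |eps| m2(theta)              *)
(*                  + O(|eps|^(3/2))] with [eps = r * cis th].  This          *)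
(* determines [m2 th], and [m1 th] up to sign, at each [th].                  *)
Definition modulus_expansion (R : realType) (n : nat) (rhoc lc : R[i])
    (m1 m2 : R -> R) : Prop :=
  exists eta del M : R,
    [/\ 0 < eta, 0 < del
      & forall r th : R, 0 < r < del ->
          exists l1 l2 : R[i],
            [/\ eigenvalue_pair_near n lc eta (rhoc + r%:C * cis th) l1 l2,
                `|Normc.normc (l1 / lc)
                  - (1 + Num.sqrt r * m1 th + r * m2 th)| <= M * r `^ (3 / 2)
              & `|Normc.normc (l2 / lc)
                  - (1 - Num.sqrt r * m1 th + r * m2 th)| <= M * r `^ (3 / 2)]].

Definition local_level_curve (R : realType) (n : nat) (rhoc lc : R[i])
    : set R[i] :=
  [set rho | exists (m1 m2 : R -> R) (r th : R),
     [/\ modulus_expansion n rhoc lc m1 m2, 0 <= r,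
         rho = rhoc + r%:C * cis th
       & Num.sqrt r * m1 th + r * m2 th = 0 \/
         - (Num.sqrt r * m1 th) + r * m2 th = 0]].

Definition ray (R : realType) (rhoc : R[i]) (th : R) : set R[i] :=
  [set rho | exists2 r : R, 0 <= r & rho = rhoc + r%:C * cis th].

Definition sector (R : realType) (rhoc : R[i]) (th0 del : R) : set R[i] :=
  [set rho | exists r th : R,
     [/\ 0 <= r, `|th - th0| < del & rho = rhoc + r%:C * cis th]].

(* Neither a change of the argument [tha] of [a] by a multiple of [2 * pi]    *)
(* nor a change of sign of [a] affects this set.                              *)
Definition cusp_bisector (R : realType) (rhoc a : R[i]) : set R[i] :=
  [set rho | exists2 tha : R, a = (Normc.normc a)%:C * cis tha
                            & ray rhoc (pi - 2 * tha) rho].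

(* Main.v *)
(* Conjugating [a - b K_n(rho)] by the unit lower bidiagonal matrix with [- rho]
   below the diagonal makes it tridiagonal. For [rho = i y] and the pencil
   [a = (1 + y^2) v], [b = (1 - y^2) v + y (v^2 - 1)], whose determinant vanishes
   iff [a / b] is an eigenvalue, the resulting three-term recursion has the roots
   [1] and [- v^2] up to scaling, and for odd [n] the determinant factors through
   [phi(v, y) = v^(n+1) + 1 - y (v^n - v)]. At [y = y_n] the point
   [u = x_n + sqrt (x_n^2 - 1)] is a double zero of [phi(_, y)], and [a / b = - n]
   there. With [rho = i y_n + z^2] the zero near [u] is a power series in [z]: it is
   the fixed point of a polynomial iteration, whose iterates stabilise
   coefficientwise and stay bounded in the norm [sum |p_k| r^k]. Writing it as
   [u exp (d1 z + d2 z^2 + d3 z^3 + ...)] makes all powers of [v] explicit and gives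
   the first two Puiseux coefficients. The modulus statements follow from
   [|1 + A + B| = 1 + Re A + Re B + (Im A)^2 / 2 + O(t^3)] for [A = O(t)],
   [B = O(t^2)], and the denominator in (3) does not vanish near the bisector
   because [a_n^2 < 2 b_n]. *)

Require Import Defs.
From HB Require Import structures.
From mathcomp Require Import all_boot all_order all_algebra.
From mathcomp Require Import all_classical all_reals all_analysis.
From mathcomp Require Import complex.
From mathcomp Require Import ring lra zify.

Set Implicit Arguments.
Unset Strict Implicit.
Unset Printing Implicit Defensive.

Import Order.TTheory GRing.Theory Num.Theory.
Import numFieldNormedType.Exports.

Local Open Scope classical_set_scope.
Local Open Scope complex_scope.
Local Open Scope ring_scope.

(** The pencil is the classical parametrization in disguise: [a / b] equals
    [(1 - rho^2) / (1 - 2 rho cos t + rho^2)] for [rho = i y] and [exp (i t) = i v], so [v] and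
    [- v^-1] give the same eigenvalue. Keeping [a] and [b] apart makes everything polynomial in [v],
    and multiplicities in [v] can be compared with those of the characteristic polynomial. At the
    critical point the double-zero conditions express both [n] and [y] as rational functions of [u]
    and [V = u^n]. The exponent then survives only as a field element, and the values of the Puiseux
    coefficients reduce to rational identities in [u] and [V], although [n] is arbitrary. Knowing
    two eigenvalue branches is not enough: the definition of the pair also excludes every other
    eigenvalue from a fixed disc. This is obtained from a size comparison at a single point instead
    of continuity of roots. Likewise, analyticity is handled through explicit geometric remainder
    bounds, which are stable under products and yield the error terms of order 3/2 directly. *)

Local Notation N := Normc.normc.

(** * The modulus on complex numbers *)

Lemma normc_ge0 (R : rcfType) (z : R[i]) : 0 <= N z.
Proof. by case: z => a b; rewrite sqrtr_ge0. Qed.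

Lemma normc_eq0 (R : rcfType) (z : R[i]) : (N z == 0) = (z == 0).
Proof.
by apply/eqP/eqP => [/Normc.eq0_normc//|->]; rewrite Normc.normc0.
Qed.

Lemma normc_gt0 (R : rcfType) (z : R[i]) : (0 < N z) = (z != 0).
Proof. by rewrite lt0r normc_eq0 normc_ge0 andbT. Qed.

Lemma normcX (R : rcfType) (z : R[i]) k : N (z ^+ k) = N z ^+ k.
Proof.
by elim: k => [|k IH]; rewrite ?expr0 ?Normc.normc1// !exprS Normc.normcM IH.
Qed.

Lemma normc_real (R : rcfType) (r : R) : N r%:C = `|r|.
Proof. by rewrite /= expr0n /= addr0 sqrtr_sqr. Qed.

Lemma normc_triangle (R : rcfType) (x y : R[i]) : N (x + y) <= N x + N y.
Proof. exact: le_normcD. Qed.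

Lemma normcB_sym (R : rcfType) (x y : R[i]) : N (x - y) = N (y - x).
Proof. by rewrite -[x - y]opprB normcN. Qed.

Lemma normc_triangleB (R : rcfType) (x y : R[i]) : N x <= N y + N (x - y).
Proof. by rewrite -{1}(subrK y x) addrC normc_triangle. Qed.

Lemma normc_sum (R : rcfType) (I : Type) (r : seq I) (P : pred I) (F : I -> R[i]) :
  N (\sum_(i <- r | P i) F i) <= \sum_(i <- r | P i) N (F i).
Proof.
elim/big_rec2: _ => [|i y x _ IH]; first by rewrite Normc.normc0.
by apply: le_trans (normc_triangle _ _) _; rewrite lerD2l.
Qed.

(** * Power series near the origin *)

Definition near0 (R : realType) (P : R[i] -> Prop) :=
  exists2 d : R, 0 < d & forall z, N z < d -> P z.

Lemma near0W (R : realType) (P Q : R[i] -> Prop) :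
  (forall z, P z -> Q z) -> near0 P -> near0 Q.
Proof. by move=> h [d d0 hd]; exists d => // z /hd /h. Qed.

Lemma near0_and (R : realType) (P Q : R[i] -> Prop) :
  near0 P -> near0 Q -> near0 (fun z => P z /\ Q z).
Proof.
move=> [d d0 hd] [e e0 he]; exists (Num.min d e); first by rewrite lt_min d0 e0.
by move=> z; rewrite lt_min => /andP[/hd ? /he ?].
Qed.

Lemma near0_lt (R : realType) (e : R) : 0 < e -> near0 (fun z => N z < e).
Proof. by move=> e0; exists e. Qed.

Definition psum (R : realType) (c : nat -> R[i]) n z := \sum_(k < n) c k * z ^+ k.

(* Quantitative way of saying that [\sum_k c k * z^k] has a positive radius of
   convergence and that its sum is [f] near [0]. *)
Definition power_series (R : realType) (c : nat -> R[i]) (f : R[i] -> R[i]) :=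
  exists S B : R, [/\ 0 < S, 0 <= B & forall n z, S * N z <= 1 ->
    N (f z - psum c n z) <= B * (S * N z) ^+ n].

Definition cauchy (R : realType) (c d : nat -> R[i]) k :=
  \sum_(i < k.+1) c i * d (k - i)%N.

Section PowerSeries.
Context {R : realType}.
Implicit Types (c d : nat -> R[i]) (f g : R[i] -> R[i]) (S B : R).

Lemma psumS c n z : psum c n.+1 z = psum c n z + c n * z ^+ n.
Proof. by rewrite /psum big_ord_recr. Qed.

Lemma psum0 c z : psum c 0 z = 0.
Proof. by rewrite /psum big_ord0. Qed.

Lemma power_series_widen c f S B S' B' :
  0 < S -> 0 <= B -> S <= S' -> B <= B' ->
  (forall n z, S * N z <= 1 -> N (f z - psum c n z) <= B * (S * N z) ^+ n) ->
  forall n z, S' * N z <= 1 -> N (f z - psum c n z) <= B' * (S' * N z) ^+ n.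
Proof.
move=> S0 B0 SS BB h n z hz.
have le : S * N z <= S' * N z by rewrite ler_wpM2r ?normc_ge0.
have n0 : 0 <= S * N z by rewrite mulr_ge0 ?normc_ge0 // ltW.
apply: le_trans (h n z (le_trans le hz)) _.
by apply: ler_pM => //; [rewrite exprn_ge0|rewrite lerXn2r ?nnegrE// (le_trans n0)].
Qed.

Lemma power_series_common c f d g : power_series c f -> power_series d g ->
  exists S B, [/\ 0 < S, 0 <= B,
    (forall n z, S * N z <= 1 -> N (f z - psum c n z) <= B * (S * N z) ^+ n) &
    (forall n z, S * N z <= 1 -> N (g z - psum d n z) <= B * (S * N z) ^+ n)].
Proof.
move=> [S [B [S0 B0 h]]] [S' [B' [S0' B0' h']]].
exists (Num.max S S'), (Num.max B B'); split.
- by rewrite lt_max S0.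
- by rewrite le_max B0.
- by apply: (power_series_widen S0 B0 _ _ h); rewrite le_max lexx.
- by apply: (power_series_widen S0' B0' _ _ h'); rewrite le_max lexx orbT.
Qed.

(** The term [c k * z^k] is the difference of two consecutive remainders; evaluate it at
    [|z| = 1 / S]. *)
Lemma power_series_coef c f S B : 0 < S ->
  (forall n z, S * N z <= 1 -> N (f z - psum c n z) <= B * (S * N z) ^+ n) ->
  forall k, N (c k) <= 2 * B * S ^+ k.
Proof.
move=> S0 h k; pose z : R[i] := (S^-1)%:C.
have nz : S * N z = 1 by rewrite normc_real gtr0_norm ?invr_gt0// divff ?gt_eqF.
have := h k z; have := h k.+1 z; rewrite nz lexx !expr1n mulr1 => /(_ isT) h1 /(_ isT) h2.
have : N (c k * z ^+ k) <= 2 * B.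
  have -> : c k * z ^+ k = (f z - psum c k z) - (f z - psum c k.+1 z).
    by rewrite psumS; ring.
  rewrite mulr_natl mulr2n; apply: le_trans (normc_triangle _ _) _.
  by rewrite normcN lerD.
rewrite Normc.normcM normcX (_ : N z = S^-1); last first.
  by rewrite normc_real gtr0_norm ?invr_gt0.
by rewrite exprVn ler_pdivrMr ?exprn_gt0.
Qed.

Lemma power_series_near c f g : near0 (fun z => f z = g z) ->
  power_series c f -> power_series c g.
Proof.
move=> [e e0 he] [S [B [S0 B0 h]]].
have h' := power_series_widen S0 B0 (_ : S <= Num.max S (2 / e)) (lexx B) h.
(* Raising the constant to [2 / e] confines [z] to [|z| <= e / 2], inside the disc where [f] and [g]
   agree. *)
exists (Num.max S (2 / e)), B; split => //; first by rewrite lt_max S0.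
move=> n z hz; rewrite -he ?h' ?le_max ?lexx//.
have : 2 / e * N z <= 1.
  by apply: le_trans hz; rewrite ler_wpM2r ?normc_ge0// le_max lexx orbT.
rewrite mulrAC ler_pdivrMr// mul1r => h2.
by have := normc_ge0 z; lra.
Qed.

Lemma power_series_jet c f n : power_series c f ->
  exists2 M : R, 0 <= M & near0 (fun z => N (f z - psum c n z) <= M * N z ^+ n).
Proof.
move=> [S [B [S0 B0 h]]]; exists (B * S ^+ n).
  by rewrite mulr_ge0 ?exprn_ge0 // ltW.
exists S^-1; first by rewrite invr_gt0.
move=> z hz; rewrite -mulrA -exprMn h// -ler_pdivlMl// mulr1; exact: ltW.
Qed.

Lemma power_series_cont c f e : 0 < e -> power_series c f ->
  near0 (fun z => N (f z - c 0%N) < e).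
Proof.
move=> e0 /(power_series_jet 1)[M M0 hM].
have e1 : 0 < e / (M + 1) by apply: divr_gt0 => //; lra.
apply: near0W (near0_and hM (near0_lt e1)) => z [].
rewrite /psum big_ord1 expr0 mulr1 expr1 => h1.
rewrite ltr_pdivlMr; last by lra.
have := normc_ge0 z; nra.
Qed.

Lemma power_series_neq0 c f : c 0%N != 0 -> power_series c f ->
  near0 (fun z => f z != 0).
Proof.
rewrite -normc_gt0 => c0 /(power_series_cont c0).
apply: near0W => z; apply: contraTneq => ->.
by rewrite sub0r normcN ltxx.
Qed.

Lemma power_series_at0 c f : power_series c f -> f 0 = c 0%N.
Proof.
move=> [S [B [S0 B0 /(_ 1%N 0)]]].
rewrite Normc.normc0 mulr0 ler01 => /(_ isT).
rewrite /psum big_ord1 expr0 !mulr1 expr1 mulr0 => h.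
apply/eqP; rewrite -subr_eq0 -normc_eq0 eq_le h; exact: normc_ge0.
Qed.

Lemma power_series0 : power_series (fun=> 0) (fun=> 0 : R[i]).
Proof.
exists 1, 0; split => // n z _.
by rewrite /psum big1 ?subrr ?Normc.normc0 ?mul0r// => i _; rewrite mul0r.
Qed.

Lemma power_series_cst (a : R[i]) :
  power_series (fun k => if k == 0%N then a else 0) (fun=> a).
Proof.
exists 1, (N a); split=> [//||n z hz]; first exact: normc_ge0.
case: n => [|n]; first by rewrite psum0 subr0 expr0 mulr1.
rewrite /psum big_ord_recl /= expr0 mulr1 big1 ?addr0 ?subrr ?Normc.normc0.
  by rewrite mulr_ge0 ?exprn_ge0 ?mulr_ge0 ?normc_ge0.
by move=> i _; rewrite mul0r.
Qed.

Lemma power_series_id :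
  power_series (fun k => if k == 1%N then 1 else 0) (fun z => z : R[i]).
Proof.
exists 1, 1; split=> // n z; rewrite !mul1r => hz.
case: n => [|[|n]]; first by rewrite psum0 subr0 expr0.
  by rewrite psumS psum0 !mul0r addr0 subr0 expr1.
rewrite /psum 2!big_ord_recl /= mul0r add0r expr1 mul1r big1 ?addr0 ?subrr.
  by rewrite Normc.normc0 exprn_ge0 ?normc_ge0.
by move=> i _; rewrite mul0r.
Qed.

Lemma power_seriesD c d f g : power_series c f -> power_series d g ->
  power_series (fun k => c k + d k) (fun z => f z + g z).
Proof.
move=> hc /(power_series_common hc)[S [B [S0 B0 h h']]].
exists S, (B + B); split => // [|n z hz]; first exact: addr_ge0.
rewrite (_ : psum _ n z = psum c n z + psum d n z); last first.
  by rewrite /psum -big_split; apply: eq_bigr => i _; rewrite mulrDl.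
rewrite opprD addrACA mulrDl.
by apply: le_trans (normc_triangle _ _) (lerD (h _ _ hz) (h' _ _ hz)).
Qed.

Lemma psum_cauchy c d n z :
  psum (cauchy c d) n z = \sum_(i < n) c i * z ^+ i * psum d (n - i) z.
Proof.
elim: n => [|n IH]; first by rewrite psum0 big_ord0.
rewrite psumS IH [RHS]big_ord_recr /= subSnn psumS psum0 add0r expr0 mulr1.
rewrite /cauchy big_ord_recr /= subnn mulrDl addrA; congr (_ + _); last by ring.
rewrite mulr_suml -big_split; apply: eq_bigr => i _ /=.
rewrite subSn 1?ltnW // psumS mulrDr; congr (_ + _).
have -> : z ^+ n = z ^+ i * z ^+ (n - i) by rewrite -exprD subnKC // ltnW.
by ring.
Qed.

(** Lets the doubled rate in [power_seriesM] absorb a number of terms that grows linearly with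
    [n]. *)
Lemma natr_le_exp2 n : (n.*2.+1)%:R <= 4 * 2 ^+ n :> R.
Proof.
elim: n => [|n IH]; first by rewrite expr0 mulr1 ler_nat.
rewrite (_ : n.+1.*2.+1 = n.*2.+1 + 2)%N ?natrD ?exprS; last by lia.
have : 1 <= 2 ^+ n :> R by rewrite exprn_ege1 // ler1n.
by lra.
Qed.

(** The remainder of the product is the remainder of [f] times [g], plus the terms [c i * z^i] times
    the remainder of [g] of order [n - i]. All these pieces have size [(S |z|)^n]; their number is
    paid for by doubling [S]. *)
Lemma power_seriesM c d f g : power_series c f -> power_series d g ->
  power_series (cauchy c d) (fun z => f z * g z).
Proof.
move=> hc /(power_series_common hc)[S [B [S0 B0 h h']]].
exists (2 * S), (4 * (B * B)); split => [||n z hz].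
- by rewrite mulr_gt0.
- by rewrite !mulr_ge0.
have nz0 := normc_ge0 z.
have hz' : S * N z <= 1 by apply: le_trans hz; rewrite -mulrA; nra.
have q0 : 0 <= S * N z by rewrite mulr_ge0 // ltW.
have gB : N (g z) <= B by have := h' 0%N z hz'; rewrite psum0 subr0 expr0 mulr1.
have -> : f z * g z - psum (cauchy c d) n z = (f z - psum c n z) * g z
    + \sum_(i < n) c i * z ^+ i * (g z - psum d (n - i) z).
  rewrite psum_cauchy; under [in RHS]eq_bigr do rewrite mulrBr.
  by rewrite sumrB -mulr_suml -/(psum c n z); ring.
apply: (@le_trans _ _ (B * (S * N z) ^+ n * B
    + \sum_(i < n) 2 * B * B * (S * N z) ^+ n)).
  apply: le_trans (normc_triangle _ _) (lerD _ _).
    by rewrite Normc.normcM ler_pM ?normc_ge0 ?h.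
  apply: le_trans (normc_sum _ _ _) (ler_sum _ _) => i _.
  have := h' (n - i)%N z hz'; have := power_series_coef S0 h i.
  rewrite !Normc.normcM normcX => h1 h2.
  have -> : (S * N z) ^+ n = (S * N z) ^+ i * (S * N z) ^+ (n - i).
    by rewrite -exprD subnKC // ltnW.
  rewrite [leRHS](_ : _ = (2 * B * S ^+ i * N z ^+ i) * (B * (S * N z) ^+ (n - i))).
    by apply: ler_pM; rewrite ?mulr_ge0 ?exprn_ge0 ?normc_ge0// ler_wpM2r ?exprn_ge0.
  by rewrite exprMn; ring.
rewrite sumr_const card_ord -(mulr_natl _ n).
have -> : (2 * S * N z) ^+ n = 2 ^+ n * (S * N z) ^+ n.
  by rewrite -exprMn mulrA.
have := natr_le_exp2 n; rewrite -addn1 -muln2 natrD natrM => hn.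
have : 0 <= B * B * (S * N z) ^+ n by rewrite !mulr_ge0 ?exprn_ge0.
set X := B * B * _ => X0.
rewrite [leLHS](_ : _ = X * (n%:R * 2 + 1)); last by rewrite /X; ring.
rewrite [leRHS](_ : _ = X * (4 * 2 ^+ n)); last by rewrite /X; ring.
exact: ler_wpM2l.
Qed.

(** At the least index [k] where they could differ, the difference times [t^k] is a difference of
    two remainders of order [k + 1], hence at most [M t t^k] for every small [t]. *)
Lemma power_series_uniq c d f : power_series c f -> power_series d f -> c =1 d.
Proof.
move=> hc /(power_series_common hc)[S [B [S0 B0 h h']]].
elim/ltn_ind => k IH; apply/eqP; rewrite -subr_eq0 -normc_eq0 eq_le normc_ge0 andbT.
have E z : psum c k z = psum d k z by apply: eq_bigr => i _; rewrite IH.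
apply/ler_addgt0Pl => e e0; rewrite addr0.
pose M := 2 * B * S ^+ k.+1.
have M0 : 0 <= M by rewrite !mulr_ge0 ?exprn_ge0 // ltW.
pose t : R := Num.min S^-1 (e / (M + 1)).
have t0 : 0 < t by rewrite lt_min invr_gt0 S0 divr_gt0//; lra.
have Nt : N t%:C = t by rewrite normc_real gtr0_norm.
have St : S * N t%:C <= 1 by rewrite Nt -ler_pdivlMl// mulr1 ge_min lexx.
have : N ((c k - d k) * t%:C ^+ k) <= M * t * t ^+ k.
  have -> : (c k - d k) * t%:C ^+ k
      = (f t%:C - psum d k.+1 t%:C) - (f t%:C - psum c k.+1 t%:C).
    by rewrite !psumS E; ring.
  apply: le_trans (normc_triangle _ _) _; rewrite normcN.
  apply: le_trans (lerD (h' _ _ St) (h _ _ St)) _.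
  by rewrite Nt exprMn /M (exprS t); lra.
rewrite Normc.normcM normcX Nt ler_pM2r ?exprn_gt0// => /le_trans; apply.
have : t <= e / (M + 1) by rewrite /t ge_min lexx orbT.
rewrite ler_pdivlMr; last by lra.
nra.
Qed.

End PowerSeries.

(** * Convergence of geometrically bounded series *)

Lemma le0_of_exp2 (R : realType) (x K : R) : (forall j, x * 2 ^+ j <= K) -> x <= 0.
Proof.
move=> h; rewrite leNgt; apply/negP => x0.
have K0 : 0 <= K by apply: le_trans (h 0%N); rewrite expr0 mulr1 ltW.
have := archi_boundP (divr_ge0 K0 (ltW x0)); set b := Num.bound _ => hb.
have := h b; rewrite leNgt => /negP; apply.
rewrite -ltr_pdivrMl// mulrC; apply: lt_trans hb _.
by rewrite -natrX ltr_nat ltn_expl.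
Qed.

Lemma normc_ge_absRe (R : rcfType) (z : R[i]) : `|complex.Re z| <= N z.
Proof.
case: z => a b /=; rewrite -sqrtr_sqr; apply: ler_wsqrtr.
by rewrite lerDl sqr_ge0.
Qed.

Lemma normc_ge_absIm (R : rcfType) (z : R[i]) : `|complex.Im z| <= N z.
Proof.
case: z => a b /=; rewrite -sqrtr_sqr; apply: ler_wsqrtr.
by rewrite lerDr sqr_ge0.
Qed.

Lemma normc_le_ReIm (R : rcfType) (z : R[i]) :
  N z <= `|complex.Re z| + `|complex.Im z|.
Proof.
case: z => a b /=; rewrite -[leRHS]ger0_norm ?addr_ge0// -(sqrtr_sqr (`|a| + `|b|)).
apply: ler_wsqrtr; rewrite sqrrD !real_normK ?num_real//.
by rewrite lerD2r lerDl mulrn_wge0// mulr_ge0.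
Qed.

Lemma Re_sum (R : rcfType) n (F : 'I_n -> R[i]) :
  complex.Re (\sum_(i < n) F i) = \sum_(i < n) complex.Re (F i).
Proof. by apply: (big_morph (@complex.Re R)) => // [[a b] [a' b']]. Qed.

Lemma Im_sum (R : rcfType) n (F : 'I_n -> R[i]) :
  complex.Im (\sum_(i < n) F i) = \sum_(i < n) complex.Im (F i).
Proof. by apply: (big_morph (@complex.Im R)) => // [[a b] [a' b']]. Qed.

(** The intervals of centre [s n] and radius [e n] are nested because [2 q <= 1]; the supremum of
    their left ends lies in all of them. *)
Lemma geometric_tail (R : realType) (a : nat -> R) (B q : R) :
  0 <= B -> 0 <= q -> 2 * q <= 1 -> (forall k, `|a k| <= B * q ^+ k) ->
  exists l, forall n, `|l - \sum_(k < n) a k| <= 2 * B * q ^+ n.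
Proof.
move=> B0 q0 q1 h; pose s n := \sum_(k < n) a k; pose e n := 2 * B * q ^+ n.
have e0 n : 0 <= e n by rewrite /e !mulr_ge0 ?exprn_ge0.
have step n j : `|s (n + j)%N - s n| <= e n - e (n + j)%N.
  elim: j => [|j IH]; first by rewrite addn0 !subrr normr0.
  rewrite addnS /s big_ord_recr /= -/(s _).
  have -> : s (n + j)%N + a (n + j)%N - s n = (s (n + j)%N - s n) + a (n + j)%N by ring.
  apply: le_trans (ler_normD _ _) _; apply: le_trans (lerD IH (h _)) _.
  have Q0 := exprn_ge0 (n + j) q0.
  have : 0 <= B * q ^+ (n + j) * (1 - 2 * q) by rewrite !mulr_ge0// subr_ge0.
  by rewrite /e exprS; lra.
have cross n m : s n - e n <= s m + e m.
  case: (leqP n m) => hnm.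
    have := step n (m - n)%N; rewrite subnKC // ler_norml => /andP[].
    by have := e0 m; lra.
  have := step m (n - m)%N; rewrite subnKC 1?ltnW // ler_norml => /andP[].
  by have := e0 n; lra.
pose A := [set s n - e n | n in [set: nat]].
have hA : has_sup A.
  split; first by exists (s 0%N - e 0%N), 0%N.
  by exists (s 0%N + e 0%N) => _ [n _ <-].
exists (sup A) => n; rewrite ler_norml -/(s n) -/(e n).
have h1 : s n - e n <= sup A by apply: sup_upper_bound => //; exists n.
have h2 : sup A <= s n + e n by apply: ge_sup => [|_ [m _ <-]]; [case: hA|].
by lra.
Qed.

Lemma geometric_tailC (R : realType) (a : nat -> R[i]) (B q : R) :
  0 <= B -> 0 <= q -> 2 * q <= 1 -> (forall k, N (a k) <= B * q ^+ k) ->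
  exists l, forall n, N (l - \sum_(k < n) a k) <= 4 * B * q ^+ n.
Proof.
move=> B0 q0 q1 h.
have [l hl] := geometric_tail B0 q0 q1 (fun k => le_trans (normc_ge_absRe _) (h k)).
have [l' hl'] := geometric_tail B0 q0 q1 (fun k => le_trans (normc_ge_absIm _) (h k)).
exists (l +i* l') => n; apply: le_trans (normc_le_ReIm _) _.
have -> : complex.Re (l +i* l' - \sum_(k < n) a k) = l - \sum_(k < n) complex.Re (a k).
  by rewrite -Re_sum; case: (\sum_(k < n) a k).
have -> : complex.Im (l +i* l' - \sum_(k < n) a k) = l' - \sum_(k < n) complex.Im (a k).
  by rewrite -Im_sum; case: (\sum_(k < n) a k).
by have := hl n; have := hl' n; lra.
Qed.

Section Convergence.
Context {R : realType}.
Implicit Types (c d : nat -> R[i]) (f g : R[i] -> R[i]) (S B : R).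

Lemma bounded_power_series c S B : 0 < S -> 0 <= B ->
  (forall k, N (c k) <= B * S ^+ k) -> exists f, power_series c f.
Proof.
move=> S0 B0 h.
have : forall z : R[i], exists l, 2 * S * N z <= 1 ->
    forall n, N (l - psum c n z) <= 4 * B * (S * N z) ^+ n.
  (* Outside the disc the sum receives the default value 0, so that a total function can be
     chosen. *)
  move=> z; have [hz|hz] := leP (2 * S * N z) 1; last first.
    by exists 0.
  have q0 : 0 <= S * N z by rewrite mulr_ge0 ?normc_ge0// ltW.
  rewrite -mulrA in hz.
  have [|l hl] := geometric_tailC (a := fun k => c k * z ^+ k) B0 q0 hz.
    move=> k; rewrite Normc.normcM normcX exprMn mulrA.
    by rewrite ler_wpM2r ?exprn_ge0 ?normc_ge0.
  by exists l.
move=> /choice [f hf]; exists f, (2 * S), (4 * B); split => [||n z hz].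
- by rewrite mulr_gt0.
- by rewrite mulr_ge0.
apply: le_trans (hf z hz n) _; rewrite ler_wpM2l ?mulr_ge0//.
have nz0 := normc_ge0 z; have p : 0 <= S * N z by rewrite mulr_ge0// ltW.
by rewrite lerXn2r ?nnegrE// -?mulrA; nra.
Qed.

(** The topology of [R[i]] quantifies over positive complex radii, that is, positive reals embedded
    in [R[i]]; this brings the radii back to [R]. *)
Lemma cvgcP (u : nat -> R[i]^o) (l : R[i]^o) :
  (u @ \oo --> l) <->
  (forall e : R, 0 < e -> exists K, forall n, (K <= n)%N -> N (l - u n) < e).
Proof.
split=> [/cvgrPdist_lt h e e0|h].
  have /(h e%:C)[K _ hK] : 0 < e%:C by rewrite ltcR.
  by exists K => n /hK /=; rewrite ltcR.
apply/cvgrPdist_lt => e; rewrite ltcE /= => /andP[/eqP ei er].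
have [K hK] := h _ er; exists K => // n /= /hK; rewrite -ltcR.
by rewrite (_ : (complex.Re e)%:C = e)//; case: e ei {er hK} => ? ? /= ->.
Qed.

Lemma power_series_cvg c f : power_series c f ->
  near0 (fun z => series (fun k => c k * z ^+ k : R[i]^o) @ \oo --> (f z : R[i]^o)).
Proof.
move=> [S [B [S0 B0 h]]]; exists (2 * S)^-1; first by rewrite invr_gt0 mulr_gt0.
move=> z hz; apply/cvgcP => e e0.
have nz0 := normc_ge0 z.
have hz1 : 2 * (S * N z) <= 1.
  by rewrite mulrA -ler_pdivlMl ?mulr_gt0// mulr1 ltW.
have q0 : 0 <= S * N z by rewrite mulr_ge0// ltW.
pose K := Num.bound (B / e); exists K => n hn.
rewrite (_ : series _ n = psum c n z); last by rewrite /series /= big_mkord.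
apply: le_lt_trans (h n z _) _; first by lra.
have hK : B / e < K%:R by apply: archi_boundP; rewrite divr_ge0// ltW.
rewrite ltr_pdivrMr // in hK.
have h2 : (S * N z) ^+ n * 2 ^+ n <= 1 by rewrite -exprMn mulrC exprn_ile1 // mulr_ge0.
have h3 : K%:R < 2 ^+ n :> R.
  by rewrite -natrX ltr_nat (leq_trans (ltn_expl K (isT : (1 < 2)%N)))// leq_exp2l.
rewrite -(ltr_pM2r (_ : 0 < 2 ^+ n)) ?exprn_gt0// -mulrA.
apply: (@le_lt_trans _ _ B); first by rewrite ler_piMr.
by apply: lt_trans hK _; rewrite mulrC ltr_pM2l.
Qed.

(** Convergence at the single point [del / 2] bounds the terms there, hence the coefficients
    geometrically. The resulting sum is identified with [f] by uniqueness of limits. *)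
Lemma cvg_power_series c f (del : R) : 0 < del ->
  (forall z, N z < del ->
    series (fun k => c k * z ^+ k : R[i]^o) @ \oo --> (f z : R[i]^o)) ->
  power_series c f.
Proof.
move=> d0 h; pose t : R := del / 2; have t0 : 0 < t by rewrite divr_gt0.
have Nt : N t%:C = t by rewrite normc_real gtr0_norm.
have /h/cvgcP/(_ 1 ltr01)[K hK] : N t%:C < del by rewrite Nt /t; lra.
pose a k := c k * t%:C ^+ k.
have ha k : N (a k) <= \sum_(i < K) N (a i) + 2.
  have [hk|hk] := ltnP k K.
    rewrite (bigD1 (Ordinal hk)) //= -addrA lerDl addr_ge0 //.
    by apply: sumr_ge0 => *; exact: normc_ge0.
  have -> : a k = (f t%:C - series (fun k => c k * t%:C ^+ k : R[i]^o) k)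
      - (f t%:C - series (fun k => c k * t%:C ^+ k : R[i]^o) k.+1).
    by rewrite /series /= big_nat_recr //= /a; ring.
  have h1 := hK _ hk; have h2 := hK _ (leqW hk).
  apply: le_trans (normc_triangle _ _) _; rewrite normcN.
  have : 0 <= \sum_(i < K) N (a i) by apply: sumr_ge0 => *; exact: normc_ge0.
  by lra.
have [||k|g hg] := @bounded_power_series c t^-1 (\sum_(i < K) N (a i) + 2).
- by rewrite invr_gt0.
- by rewrite addr_ge0// sumr_ge0// => *; exact: normc_ge0.
- rewrite exprVn ler_pdivlMr ?exprn_gt0//; apply: le_trans (ha k).
  by rewrite /a Normc.normcM normcX Nt.
apply: power_series_near (hg).
apply: near0W (near0_and (power_series_cvg hg) (near0_lt d0)) => z [hz /h hz'].
by apply: cvg_unique hz hz'; exact: norm_hausdorff.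
Qed.

End Convergence.

(** * The weighted coefficient norm on polynomials *)

Definition pnorm (R : realType) (r : R) (p : {poly R[i]}) : R :=
  \sum_(i < size p) N p`_i * r ^+ i.

Section PolyNorm.
Context {R : realType}.
Implicit Types (p q : {poly R[i]}) (r : R).

Lemma pnorm_widen r p n : (size p <= n)%N ->
  pnorm r p = \sum_(i < n) N p`_i * r ^+ i.
Proof.
move=> h; rewrite /pnorm (big_ord_widen n (fun i => N p`_i * r ^+ i)) // big_mkcond.
apply: eq_bigr => i _; case: ltnP => // hi.
by rewrite nth_default // Normc.normc0 mul0r.
Qed.

Lemma pnorm_ge0 r p : 0 <= r -> 0 <= pnorm r p.
Proof. by move=> r0; apply: sumr_ge0 => i _; rewrite mulr_ge0 ?normc_ge0 ?exprn_ge0. Qed.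

Lemma pnormC r a : pnorm r a%:P = N a.
Proof.
by rewrite (@pnorm_widen _ _ 1) ?size_polyC_leq1// big_ord1 coefC expr0 mulr1.
Qed.

Lemma pnormD r p q : 0 <= r -> pnorm r (p + q) <= pnorm r p + pnorm r q.
Proof.
move=> r0; pose n := maxn (size p) (size q).
rewrite (@pnorm_widen _ (p + q) n) ?size_polyD//.
rewrite (@pnorm_widen _ p n) ?leq_maxl// (@pnorm_widen _ q n) ?leq_maxr//.
rewrite -big_split; apply: ler_sum => i _ /=.
by rewrite coefD -mulrDl ler_wpM2r ?exprn_ge0// normc_triangle.
Qed.

Lemma pnormMX r p : pnorm r (p * 'X) = r * pnorm r p.
Proof.
rewrite (@pnorm_widen _ _ (size p).+1); last first.
  by apply: leq_trans (size_polyMleq _ _) _; rewrite size_polyX addn2.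
rewrite big_ord_recl coefMX /= [X in X * _ + _](_ : _ = 0) ?mul0r ?add0r; last first.
  exact: Normc.normc0.
rewrite mulr_sumr.
by apply: eq_bigr => i _; rewrite coefMX /= exprS; ring.
Qed.

Lemma pnormCM r a p : pnorm r (a%:P * p) = N a * pnorm r p.
Proof.
rewrite (@pnorm_widen _ _ (size p)); last by rewrite mul_polyC size_scale_leq.
by rewrite mulr_sumr; apply: eq_bigr => i _; rewrite coefCM Normc.normcM mulrA.
Qed.

Lemma pnormM r p q : 0 <= r -> pnorm r (p * q) <= pnorm r p * pnorm r q.
Proof.
move=> r0; elim/poly_ind: p => [|p a IH].
  by rewrite mul0r -{1 2}polyC0 !pnormC Normc.normc0 mul0r.
have -> : (p * 'X + a%:P) * q = p * q * 'X + a%:P * q by ring.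
have E : pnorm r (p * 'X + a%:P) = r * pnorm r p + N a.
  rewrite (@pnorm_widen _ _ (size p).+1); last first.
    apply: leq_trans (size_polyD _ _) _; rewrite geq_max.
    rewrite (leq_trans (size_polyC_leq1 _))// andbT.
    by apply: leq_trans (size_polyMleq _ _) _; rewrite size_polyX addn2.
  rewrite big_ord_recl coefD coefMX coefC /= add0r expr0 mulr1 addrC; congr (_ + _).
  rewrite mulr_sumr; apply: eq_bigr => i _.
  by rewrite coefD coefMX coefC /= addr0 exprS; ring.
apply: le_trans (pnormD _ _ r0) _.
rewrite pnormMX pnormCM E mulrDl lerD2r -mulrA; exact: ler_wpM2l.
Qed.

Lemma pnormX r p k : 0 <= r -> pnorm r (p ^+ k) <= pnorm r p ^+ k.
Proof.
move=> r0; elim: k => [|k IH]; first by rewrite !expr0 -polyC1 pnormC Normc.normc1.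
rewrite !exprS; apply: le_trans (pnormM _ _ r0) _.
by rewrite ler_wpM2l ?pnorm_ge0.
Qed.

Lemma pnorm_sum r n (F : 'I_n -> {poly R[i]}) : 0 <= r ->
  pnorm r (\sum_(i < n) F i) <= \sum_(i < n) pnorm r (F i).
Proof.
move=> r0; elim/big_rec2: _ => [|i y x _ IH].
  by rewrite -polyC0 pnormC Normc.normc0.
by apply: le_trans (pnormD _ _ r0) _; rewrite lerD2l.
Qed.

Lemma pnorm_horner r p z : N z <= r -> N p.[z] <= pnorm r p.
Proof.
move=> hz; rewrite horner_coef; apply: le_trans (normc_sum _ _ _) _.
apply: ler_sum => i _; rewrite Normc.normcM normcX ler_wpM2l ?normc_ge0//.
by rewrite lerXn2r ?nnegrE ?normc_ge0// (le_trans (normc_ge0 z)).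
Qed.

Lemma pnorm_coef r p k : 0 <= r -> N p`_k * r ^+ k <= pnorm r p.
Proof.
move=> r0; have [hk|hk] := ltnP k (size p); last first.
  by rewrite nth_default // Normc.normc0 mul0r pnorm_ge0.
rewrite /pnorm (bigD1 (Ordinal hk)) //= lerDl sumr_ge0// => i _.
by rewrite mulr_ge0 ?normc_ge0 ?exprn_ge0.
Qed.

Lemma pnorm_mono r r' p : 0 <= r -> r <= r' -> pnorm r p <= pnorm r' p.
Proof.
move=> r0 h; apply: ler_sum => i _; rewrite ler_wpM2l ?normc_ge0//.
by rewrite lerXn2r ?nnegrE// (le_trans r0).
Qed.

Lemma poly_coef0 (T : nzRingType) (p : {poly T}) : p`_0 = 0 -> exists q : {poly T}, p = q * 'X.
Proof.
move=> h; have /factor_theorem[q ->] : root p 0 by rewrite /root horner_coef0 h.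
by exists q; rewrite subr0.
Qed.

(** The factor [r] gained from a vanishing constant term is what lets the fixed-point iteration
    preserve a small ball. *)
Lemma pnorm_coef0 r p : 0 <= r -> r <= 1 -> p`_0 = 0 -> pnorm r p <= r * pnorm 1 p.
Proof.
move=> r0 r1 /poly_coef0[q ->]; rewrite !pnormMX mul1r ler_wpM2l//.
exact: pnorm_mono.
Qed.

Lemma pnorm_drop r p j : 0 <= r -> pnorm r (drop_poly j p) * r ^+ j <= pnorm r p.
Proof.
move=> r0; rewrite (@pnorm_widen _ (drop_poly j p) (size p)); last first.
  by rewrite size_drop_poly leq_subr.
rewrite (@pnorm_widen _ p (j + size p)) ?leq_addl// big_split_ord /=.
apply: ler_wpDl; first by apply: sumr_ge0 => i _; rewrite mulr_ge0 ?normc_ge0 ?exprn_ge0.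
rewrite mulr_suml; apply: ler_sum => i _.
rewrite coef_drop_poly addnC exprD le_eqVlt; apply/orP; left; apply/eqP; ring.
Qed.

(** In such an [H] the inner variable is the parameter [z] and the outer one the unknown:
    substituting a polynomial in [z] for the unknown commutes with fixing [z]. *)
Lemma horner2_eval (H : {poly {poly R[i]}}) p z :
  (H.[p]).[z] = (map_poly (horner_eval z) H).[p.[z]].
Proof. exact: (esym (horner_map (horner_eval z) H p)). Qed.

Lemma horner_taylor (T : comNzRingType) (H : {poly T}) (q e : T) :
  exists s, H.[q + e] = H.[q] + e * H^`().[q] + e ^+ 2 * s.
Proof.
elim/poly_ind: H => [|H a [s IH]]; first by exists 0; rewrite deriv0 !horner0; ring.
exists (s * (q + e) + H^`().[q]).
rewrite derivD derivM derivX derivC !hornerE IH; ring.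
Qed.

Lemma horner_lipschitz (P : {poly R[i]}) (M : R) : 0 <= M ->
  exists2 L : R, 0 <= L & forall a b, N a <= M -> N b <= M ->
    N (P.[a] - P.[b]) <= L * N (a - b).
Proof.
move=> M0; elim/poly_ind: P => [|P k [L L0 IH]].
  by exists 0 => // a b _ _; rewrite !horner0 subr0 Normc.normc0 mul0r.
exists (L * M + pnorm M P); first by rewrite addr_ge0 ?mulr_ge0 ?pnorm_ge0.
move=> a b ha hb; rewrite !hornerE.
have -> : P.[a] * a + k - (P.[b] * b + k) = (P.[a] - P.[b]) * a + P.[b] * (a - b).
  by ring.
apply: le_trans (normc_triangle _ _) _; rewrite !Normc.normcM mulrDl.
have h1 := IH a b ha hb; have h2 := pnorm_horner P hb.
have := normc_ge0 (a - b); have := normc_ge0 a; have := normc_ge0 (P.[a] - P.[b]).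
move=> n1 n2 n3; apply: lerD; last exact: ler_wpM2r.
rewrite [leRHS](_ : _ = L * N (a - b) * M); last by ring.
exact: ler_pM.
Qed.

End PolyNorm.

(** * Fixed points of polynomial maps *)

Section FixedPoint.
Context {R : realType}.
Context (H : {poly {poly R[i]}}) (H00 : H`_0`_0 = 0) (H10 : H`_1`_0 = 0).

Let p j := iter j (fun q => H.[q]) 0.

Let pS j : p j.+1 = H.[p j]. Proof. by []. Qed.

(** The iterates vanish at [z = 0], and so does the linear coefficient of [H]. Hence the derivative
    of [H] at an iterate is divisible by [z], and an error of order [z^(j+1)] becomes one of order
    [z^(j+2)]. *)
Let p_stable j : exists d : {poly R[i]}, p j.+1 = p j + d * 'X^(j.+1) /\ (p j)`_0 = 0.
Proof.
elim: j => [|j [d [E p0]]].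
  rewrite pS /p /= horner_coef0; have [d ->] := poly_coef0 H00.
  by exists d; rewrite add0r expr1 coefC.
have [s Hs] := horner_taylor H (p j) (d * 'X^(j.+1)).
have [t Ht] : exists t, H^`().[p j] = t * 'X.
  apply: poly_coef0; rewrite -horner_coef0 horner2_eval horner_coef0 p0.
  by rewrite horner_coef0 coef_map /= coef_deriv mulr1n /horner_eval horner_coef0.
exists (d * t + d ^+ 2 * 'X^j * s); split.
  by rewrite pS {1}E Hs -pS Ht !exprS; ring.
by rewrite E coefD p0 coefMXn /= addr0.
Qed.

Let c k := (p k)`_k.

Let p_coef j k : (k <= j)%N -> (p j)`_k = c k.
Proof.
elim: j => [|j IH]; first by rewrite leqn0 => /eqP ->.
rewrite leq_eqVlt => /predU1P[->//|]; rewrite ltnS => hk.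
by have [d [-> _]] := p_stable j; rewrite coefD coefMXn ltnS hk addr0 IH.
Qed.

(** The constants make [H] preserve the ball [pnorm r p <= b]: the coefficients of degree 0 and 1 in
    the unknown gain a factor [r], the higher powers of [p] contribute at most [b^2 = r], and
    [2 A r <= b]. *)
Let A : R := \sum_(k < size H) pnorm 1 H`_k.
Let b : R := (2 * (A + 1))^-1.
Let r := b ^+ 2.

Let A0 : 0 <= A. Proof. by apply: sumr_ge0 => i _; rewrite pnorm_ge0. Qed.
Let b0 : 0 < b. Proof. by rewrite invr_gt0 mulr_gt0// ltr_wpDl. Qed.
Let bA : 2 * A * b <= 1.
Proof. by rewrite /b ler_pdivrMr; have := A0; lra. Qed.
Let b1 : b <= 1.
Proof. by rewrite /b invf_le1; have := A0; lra. Qed.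
Let r0 : 0 < r. Proof. by rewrite exprn_gt0. Qed.
Let r1 : r <= 1. Proof. by rewrite exprn_ile1// ltW. Qed.

Let p_bounded j : pnorm r (p j) <= b.
Proof.
elim: j => [|j IH]; first by rewrite /p /= -polyC0 pnormC Normc.normc0 ltW.
have r0' := ltW r0; have b0' := ltW b0.
rewrite pS horner_coef; apply: le_trans (pnorm_sum _ r0') _.
apply: (@le_trans _ _ (\sum_(k < size H) pnorm 1 H`_k * (2 * r))); last first.
  rewrite -mulr_suml -/A /r expr2; have := bA; have := b0.
  rewrite (_ : A * _ = 2 * A * b * b); last by ring.
  by move=> ? ?; rewrite ler_piMl.
apply: ler_sum => k _; apply: le_trans (pnormM _ _ r0') _.
have hX : pnorm r (p j ^+ k) <= b ^+ k.
  apply: le_trans (pnormX _ _ r0') _.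
  by rewrite lerXn2r ?nnegrE ?pnorm_ge0.
apply: (@le_trans _ _ (pnorm r H`_k * b ^+ k)); first by rewrite ler_wpM2l ?pnorm_ge0.
have q0 : 0 <= pnorm 1 H`_k by rewrite pnorm_ge0.
case: (nat_of_ord k) {hX} q0 => [|[|m]] q0.
- rewrite expr0 mulr1; apply: le_trans (pnorm_coef0 r0' r1 H00) _; have := r0; nra.
- rewrite expr1; apply: (@le_trans _ _ (r * pnorm 1 H`_1 * b)).
    by rewrite ler_wpM2r// pnorm_coef0.
  have := b1; have : 0 <= r * pnorm 1 H`_1 by rewrite mulr_ge0.
  nra.
- apply: ler_pM; rewrite ?pnorm_ge0 ?exprn_ge0 ?pnorm_mono//.
  rewrite -addn2 exprD -/r ler_wpM2r//.
  by apply: (@le_trans _ _ 1); [rewrite exprn_ile1|rewrite ler1n].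
Qed.

Lemma fixed_point_power_series :
  exists c f, [/\ power_series c f, c 0%N = 0 :> R[i]
    & near0 (fun z => f z = (map_poly (horner_eval z) H).[f z])].
Proof.
have r0' := ltW r0.
have [||k|f hf] := @bounded_power_series R c r^-1 b.
- by rewrite invr_gt0.
- exact: ltW.
- rewrite exprVn ler_pdivlMr ?exprn_gt0//.
  exact: le_trans (pnorm_coef _ _ r0') (p_bounded k).
exists c, f; split => //; first by rewrite /c /p /= coef0.
have [S [B [S0 B0 h]]] := hf.
exists (Num.min (r / 2) (2 * S)^-1).
  by rewrite lt_min divr_gt0//= invr_gt0 mulr_gt0.
move=> z; rewrite lt_min => /andP[z1 z2].
have nz0 := normc_ge0 z.
have S0' := ltW S0.
have z1' : N z / r * 2 <= 1 by rewrite mulrAC ler_pdivrMr//; lra.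
have z2' : S * N z * 2 <= 1.
  by move/ltW: z2; rewrite -[_^-1]mulr1 ler_pdivlMl ?mulr_gt0//; lra.
have q0 : 0 <= S * N z by rewrite mulr_ge0.
(* [f] and the [j]-th iterate share their first [j] coefficients. Both tails shrink like [2^-j],
   since [|z|] is at most half of either radius; this allows passing to the limit in the
   iteration. *)
have eps j : N (f z - (p j).[z]) * 2 ^+ j <= B + b.
  have -> : f z - (p j).[z] = (f z - psum c j z) - ((drop_poly j (p j)).[z] * z ^+ j).
    rewrite -{1}(poly_take_drop j (p j)) hornerD hornerM hornerXn.
    rewrite (_ : (take_poly j (p j)).[z] = psum c j z); first by ring.
    rewrite (@horner_coef_wide _ j) ?size_take_poly//; apply: eq_bigr => i _.
    by rewrite coef_take_poly ltn_ord p_coef // ltnW.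
  have h1 : N (f z - psum c j z) * 2 ^+ j <= B.
    apply: (@le_trans _ _ (B * (S * N z) ^+ j * 2 ^+ j)).
      by rewrite ler_wpM2r ?exprn_ge0// h//; lra.
    by rewrite -mulrA -exprMn ler_piMr// exprn_ile1// mulr_ge0.
  have h2 : N ((drop_poly j (p j)).[z] * z ^+ j) * 2 ^+ j <= b.
    rewrite Normc.normcM normcX.
    apply: (@le_trans _ _ (pnorm r (drop_poly j (p j)) * r ^+ j * (N z / r * 2) ^+ j)).
      have E : r ^+ j * (N z / r * 2) ^+ j = N z ^+ j * 2 ^+ j.
        by rewrite -exprMn mulrA mulrCA divff ?gt_eqF// mulr1 exprMn.
      rewrite -[leRHS]mulrA E mulrA !ler_wpM2r ?exprn_ge0// pnorm_horner//.
      by apply: le_trans (ltW z1) _; have := r0; lra.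
    apply: le_trans (p_bounded j); apply: le_trans (pnorm_drop (p j) j r0').
    apply: ler_piMr; first by apply: mulr_ge0; [exact: pnorm_ge0|exact: exprn_ge0].
    by apply: exprn_ile1 => //; rewrite mulr_ge0// divr_ge0.
  apply: le_trans (ler_wpM2r _ (normc_triangle _ _)) _; first by rewrite exprn_ge0.
  by rewrite normcN mulrDl lerD.
have K0 : 0 <= B + b by rewrite addr_ge0// ltW.
pose P := map_poly (horner_eval z) H; rewrite -/P.
have [L L0 hL] := horner_lipschitz P (addr_ge0 (normc_ge0 (f z)) K0).
apply/eqP; rewrite -subr_eq0 -normc_eq0 eq_le normc_ge0 andbT.
apply: (@le0_of_exp2 _ _ ((B + b) * (1 + L))) => j.
have -> : f z - P.[f z] = (f z - (p j.+1).[z]) + (P.[(p j).[z]] - P.[f z]).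
  by rewrite pS horner2_eval -/P; ring.
have e1 : 1 <= 2 ^+ j :> R by rewrite exprn_ege1 // ler1n.
have hP : N (P.[(p j).[z]] - P.[f z]) <= L * N ((p j).[z] - f z).
  apply: hL; last by rewrite lerDl.
  apply: le_trans (normc_triangleB _ (f z)) _; rewrite lerD2l normcB_sym.
  by apply: le_trans (eps j); rewrite ler_peMr ?normc_ge0.
have e2 := eps j; have e3 := eps j.+1.
apply: le_trans (ler_wpM2r _ (normc_triangle _ _)) _; first by rewrite exprn_ge0.
rewrite mulrDl mulrDr mulr1; apply: lerD.
  apply: le_trans e3; rewrite ler_wpM2l ?normc_ge0// exprS; lra.
apply: (@le_trans _ _ (L * N ((p j).[z] - f z) * 2 ^+ j)).
  by rewrite ler_wpM2r ?exprn_ge0.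
by rewrite -mulrA mulrC ler_wpM2r// normcB_sym.
Qed.

End FixedPoint.

(** * A power series branch at a double zero *)

Section Branch.
Context {R : realType}.
Implicit Types (P Q : {poly R[i]}).

(** The fixed-point result wants coefficients polynomial in [z], so the composite [P (z (X + w0))]
    is realised as one polynomial in both variables. *)
Lemma lift_comp_poly P (w0 : R[i]) : exists G : {poly {poly R[i]}}, forall z,
  map_poly (horner_eval z) G = P \Po (z%:P * ('X + w0%:P)).
Proof.
elim/poly_ind: P => [|P a [G IH]]; first by exists 0 => z; rewrite rmorph0 comp_poly0.
exists (G * ('X%:P * ('X + w0%:P%:P)) + a%:P%:P) => z.
rewrite !rmorphD !rmorphM rmorphD /= IH !map_polyX !map_polyC /= /horner_eval.
by rewrite hornerX !hornerC comp_polyX comp_polyC.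
Qed.

(* Newton polygon step: substituting [t = z * w] in [t^2 * P(t) + z^2 * Q(t)] *)
(* and dividing by [z^2] leaves a simple root [w0] at [z = 0]. *)
Lemma branch_power_series P Q (w0 : R[i]) :
  w0 != 0 -> P.[0] != 0 -> w0 ^+ 2 * P.[0] + Q.[0] = 0 ->
  exists c w, [/\ power_series c w, c 0%N = w0
    & near0 (fun z => w z ^+ 2 * P.[z * w z] + Q.[z * w z] = 0)].
Proof.
move=> w0n P0n E0.
have [GP hP] := lift_comp_poly P w0; have [GQ hQ] := lift_comp_poly Q w0.
(* [g] is the derivative of [w^2 P(0) + Q(0)] at [w0]. Dividing by it turns the equation into a
   fixed-point problem whose linear coefficient vanishes at [z = 0]. *)
pose g := 2 * w0 * P.[0].
have gn : g != 0 by rewrite !mulf_neq0 ?pnatr_eq0.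
pose H : {poly {poly R[i]}} :=
  'X - (g^-1)%:P%:P * (('X + w0%:P%:P) ^+ 2 * GP + GQ).
have hH z : map_poly (horner_eval z) H = 'X - (g^-1)%:P *
   (('X + w0%:P) ^+ 2 * (P \Po (z%:P * ('X + w0%:P))) + (Q \Po (z%:P * ('X + w0%:P)))).
  rewrite rmorphB rmorphM !rmorphD rmorphM rmorphXn rmorphD /= hP hQ.
  by rewrite !map_polyX !map_polyC /= /horner_eval !hornerC.
have H0 k : H`_k`_0 = (- (g^-1 * P.[0]) *: 'X^2 : {poly R[i]})`_k.
  rewrite -horner_coef0 -/(horner_eval 0 _) -coef_map hH.
  apply: (congr1 (fun p : {poly R[i]} => p`_k)).
  rewrite polyC0 mul0r -polyC0 !comp_polyCr.
  have -> : (Q.[0])%:P = - (w0 ^+ 2 * P.[0])%:P :> {poly R[i]}.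
    by rewrite -polyCN -[Q.[0]](addrK (w0 ^+ 2 * P.[0])) [_ + w0 ^+ 2 * _]addrC E0 sub0r.
  have e2 : (g^-1)%:P * (2 * w0 * P.[0])%:P = 1 :> {poly R[i]}.
    by rewrite -polyCM mulVf.
  rewrite scaleNr -mul_polyC !polyCM.
  move: e2; rewrite !polyCM polyC_natr => e2.
  transitivity ('X - (g^-1)%:P * (2%:R * w0%:P * (P.[0])%:P) * 'X
     - (g^-1)%:P * (P.[0])%:P * 'X^2 : {poly R[i]}); first by ring.
  by rewrite e2; ring.
have [|| c [f [hf c0 hz]]] := @fixed_point_power_series R H.
- by rewrite H0 coefZ coefXn mulr0.
- by rewrite H0 coefZ coefXn mulr0.
have hw := power_seriesD hf (power_series_cst w0).
eexists; eexists; split; [exact: hw|by rewrite /= c0 add0r|].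
apply: near0W hz => z /=; rewrite hH !hornerE !horner_comp !hornerE /=.
move: (f z) => t; set p := P.[_]; set q := Q.[_] => /eqP.
rewrite -subr_eq0 (_ : _ - _ = g^-1 * ((t + w0) ^+ 2 * p + q)); last by ring.
by rewrite mulf_eq0 invr_eq0 (negPf gn) => /eqP.
Qed.

Lemma double_root_factor (F : fieldType) (P : {poly F}) (u : F) :
  P.[u] = 0 -> P^`().[u] = 0 ->
  exists Q : {poly F}, P = ('X - u%:P) ^+ 2 * Q /\ P^`(2).[u] = 2 * Q.[u].
Proof.
move=> h0 h1.
have /factor_theorem[Q1 E1] : root P u by apply/eqP.
have /factor_theorem[Q E2] : root Q1 u.
  by apply/eqP; move: h1; rewrite E1 derivM derivXsubC !hornerE subrr mulr0 add0r.
have E : P = ('X - u%:P) ^+ 2 * Q by rewrite E1 E2; ring.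
exists Q; split => //.
have dD : ('X - u%:P)^`() = 1 by exact: derivXsubC.
have hD : ('X - u%:P).[u] = 0 by rewrite !hornerE subrr.
rewrite E expr2 derivnS derivn1; move: ('X - u%:P) dD hD => D dD hD.
have -> : (D * D * Q)^`() = D * Q + D * Q + D * D * Q^`() by rewrite !derivM dD; ring.
by rewrite !derivD !derivM dD !(hornerD, hornerM) hD -polyC1 !hornerC; ring.
Qed.

End Branch.

(** * Jets of powers of a series *)

Section Jets.
Context {R : realType}.
Implicit Types (c d : nat -> R[i]) (f : R[i] -> R[i]).

Definition cpow c k := iter k (cauchy c) (fun j => if j == 0%N then 1 else 0).

Lemma power_seriesX c f k : power_series c f -> power_series (cpow c k) (fun z => f z ^+ k).
Proof.
move=> hf; elim: k => [|k IH].
  by under eq_fun do rewrite expr0; exact: power_series_cst.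
by under eq_fun do rewrite exprS; exact: power_seriesM.
Qed.

Lemma cauchy0 c d : cauchy c d 0 = c 0%N * d 0%N.
Proof. by rewrite /cauchy big_ord1. Qed.

Lemma cauchy1 c d : cauchy c d 1 = c 0%N * d 1%N + c 1%N * d 0%N.
Proof. by rewrite /cauchy !big_ord_recr big_ord0 /= add0r. Qed.

Lemma cauchy2 c d : cauchy c d 2 = c 0%N * d 2%N + c 1%N * d 1%N + c 2%N * d 0%N.
Proof. by rewrite /cauchy !big_ord_recr big_ord0 /= add0r. Qed.

Lemma cauchy3 c d : cauchy c d 3 =
  c 0%N * d 3%N + c 1%N * d 2%N + c 2%N * d 1%N + c 3%N * d 0%N.
Proof. by rewrite /cauchy !big_ord_recr big_ord0 /= add0r. Qed.

(* The 3-jet of [v * exp (k * (d1 * z + d2 * z^2 + d3 * z^3))]. *)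
Definition exp_jet (v k d1 d2 d3 : R[i]) (c : nat -> R[i]) :=
  [/\ c 0%N = v, c 1%N = v * (k * d1),
      c 2%N = v * (k * d2 + (k * d1) ^+ 2 / 2)
    & c 3%N = v * (k * d3 + k ^+ 2 * d1 * d2 + (k * d1) ^+ 3 / 6)].

Lemma exp_jet_exists c : c 0%N != 0 ->
  exists d1 d2 d3 : R[i], exp_jet (c 0%N) 1 d1 d2 d3 c.
Proof.
move=> c0; pose d1 := c 1%N / c 0%N; pose d2 := c 2%N / c 0%N - d1 ^+ 2 / 2.
exists d1, d2, (c 3%N / c 0%N - d1 * d2 - d1 ^+ 3 / 6).
by split; rewrite /d2 /d1; field.
Qed.

Lemma exp_jet_pow (u d1 d2 d3 : R[i]) c k : exp_jet u 1 d1 d2 d3 c ->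
  exp_jet (u ^+ k) k%:R d1 d2 d3 (cpow c k).
Proof.
move=> [c0 c1 c2 c3]; elim: k => [|k [h0 h1 h2 h3]].
  by split; rewrite /= ?expr0 //; field.
rewrite /cpow iterS -/(cpow c k) -addn1 natrD.
split; rewrite !(cauchy0, cauchy1, cauchy2, cauchy3) !(c0, c1, c2, c3) !(h0, h1, h2, h3)
  addn1 (exprS u).
- by [].
- ring.
- by field.
- by field.
Qed.

End Jets.

(** * Characteristic polynomial of the Kac-Murdock-Szego matrix *)

Section Determinants.
Context {K : comNzRingType}.

(** Entries are a function on all natural numbers, so that shifted indices and minors need no
    ordinal arithmetic. *)
Definition nat_mx n (F : nat -> nat -> K) := \matrix_(i < n, j < n) F i j.

(** Only the corner is special: the first row of the conjugating bidiagonal matrix has no entry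
    below the diagonal. *)
Definition tridiag (c b o : K) (i j : nat) : K :=
  if i == j then (if i == 0%N then c else b)
  else if (i == j.+1) || (j == i.+1) then o else 0.

Lemma det_tridiag_rec n c b o :
  \det (nat_mx n.+2 (tridiag c b o)) =
  c * \det (nat_mx n.+1 (tridiag b b o)) - o ^+ 2 * \det (nat_mx n (tridiag b b o)).
Proof.
rewrite (expand_det_row _ ord0) 2!big_ord_recl big1 ?addr0; last first.
  by move=> i _; rewrite mxE /tridiag /= mul0r.
congr (_ + _).
  rewrite mxE /tridiag /= /cofactor expr0 mul1r; congr (_ * \det _).
  apply/matrixP => i j; rewrite !mxE !lift0 /tridiag /= !eqSS.
  by case: eqP => // ->; case: ifP.
rewrite mxE /tridiag /= /cofactor /= expr1 (expand_det_col _ ord0) big_ord_recl big1 ?addr0.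
  rewrite !mxE /= /cofactor expr0 mul1r mulN1r expr2 -mulrA mulrN; congr (- (_ * (_ * \det _))).
  apply/matrixP => i j; rewrite !mxE /= /bump /= !add1n !eqSS.
  by case: eqP => // ->; case: ifP.
by move=> i _; rewrite !mxE /= /bump /= mul0r.
Qed.

Definition lower_bidiag n (r : K) :=
  nat_mx n (fun i j => (i == j)%:R - r * (i == j.+1)%:R).

Definition shift_row (r : K) (F : nat -> nat -> K) i j :=
  F i j - r * (if i is i'.+1 then F i' j else 0).

Lemma lower_bidiag_mul n r F :
  lower_bidiag n r *m nat_mx n F = nat_mx n (shift_row r F).
Proof.
apply/matrixP => i j; rewrite !mxE /shift_row.
under eq_bigr do rewrite !mxE mulrBl -mulrA.
rewrite sumrB -mulr_sumr; congr (_ - _ * _).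
  rewrite (bigD1 i) //= eqxx mul1r big1 ?addr0// => k ki.
  by rewrite eq_sym (negPf (ki : nat_of_ord k != i)) mul0r.
case: (nat_of_ord i) (ltn_ord i) => [|i'] hi; first by rewrite big1// => k _; rewrite mul0r.
rewrite (bigD1 (Ordinal (ltnW hi))) //= eqxx mul1r big1 ?addr0// => k.
rewrite -val_eqE /= => ki; rewrite eqSS eq_sym (negPf ki) mul0r //.
Qed.

Lemma det_lower_bidiag n r : \det (lower_bidiag n r) = 1.
Proof.
rewrite det_trig; last first.
  apply/is_trig_mxP => i j ij; rewrite mxE (ltn_eqF ij) (_ : _ == _ = false).
    by rewrite mulr0 subr0.
  by apply/eqP => e; rewrite e ltnNge leqnSn in ij.
by rewrite big1// => i _; rewrite mxE eqxx (ltn_eqF (ltnSn _)) mulr0 subr0.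
Qed.

Lemma tr_nat_mx n F : (nat_mx n F)^T = nat_mx n (fun i j => F j i).
Proof. by apply/matrixP => i j; rewrite !mxE. Qed.

Lemma det_bidiag_conj n r F :
  \det (nat_mx n F) =
  \det (nat_mx n (fun i j => shift_row r (fun i j => shift_row r F j i) j i)).
Proof.
transitivity (\det (lower_bidiag n r *m (lower_bidiag n r *m nat_mx n F)^T)).
  by rewrite det_mulmx det_tr det_mulmx det_lower_bidiag !mul1r.
by rewrite lower_bidiag_mul tr_nat_mx lower_bidiag_mul -det_tr tr_nat_mx.
Qed.

(* [L K L^T] is diagonal for the bidiagonal [L] with [- r] below its unit *)
(* diagonal, so that the pencil [a - b * K] becomes tridiagonal. *)
Lemma det_kms_tridiag n (r a b : K) :
  \det (nat_mx n (fun i j => a * (i == j)%:R - b * r ^+ `|i - j|%N)) =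
  \det (nat_mx n (tridiag (a - b) (a * (1 + r ^+ 2) - b * (1 - r ^+ 2)) (- r * a))).
Proof.
rewrite (det_bidiag_conj n r); congr (\det _); apply/matrixP => i j; rewrite !mxE.
move: (nat_of_ord i) (nat_of_ord j) => {}i {}j.
rewrite /shift_row /tridiag.
have b0 : (false : nat)%:R = 0 :> K by [].
have b1 : (true : nat)%:R = 1 :> K by [].
have d1 (k : nat) : `|k - k.+1|%N = 1%N by lia.
have d1' (k : nat) : `|k.+1 - k|%N = 1%N by lia.
have d2 (k : nat) : `|k - k.+2|%N = 2%N by lia.
have d2' (k : nat) : `|k.+2 - k|%N = 2%N by lia.
have e1 (k : nat) : (k == k.+1) = false by lia.
have e1' (k : nat) : (k.+1 == k) = false by lia.
have e2 (k : nat) : (k == k.+2) = false by lia.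
have e2' (k : nat) : (k.+2 == k) = false by lia.
have [ij|ji|ij] := ltngtP i j.
- have h1 : (i == j.+1) = false by lia.
  rewrite h1 orFb; case: j ij h1 => // j ij h1; rewrite eqSS.
  have [ji|ji] := eqVneq j i.
    rewrite ji; case: i {ij h1 ji} => [|i].
      by rewrite ?eqxx distnn d1 expr0 expr1 b0 b1; ring.
    by rewrite ?eqxx !distnn !d1 !d2 !e1 !e2 expr0 expr1 b0 b1; ring.
  have h2 : (i == j) = false by lia.
  rewrite ?h2 (_ : `|i - j.+1|%N = `|i - j|%N.+1); last by lia.
  case: i ij ji h1 h2 => [|i] ij ji h1 h2; first by rewrite exprS b0; ring.
  have h3 : (i == j) = false by lia.
  have h4 : (i == j.+1) = false by lia.
  rewrite ?h3 ?h4 (_ : `|i - j.+1|%N = `|i.+1 - j|%N.+2); last by lia.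
  rewrite (_ : `|i - j|%N = `|i.+1 - j|%N.+1); last by lia.
  by rewrite !exprS b0; ring.
- have h1 : (j == i.+1) = false by lia.
  rewrite h1 orbF; case: i ji h1 => // i ji h1; rewrite eqSS.
  have [ij|ij] := eqVneq i j.
    rewrite ij; case: j {ij h1 ji} => [|j].
      by rewrite ?eqxx distnn d1' expr0 expr1 b0 b1; ring.
    by rewrite ?eqxx !distnn !d1' !d2' !e1' !e2' expr0 expr1 b0 b1; ring.
  have h2 : (i == j) = false by lia.
  rewrite ?h2 (_ : `|i.+1 - j|%N = `|i - j|%N.+1); last by lia.
  case: j ij ji h1 h2 => [|j] ij ji h1 h2; first by rewrite exprS b0; ring.
  have h3 : (i == j) = false by lia.
  have h4 : (i.+1 == j) = false by lia.
  rewrite ?h3 ?h4 (_ : `|i.+1 - j|%N = `|i - j.+1|%N.+2); last by lia.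
  rewrite (_ : `|i - j|%N = `|i - j.+1|%N.+1); last by lia.
  by rewrite !exprS b0; ring.
- rewrite ij; case: j {ij} => [|j]; first by rewrite distnn expr0 b1; ring.
  by rewrite !distnn !eqxx d1 d1' e1 e1' expr0 expr1 b0 b1 /=; ring.
Qed.

(* [1] and [- v^2] are the roots of [X^2 - (1 - v^2) X - v^2]. *)
Lemma det_tridiag_closed n (k b o v : K) : b = k * (1 - v ^+ 2) ->
  o ^+ 2 = - (k * v) ^+ 2 ->
  (1 + v ^+ 2) * \det (nat_mx n (tridiag b b o)) = k ^+ n * (1 - (- v ^+ 2) ^+ n.+1).
Proof.
move=> hb ho; elim/ltn_ind: n => -[|[|n]] IH.
- by rewrite det_mx00; ring.
- by rewrite det_mx11 mxE /tridiag /= hb; ring.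
rewrite det_tridiag_rec mulrBr !(mulrCA (1 + v ^+ 2)) !IH // ho hb !exprS; ring.
Qed.

(** [1 + v^2] is the difference of the two characteristic roots, so multiplying by it clears the
    denominator of the Binet form of the determinant. *)
Lemma det_kms_closed n (ii y v : K) : ii ^+ 2 = -1 ->
  let a := (1 + y ^+ 2) * v in
  let b := (1 - y ^+ 2) * v + y * (v ^+ 2 - 1) in
  (1 + v ^+ 2) * \det (nat_mx n.+1 (fun i j => a * (i == j)%:R - b * (ii * y) ^+ `|i - j|%N))
  = ((1 + y ^+ 2) * y) ^+ n * y
      * ((1 + y * v) ^+ 2 - (- v ^+ 2) ^+ n * v ^+ 2 * (v - y) ^+ 2).
Proof.
move=> hi a b; rewrite det_kms_tridiag.
pose k := (1 + y ^+ 2) * y.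
have hb : a * (1 + (ii * y) ^+ 2) - b * (1 - (ii * y) ^+ 2) = k * (1 - v ^+ 2).
  by rewrite exprMn hi /a /b /k; ring.
have ho : (- (ii * y) * a) ^+ 2 = - (k * v) ^+ 2.
  by rewrite exprMn sqrrN exprMn hi /a /k; ring.
have ha : a - b = y * (2 * y * v - v ^+ 2 + 1) by rewrite /a /b; ring.
rewrite hb ha; case: n => [|n].
  by rewrite det_mx11 mxE /tridiag /=; ring.
rewrite det_tridiag_rec mulrBr !(mulrCA (1 + v ^+ 2)).
rewrite !(det_tridiag_closed _ (erefl _) ho) ho -/k !exprS.
by set kn := k ^+ n; set q := _ ^+ n; rewrite /k; ring.
Qed.

End Determinants.

(** * Multiplicities through a polynomial pencil *)

Section Multiplicity.

Lemma poly_ext (K : numDomainType) (p q : {poly K}) :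
  (forall v, p.[v] = q.[v]) -> p = q.
Proof.
move=> h; apply/eqP; rewrite -subr_eq0; apply/negPn/negP => r0.
pose rs : seq K := [seq i%:R | i <- iota 0 (size (p - q))].
suff : (size rs < size (p - q)%R)%N by rewrite size_map size_iota ltnn.
apply: max_poly_roots => //.
  by apply/allP => v _; rewrite /root hornerD hornerN h subrr.
rewrite map_inj_uniq ?iota_uniq// => i j /eqP.
by rewrite eqr_nat => /eqP.
Qed.

Lemma horner_char_poly (K : comNzRingType) n (A : 'M[K]_n) l :
  (char_poly A).[l] = \det (l%:M - A).
Proof.
rewrite /char_poly -[LHS]/(horner_eval l _) -det_map_mx; congr (\det _).
apply/matrixP => i j; rewrite !mxE rmorphB rmorphMn /= /horner_eval.
by rewrite hornerX hornerC.
Qed.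

Lemma det_pencil (K : fieldType) n (A : 'M[K]_n) a b : b != 0 ->
  \det (a%:M - b *: A) = b ^+ n * (char_poly A).[a / b].
Proof.
move=> b0; rewrite horner_char_poly -detZ; congr (\det _).
by rewrite scalerBr scale_scalar_mx mulrCA divff// mulr1.
Qed.

(** The determinant is the product of [a - z b] over the eigenvalues [z] with multiplicity. Only the
    factors with [z = l] vanish at [u], and each of them simply, so the two multiplicities agree. *)
Lemma mup_pencil (K : closedFieldType) n (A : 'M[K]_n) (a b e : {poly K}) u l :
  b.[u] != 0 -> a - l *: b = ('X - u%:P) * e -> e.[u] != 0 ->
  exists D : {poly K}, [/\ D != 0, forall v, D.[v] = \det (a.[v]%:M - b.[v] *: A)
    & mup u D = mup l (char_poly A)].
Proof.
move=> bu ale eu.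
have [rs Ers] := closed_field_poly_normal (char_poly A).
rewrite (eqP (char_poly_monic A)) scale1r in Ers.
have srs : size rs = n.
  by apply/eqP; rewrite -eqSS -(size_prod_XsubC rs id) -Ers size_char_poly.
have e0 : e != 0 by apply: contraNneq eu => ->; rewrite horner0.
have au : a.[u] = l * b.[u].
  apply/eqP; rewrite -subr_eq0 -hornerZ -hornerN -hornerD ale.
  by rewrite hornerM hornerXsubC subrr mul0r.
have fu z : z != l -> (a - z *: b).[u] != 0.
  by move=> zl; rewrite hornerD hornerN hornerZ au -mulrBl mulf_neq0// subr_eq0 eq_sym.
have f0 z : a - z *: b != 0.
  have [->|/fu] := eqVneq z l; first by rewrite ale mulf_neq0// polyXsubC_eq0.
  by apply: contraNneq => ->; rewrite horner0.
exists (\prod_(z <- rs) (a - z *: b)); split.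
- by rewrite prodf_seq_neq0; apply/allP => z _; rewrite f0.
- move=> v; rewrite horner_prod.
  under eq_bigr do rewrite hornerD hornerN hornerZ.
  have [bv|bv] := eqVneq b.[v] 0.
    rewrite bv scale0r subr0 det_scalar; under eq_bigr do rewrite mulr0 subr0.
    by rewrite big_const_seq count_predT srs iter_mulr_1.
  rewrite det_pencil// Ers horner_prod -{1}srs.
  elim: rs {Ers srs} => [|z rs IH]; first by rewrite !big_nil expr0 mulr1.
  rewrite !big_cons IH /= exprS hornerXsubC; set P := \prod_(_ <- _) _; by field.
- rewrite Ers; elim: rs {Ers srs} => [|z rs IH].
    by rewrite !big_nil !mupNroot ?root1.
  have P0 : \prod_(x <- rs) (a - x *: b) != 0.
    by rewrite prodf_seq_neq0; apply/allP => x _; rewrite f0.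
  rewrite !big_cons (mupM _ (f0 z) P0) IH.
  rewrite mupM ?polyXsubC_eq0 ?monic_neq0 ?monic_prod_XsubC//; congr (_ + _)%N.
  have [->|zl] := eqVneq z l.
    rewrite ale mupMl; last by rewrite rootE.
    by rewrite -['X - u%:P]expr1 -['X - l%:P]expr1 !mup_XsubCX !eqxx.
  rewrite mupNroot; last by rewrite rootE fu.
  by rewrite mupNroot // root_XsubC eq_sym.
Qed.

End Multiplicity.

(** * Double zeros of the determinant factor *)

Definition phi (K : nzRingType) n (v y : K) := v ^+ n.+1 + 1 - y * (v ^+ n - v).

(* [u] is a double zero of [phi n _ y]: with [u = exp alpha] the equations are *)
(* [cosh (n * alpha) = n * cosh alpha] and *)
(* [y = cosh ((n + 1) / 2 * alpha) / sinh ((n - 1) / 2 * alpha)]. *)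
Definition critical (K : fieldType) n (u y : K) :=
  [/\ [/\ u != 0, u ^+ 2 + 1 != 0, u ^+ n - u != 0 & u * u ^+ n + 1 != 0],
      u * ((u ^+ n) ^+ 2 + 1) = n%:R * u ^+ n * (u ^+ 2 + 1)
    & y * (u ^+ n - u) = u * u ^+ n + 1].

Section Critical.
Context {K : numFieldType} (n : nat) (u y : K).
Context (n_ge2 : (1 < n)%N) (crit : critical n u y).
Let V := u ^+ n.

Let u0 : u != 0. Proof. by case: crit => -[]. Qed.
Let u1 : u ^+ 2 + 1 != 0. Proof. by case: crit => -[]. Qed.
Let Vu : V - u != 0. Proof. by case: crit => -[]. Qed.
Let uV : u * V + 1 != 0. Proof. by case: crit => -[]. Qed.
Let V0 : V != 0. Proof. by rewrite expf_neq0. Qed.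
Let n0 : n%:R != 0 :> K. Proof. by rewrite pnatr_eq0 -lt0n ltnW. Qed.

Lemma critical_n : n%:R = u * (V ^+ 2 + 1) / (V * (u ^+ 2 + 1)).
Proof. by case: crit => _; rewrite -/V => -> _; field; rewrite V0 u1. Qed.

Lemma critical_y : y = (u * V + 1) / (V - u).
Proof. by case: crit => _ _; rewrite -/V => <-; field. Qed.

Lemma critical_V1 : V ^+ 2 + 1 != 0.
Proof.
case: crit => _ h _; have : n%:R * V * (u ^+ 2 + 1) != 0 by rewrite !mulf_neq0.
by rewrite -h mulf_eq0 negb_or => /andP[].
Qed.

Lemma critical_y0 : y != 0.
Proof. by rewrite critical_y mulf_neq0 ?invr_eq0. Qed.

Lemma critical_y1 : 1 + y ^+ 2 != 0.
Proof.
have -> : 1 + y ^+ 2 = (V ^+ 2 + 1) * (u ^+ 2 + 1) / (V - u) ^+ 2.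
  by rewrite critical_y; field.
by rewrite !mulf_neq0 ?invr_eq0 ?expf_neq0// critical_V1.
Qed.

Definition phiP : {poly K} := 'X^(n.+1) + 1%:P - y *: ('X^n - 'X).

Lemma phiP_horner v : phiP.[v] = phi n v y.
Proof. by rewrite /phiP /phi !hornerE. Qed.

(** The second identity is the value of [u^2 phi''(u)]. It is nonzero, so the zero is exactly
    double, and it fixes the leading coefficient of the branch through [u]. *)
Lemma phi_double : exists Q : {poly K},
  phiP = ('X - u%:P) ^+ 2 * Q /\ u ^+ 2 * (2 * Q.[u]) = n%:R * (u * V + 1).
Proof.
have h0 : phiP.[u] = 0.
  by rewrite phiP_horner /phi exprS -/V; case: crit => _ _; rewrite -/V => ->; ring.
have [k En] : exists k, n = k.+2 by case: n n_ge2 => // -[//|k] _; exists k.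
have EV : V = u ^+ 2 * u ^+ k by rewrite /V En !exprS; ring.
have k2 : k.+2%:R = n%:R :> K by rewrite En.
have k1 : k.+1%:R = n%:R - 1 :> K by rewrite -k2 -(natr1 k.+1); ring.
have k3 : k.+3%:R = n%:R + 1 :> K by rewrite -k2 natr1.
have dXn m : ('X^(m.+1))^`() = m.+1%:R *: 'X^m :> {poly K}.
  by rewrite derivXn scaler_nat.
have h1 : phiP^`().[u] = 0.
  rewrite /phiP En !(derivB, derivD, derivZ, dXn, derivX, derivC).
  rewrite -polyC1 !(hornerD, hornerN, hornerZ, hornerXn, hornerX, hornerC).
  apply: (mulfI u0); rewrite mulr0.
  have -> : u * (k.+3%:R * u ^+ k.+2 + 0 - y * (k.+2%:R * u ^+ k.+1 - 1))
    = (n%:R + 1) * u * V - y * (n%:R * V - u).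
    by rewrite EV k3 k2 !exprS; ring.
  by rewrite critical_n critical_y; field; rewrite u1 V0 Vu.
have [Q [E EQ]] := double_root_factor h0 h1.
exists Q; split => //; rewrite -EQ derivnS derivn1 /phiP En !(derivB, derivD, derivZ, dXn, derivX, derivC).
rewrite !(hornerD, hornerN, hornerZ, hornerXn, hornerX, hornerC).
transitivity (n%:R * ((n%:R + 1) * u * V - y * (n%:R - 1) * V)).
  by rewrite EV k3 k2 k1 !exprS; ring.
rewrite k2 critical_n critical_y.
by field; rewrite u1 V0 Vu.
Qed.

(** The other factor of the determinant adds nothing to the multiplicity at [u]. *)
Lemma phi2_neq0 : u ^+ n.+1 - 1 - y * (V + u) != 0.
Proof.
have -> : u ^+ n.+1 - 1 - y * (V + u) = - 2 * V * (u ^+ 2 + 1) / (V - u).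
  by rewrite critical_y exprS -/V; field.
by rewrite !mulf_neq0 ?oppr_eq0 ?pnatr_eq0 ?invr_eq0.
Qed.

(** Division-free form of [a / b = - n] at the critical point. *)
Lemma critical_pencil :
  (1 + y ^+ 2) * u = - n%:R * ((1 - y ^+ 2) * u + y * (u ^+ 2 - 1)).
Proof. by rewrite critical_n critical_y; field; rewrite u1 V0 Vu. Qed.

End Critical.

(** * The double eigenvalue and the symmetry of its eigenvectors *)

Section KMS.
Context {R : realType}.
Local Notation C := R[i].

Lemma sqr_ic : 'i%C ^+ 2 = -1 :> C.
Proof. exact: sqr_i. Qed.

Lemma ic_neq0 : 'i%C != 0 :> C.
Proof. by rewrite -sqrf_eq0 sqr_i oppr_eq0 oner_eq0. Qed.

Lemma det_kms_pencil n (rho a b : C) : \det (a%:M - b *: KMS n rho) =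
  \det (nat_mx n (fun i j => a * (i == j)%:R - b * rho ^+ `|i - j|%N)).
Proof.
by congr (\det _); apply/matrixP => i j; rewrite !mxE -val_eqE /= mulr_natr.
Qed.

Definition pencil_num (y v : C) := (1 + y ^+ 2) * v.
Definition pencil_den (y v : C) := (1 - y ^+ 2) * v + y * (v ^+ 2 - 1).

(** For odd [n] the sign in [(- v^2)^(n-1)] disappears, and the closed form is a difference of the
    squares of [1 + y v] and [v^n (v - y)], hence the two factors. *)
Lemma det_kms_phi n (y v : C) : odd n ->
  (1 + v ^+ 2) * \det ((pencil_num y v)%:M - pencil_den y v *: KMS n ('i%C * y)) =
  - ((1 + y ^+ 2) * y) ^+ n.-1 * y * (phi n v y * (v ^+ n.+1 - 1 - y * (v ^+ n + v))).
Proof.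
case: n => // k /= /negPf hk; rewrite det_kms_pencil (det_kms_closed _ _ _ sqr_ic).
have -> : (- v ^+ 2) ^+ k = (v ^+ k) ^+ 2.
  by rewrite exprNn -signr_odd hk expr0 mul1r -!exprM mulnC.
by rewrite /phi !exprS; ring.
Qed.

Lemma kms_root n (y v : C) : odd n -> phi n v y = 0 -> 1 + v ^+ 2 != 0 ->
  pencil_den y v != 0 -> root (char_poly (KMS n ('i%C * y))) (pencil_num y v / pencil_den y v).
Proof.
move=> on hphi v1 b0; apply/eqP.
have := det_kms_phi y v on; rewrite hphi mul0r mulr0 det_pencil// => /eqP.
by rewrite !mulf_eq0 expf_eq0 (negPf v1) (negPf b0) andbF /= => /eqP.
Qed.

Lemma kms_critical_mup n (u y : C) : odd n -> (1 < n)%N -> critical n u y ->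
  mup (- n%:R) (char_poly (KMS n ('i%C * y))) = 2%N.
Proof.
move=> on n2 cr.
have [[u0 u1 Vu uV] _ _] := cr.
have y0 := critical_y0 cr; have y1 := critical_y1 n2 cr.
have n0 : n%:R != 0 :> C by rewrite pnatr_eq0 -lt0n ltnW.
pose a : {poly C} := (1 + y ^+ 2) *: 'X.
pose b : {poly C} := (1 - y ^+ 2) *: 'X + y *: ('X^2 - 1%:P).
have aE v : a.[v] = pencil_num y v by rewrite /a !hornerE.
have bE v : b.[v] = pencil_den y v by rewrite /b !hornerE.
have pe := critical_pencil cr.
have bu : b.[u] != 0.
  rewrite bE; apply/eqP => b0; move/eqP: pe.
  by rewrite -/(pencil_den y u) b0 mulr0 mulf_eq0 (negPf y1) (negPf u0).
have hb2 : (1 + y ^+ 2) + n%:R * (1 - y ^+ 2) = n%:R * y * (u^-1 - u).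
  apply: (mulIf u0); rewrite mulrDl pe; by field.
(* As [v] and [- v^-1] give the same eigenvalue, the second zero of [a + n b] is [- u^-1]; it
   differs from [u] because [u^2 + 1] is nonzero. *)
have ale : a - (- n%:R) *: b = ('X - u%:P) * ((n%:R * y) *: ('X + u^-1%:P)).
  have uu : u%:P * u^-1%:P = 1 :> {poly C} by rewrite -polyCM divff.
  have hb3 : (1 + y ^+ 2)%:P + n%:R%:P * (1 - y ^+ 2)%:P
      = n%:R%:P * y%:P * (u^-1%:P - u%:P) :> {poly C}.
    by rewrite -polyCM -polyCD hb2 !polyCM polyCB.
  rewrite /a /b -!mul_polyC !polyCN polyCM.
  transitivity (((1 + y ^+ 2)%:P + n%:R%:P * (1 - y ^+ 2)%:P) * 'X
    + n%:R%:P * y%:P * ('X^2 - 1%:P)); first by ring.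
  rewrite hb3 polyC1 -uu; ring.
have eu : ((n%:R * y) *: ('X + u^-1%:P)).[u] != 0.
  rewrite !hornerE !mulf_neq0//.
  rewrite (_ : u + u^-1 = (u ^+ 2 + 1) / u); last by field.
  by rewrite mulf_neq0 ?invr_eq0.
have [D [D0 Dv <-]] := mup_pencil (KMS n ('i%C * y)) bu ale eu.
have [Q [EQ Qu]] := phi_double n2 cr.
pose P2 : {poly C} := 'X^(n.+1) - 1%:P - y *: ('X^n + 'X).
have P2u : P2.[u] != 0 by rewrite /P2 !hornerE phi2_neq0.
have Qu0 : Q.[u] != 0.
  apply: contraTneq (mulf_neq0 n0 uV) => Q0; rewrite -Qu Q0 !mulr0 eqxx //.
have c0 : - ((1 + y ^+ 2) * y) ^+ n.-1 * y != 0.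
  by rewrite mulf_neq0 ?oppr_eq0 ?expf_neq0 ?mulf_neq0.
(* The closed form gives [D] only after multiplication by [X^2 + 1], which does not vanish at [u]
   and leaves the multiplicity unchanged. *)
have E : D * ('X^2 + 1%:P)
    = ('X - u%:P) ^+ 2 * ((- ((1 + y ^+ 2) * y) ^+ n.-1 * y)%:P * (Q * P2)).
  apply: poly_ext => v; rewrite hornerM Dv aE bE.
  transitivity ((- ((1 + y ^+ 2) * y) ^+ n.-1 * y) * ((phiP n y).[v] * P2.[v])).
    rewrite phiP_horner -[RHS]/(_ * (_ * _)) /P2.
    rewrite (_ : ('X^(n.+1) - 1%:P - y *: ('X^n + 'X)).[v]
      = v ^+ n.+1 - 1 - y * (v ^+ n + v)); last by rewrite !hornerE.
    by rewrite -det_kms_phi// mulrC; congr (_ * _); rewrite !hornerE addrC.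
  by rewrite EQ !hornerM hornerC; ring.
have : mup u (D * ('X^2 + 1%:P)) = 2%N.
  rewrite E mupMl; first by rewrite mup_XsubCX eqxx.
  by rewrite rootE !hornerM hornerC; apply: mulf_neq0 => //; exact: mulf_neq0.
by rewrite mupMl// rootE !hornerE.
Qed.

(** Three consecutive columns of the matrix combine to a multiple of a unit vector, reflecting that
    its inverse is tridiagonal; pairing this with an eigenvector gives a recursion on its
    entries. *)
Lemma dist_three_term (K : comNzRingType) (r : K) (i j : nat) :
  r * (r ^+ `|i - j|%N + r ^+ `|i - j.+2|%N) =
  (1 + r ^+ 2) * r ^+ `|i - j.+1|%N - (1 - r ^+ 2) * (i == j.+1)%:R.
Proof.
have [ij|ji|->] := ltngtP i j.+1.
- rewrite (_ : `|i - j.+1|%N = `|i - j|%N.+1); last by lia.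
  rewrite (_ : `|i - j.+2|%N = `|i - j|%N.+2); last by lia.
  by rewrite !exprS /=; ring.
- rewrite (_ : `|i - j.+1|%N = `|i - j.+2|%N.+1); last by lia.
  rewrite (_ : `|i - j|%N = `|i - j.+2|%N.+2); last by lia.
  by rewrite !exprS /=; ring.
- rewrite (_ : `|j.+1 - j|%N = 1%N); last by lia.
  rewrite (_ : `|j.+1 - j.+2|%N = 1%N); last by lia.
  by rewrite distnn expr0 expr1 /=; ring.
Qed.

Lemma dist_two_term (K : comNzRingType) (r : K) (i : nat) :
  r ^+ `|i - 0|%N - r * r ^+ `|i - 1|%N = (1 - r ^+ 2) * (i == 0%N)%:R.
Proof.
case: i => [|i]; first by rewrite distnn expr0 expr1 /=; ring.
rewrite (_ : `|i.+1 - 0|%N = i.+1); last by lia.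
rewrite (_ : `|i.+1 - 1|%N = i); last by lia.
by rewrite exprS /=; ring.
Qed.

Lemma kms_eigenvector_flip n (rho l : C) (v : 'rV[C]_n) :
  v *m KMS n rho = l *: v ->
  (\row_j v 0 (rev_ord j)) *m KMS n rho = l *: (\row_j v 0 (rev_ord j)).
Proof.
move=> hv; apply/rowP => j; rewrite !mxE.
have := congr1 (fun w : 'rV[C]_n => w 0 (rev_ord j)) hv; rewrite !mxE => <-.
rewrite (reindex_inj rev_ord_inj) /=; apply: eq_bigr => i _.
rewrite !mxE rev_ordK; congr (_ * _ ^+ _) => /=.
by have := ltn_ord i; have := ltn_ord j; lia.
Qed.

(** An eigenvector is determined by its first entry: the relation between the first two columns
    starts the recursion, the three-term relation continues it, and [e] is its solution normalised
    at 0. *)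
Lemma kms_eigenvector_rec n (rho l : C) (v : 'rV[C]_n) (e : nat -> C) :
  v *m KMS n rho = l *: v -> l * rho != 0 ->
  e 0%N = 1 -> l * rho * e 1%N = l - (1 - rho ^+ 2) ->
  (forall k, l * rho * (e k + e k.+2) = (l * (1 + rho ^+ 2) - (1 - rho ^+ 2)) * e k.+1) ->
  forall (j k : 'I_n), nat_of_ord k = 0%N -> v 0 j = e j * v 0 k.
Proof.
move=> hv lr e0 e1 e2 j0 k k0.
pose w (j : nat) := \sum_(i < n) v 0 i * (i == j :> nat)%:R.
pose g (j : nat) := \sum_(i < n) v 0 i * rho ^+ `|i - j|%N.
have wE (j : 'I_n) : w j = v 0 j.
  rewrite /w (bigD1 j) //= eqxx mulr1 big1 ?addr0// => i ij.
  by rewrite (negPf (ij : nat_of_ord i != j)) mulr0.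
have gE (j : 'I_n) : g j = l * w j.
  have := congr1 (fun u : 'rV[C]_n => u 0 j) hv; rewrite !mxE wE => <-.
  by apply: eq_bigr => i _; rewrite mxE.
have gE' j : (j < n)%N -> g j = l * w j by move=> hj; exact: (gE (Ordinal hj)).
have g0 : g 0%N - rho * g 1%N = (1 - rho ^+ 2) * w 0%N.
  rewrite /g /w !mulr_sumr -sumrB; apply: eq_bigr => i _.
  by rewrite mulrCA -mulrBr dist_two_term mulrCA.
have g2 j : rho * (g j + g j.+2) = (1 + rho ^+ 2) * g j.+1 - (1 - rho ^+ 2) * w j.+1.
  rewrite /g /w -big_split !mulr_sumr -sumrB; apply: eq_bigr => i _ /=.
  by rewrite -mulrDr mulrCA dist_three_term; ring.
suff H j : (j < n)%N -> w j = e j * w 0%N.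
  by rewrite -!wE k0 H.
elim/ltn_ind: j => -[|[|j]] IH hj.
- by rewrite e0 mul1r.
- apply: (mulfI lr); rewrite mulrA e1 -mulrA mulrCA -gE'// mulrBl.
  by rewrite -g0 (gE' _ (ltnW hj)); ring.
- apply: (mulfI lr); have := g2 j.
  have j1 := ltnW hj; have j0' := ltnW j1.
  rewrite (gE' j) // (gE' j.+1) // (gE' j.+2) // (IH j) // (IH j.+1) // => h.
  have := congr1 ( *%R^~ (w 0%N)) (e2 j); rewrite mulrDr mulrDl => h'.
  transitivity (rho * (l * (e j * w 0%N) + l * w j.+2) - l * rho * e j * w 0%N).
    by ring.
  by rewrite h; transitivity ((l * (1 + rho ^+ 2) - (1 - rho ^+ 2)) * e j.+1 * w 0%N
     - l * rho * e j * w 0%N); [ring|rewrite -h'; ring].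
Qed.

(** The flipped vector is again an eigenvector, so it is the multiple of [e] by its first entry,
    which is the last entry of [v]. The flip therefore acts as the scalar [e (n - 1)]. *)
Lemma kms_critical_flip n (u y : C) (v : 'rV[C]_n) : odd n -> (1 < n)%N ->
  critical n u y -> v *m KMS n ('i%C * y) = - n%:R *: v ->
  forall j, v 0 (rev_ord j) = - (-1) ^+ n./2 * v 0 j.
Proof.
move=> on n2 cr hv.
have [[u0 u1 Vu uV] _ _] := cr.
have y0 := critical_y0 cr.
have n0 : n%:R != 0 :> C by rewrite pnatr_eq0 -lt0n ltnW.
have V0 : u ^+ n != 0 by rewrite expf_neq0.
(* Binet form of the recursion: the characteristic roots are [i u] and [- i / u], and the weights
   are fixed by [e 0] and [e 1]. *)
pose e k := (u * (u - y) * ('i%C * u) ^+ k + (1 + u * y) * (- 'i%C / u) ^+ k) / (u ^+ 2 + 1).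
have i2 := sqr_ic.
have pe : 1 + y ^+ 2 = - n%:R * ((1 - y ^+ 2) + y * (u - u^-1)).
  by apply: (mulIf u0); rewrite (critical_pencil cr); field.
have lr : - n%:R * ('i%C * y) != 0 :> C.
  by rewrite mulf_neq0 ?oppr_eq0// mulf_neq0// ic_neq0.
have e0 : e 0%N = 1 by rewrite /e !expr0; field.
have r2 : ('i%C * y) ^+ 2 = - y ^+ 2 by rewrite exprMn i2; ring.
have e1 : - n%:R * ('i%C * y) * e 1%N = - n%:R - (1 - ('i%C * y) ^+ 2).
  rewrite r2 opprK pe /e !expr1.
  rewrite (_ : _ * _ = - n%:R * y * 'i%C ^+ 2 * (u * (u - y) * u - (1 + u * y) / u) / (u ^+ 2 + 1)).
    by rewrite i2; field; rewrite u0 u1.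
  by field; rewrite u0 u1.
have e2 k : - n%:R * ('i%C * y) * (e k + e k.+2) =
    (- n%:R * (1 + ('i%C * y) ^+ 2) - (1 - ('i%C * y) ^+ 2)) * e k.+1.
  rewrite r2 opprK pe /e !exprS.
  set p := (_ * u) ^+ k; set q := _ ^+ k.
  have -> : u * (u - y) * ('i%C * u * ('i%C * u * p)) + (1 + u * y) * (- 'i%C / u * (- 'i%C / u * q))
     = 'i%C ^+ 2 * (u * (u - y) * u ^+ 2 * p + (1 + u * y) * q / u ^+ 2) by field.
  by rewrite i2; field; rewrite u0 u1.
have key := fun w hw => @kms_eigenvector_rec n _ _ w e hw lr e0 e1 e2.
have n_gt0 : (0 < n)%N by exact: ltnW.
pose k0 := Ordinal n_gt0.
have en : e n.-1 = - (-1) ^+ n./2.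
  have En : n.-1 = (n./2 * 2)%N by rewrite -{1}(odd_double_half n) on -muln2.
  have Vn : u ^+ n = u * u ^+ n.-1 by rewrite -exprS prednK.
  have W0 : u ^+ n.-1 != 0 by rewrite expf_neq0.
  have s1 : (-1) ^+ n./2 * (-1) ^+ n./2 = 1 :> C by rewrite -exprMn mulrNN mulr1 expr1n.
  have p1 : ('i%C * u) ^+ n.-1 = (-1) ^+ n./2 * u ^+ n.-1.
    by rewrite exprMn {1}En mulnC exprM i2.
  have p2 : (- 'i%C / u) ^+ n.-1 = (-1) ^+ n./2 / u ^+ n.-1.
    by rewrite exprMn {1}En mulnC exprM sqrrN i2 exprVn.
  rewrite /e p1 p2 (critical_y cr) Vn; field.
  by rewrite W0 u1 -Vn Vu.
move=> j; have h1 := key _ (kms_eigenvector_flip hv) j k0 erefl.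
have h2 := key _ hv j k0 erefl.
have h3 := key _ hv (rev_ord k0) k0 erefl.
rewrite !mxE in h1; rewrite h1 h3 h2 /= subn1 en; ring.
Qed.

End KMS.

(** * Isolation and uniqueness of the coalescing pair *)

Section Localisation.
Context {R : realType}.
Local Notation C := R[i].

(** For [r >= |l| + 1] dividing out a linear factor does not increase the norm, so cofactors are
    bounded without any knowledge of their roots. *)
Lemma pnorm_factor (r : R) (l : C) (g : {poly C}) : N l + 1 <= r ->
  pnorm r g <= pnorm r (('X - l%:P) * g).
Proof.
move=> h; have r0 : 0 <= r by apply: le_trans h; rewrite addr_ge0 ?normc_ge0.
have : r * pnorm r g <= pnorm r (('X - l%:P) * g) + N l * pnorm r g.
  rewrite -pnormMX -pnormCM; have := pnormD (('X - l%:P) * g) (l%:P * g) r0.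
  by rewrite (_ : _ + _ = g * 'X)//; ring.
have := pnorm_ge0 g r0; nra.
Qed.

(** At [c + t] each of the three linear factors is at most [2 t], and the cofactor is controlled by
    [pnorm_factor]. *)
Lemma three_roots_small (P g : {poly C}) (c l1 l2 l3 : C) (t : R) :
  0 < t -> t <= 1 -> N (l1 - c) < t -> N (l2 - c) < t -> N (l3 - c) < t ->
  P = ('X - l1%:P) * (('X - l2%:P) * (('X - l3%:P) * g)) ->
  N P.[c + t%:C] <= 8 * t ^+ 3 * pnorm (N c + 2) P.
Proof.
move=> t0 t1 h1 h2 h3 E; pose r := N c + 2.
have hl l : N (l - c) < t -> N l + 1 <= r.
  by move=> h; have := normc_triangleB l c; rewrite /r; lra.
have r0 : 0 <= r by rewrite addr_ge0 ?normc_ge0.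
have hg : pnorm r g <= pnorm r P.
  rewrite E; apply: le_trans (pnorm_factor _ (hl _ h1)).
  by apply: le_trans (pnorm_factor _ (hl _ h2)); exact: pnorm_factor (hl _ h3).
have hw l : N (l - c) < t -> N (c + t%:C - l) <= 2 * t.
  move=> h; rewrite (_ : c + _ - l = (c - l) + t%:C); last by ring.
  apply: le_trans (normc_triangle _ _) _; rewrite normcB_sym normc_real gtr0_norm//; lra.
have hgw : N g.[c + t%:C] <= pnorm r P.
  apply: le_trans hg; apply: pnorm_horner.
  by apply: le_trans (normc_triangle _ _) _; rewrite normc_real gtr0_norm// /r; lra.
have t2 : 0 <= 2 * t by rewrite mulr_ge0// ltW.
rewrite E !hornerM !hornerXsubC !Normc.normcM -E -/r.
rewrite [leRHS](_ : _ = 2 * t * (2 * t * (2 * t * pnorm r P))); last by ring.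
by do !(apply: ler_pM; rewrite ?mulr_ge0 ?normc_ge0// ?hw//).
Qed.

(** The inner variable is [rho]; with [rho] as a polynomial variable, bounds on coefficients and
    Lipschitz estimates in [rho] follow from those for polynomials. *)
Definition kms_poly n : {poly {poly C}} :=
  char_poly (\matrix_(j < n, k < n) 'X^(`|j - k|%N) : 'M[{poly C}]_n).

Lemma kms_polyE n rho : map_poly (horner_eval rho) (kms_poly n) = char_poly (KMS n rho).
Proof.
rewrite /kms_poly map_char_poly; congr char_poly; apply/matrixP => i j.
by rewrite !mxE /= /horner_eval hornerXn.
Qed.

Lemma kms_poly_bounded n (r s : R) : 0 <= r -> exists2 M : R, 0 <= M &
  forall rho, N rho <= s -> pnorm r (char_poly (KMS n rho)) <= M.
Proof.
move=> r0; exists (\sum_(k < n.+1) pnorm `|s| (kms_poly n)`_k * r ^+ k).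
  by apply: sumr_ge0 => k _; rewrite mulr_ge0 ?exprn_ge0 ?pnorm_ge0.
move=> rho hrho; rewrite (@pnorm_widen _ _ _ n.+1) ?size_char_poly//.
apply: ler_sum => k _; rewrite ler_wpM2r ?exprn_ge0// -kms_polyE coef_map /=.
by apply: pnorm_horner; apply: le_trans hrho (ler_norm _).
Qed.

Lemma kms_poly_lipschitz n (w : C) (s : R) : 0 <= s -> exists2 L : R, 0 <= L &
  forall rho rho', N rho <= s -> N rho' <= s ->
    N ((char_poly (KMS n rho)).[w] - (char_poly (KMS n rho')).[w]) <= L * N (rho - rho').
Proof.
move=> s0; have [L L0 hL] := horner_lipschitz ((kms_poly n).[w%:P]) s0.
by exists L => // rho rho' h h'; have := hL _ _ h h'; rewrite !horner2_eval !kms_polyE !hornerC.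
Qed.

Lemma cubic_gap (t k M p q r : R) : 0 < t -> 16 * t * M < k ->
  p <= 8 * t ^+ 3 * M -> q <= t ^+ 2 * k / 2 -> t ^+ 2 * k <= r -> r <= p + q -> False.
Proof.
move=> t0 h hp hq hr hle.
have : t ^+ 2 * (k - 16 * t * M) <= 0.
  rewrite (_ : _ * _ = t ^+ 2 * k - 2 * (8 * t ^+ 3 * M)); last by ring.
  lra.
by rewrite pmulr_rle0 ?exprn_gt0// subr_le0 leNgt h.
Qed.

(** A third root in the disc would make the polynomial of order [t^3] at [lc + t], whereas at
    [rhoc], and by continuity in [rho] nearby, it is at least of order [t^2] there. *)
Lemma kms_isolated n (rhoc lc : C) :
  mup lc (char_poly (KMS n rhoc)) = 2%N ->
  exists t d : R, [/\ 0 < t, 0 < d & forall rho l1 l2 q, N (rho - rhoc) < d ->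
    N (l1 - lc) < t -> N (l2 - lc) < t ->
    char_poly (KMS n rho) = ('X - l1%:P) * ('X - l2%:P) * q ->
    forall l, N (l - lc) < t -> ~~ root q l].
Proof.
move=> mu; pose P (rho : C) := char_poly (KMS n rho).
have P0 rho : P rho != 0 by rewrite monic_neq0 ?char_poly_monic.
have [q0 Eq0 q0c] : exists2 q0, P rhoc = q0 * ('X - lc%:P) ^+ 2 & q0.[lc] != 0.
  have := mup_geq lc 2 (P0 rhoc); rewrite mu leqnn => /esym/dvdpP[q0 E].
  exists q0 => //; apply/negP => /factor_theorem[q1 E1].
  have := mup_geq lc 3 (P0 rhoc); rewrite mu ltnn => /esym/negP; apply.
  by rewrite E E1 -mulrA -exprS dvdp_mulIr.
pose k : R := N q0.[lc] / 2; have k0 : 0 < k by rewrite divr_gt0// normc_gt0.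
have nlc := normc_ge0 lc; have nrc := normc_ge0 rhoc.
have [L L0 hL] := horner_lipschitz q0 (addr_ge0 nlc ler01).
have r0 : 0 <= N lc + 2 by lra.
have [M M0 hM] := kms_poly_bounded n (N rhoc + 1) r0.
(* The bound [k / (L + 1)] keeps [|q0| >= k] at [lc + t]; the bound with 16 puts the cubic estimate
   below [t^2 k / 2]. The radius [d] below limits the effect of moving [rho] to the other half. *)
pose t := Num.min 1 (Num.min (k / (L + 1)) (k / (16 * (M + 1)))).
have L1 : 0 < L + 1 by rewrite ltr_wpDl.
have M1 : 0 < 16 * (M + 1) by rewrite mulr_gt0// ltr_wpDl.
have t0 : 0 < t by rewrite !lt_min ltr01 (divr_gt0 k0 L1) (divr_gt0 k0 M1).
have t1 : t <= 1 by rewrite ge_min lexx.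
have tL : L * t <= k.
  have : t <= k / (L + 1) by rewrite !ge_min lexx orbT.
  rewrite ler_pdivlMr; [nra|lra].
have tM : 16 * t * M < k.
  have : t <= k / (16 * (M + 1)) by rewrite !ge_min lexx !orbT.
  rewrite ler_pdivlMr; [nra|rewrite mulr_gt0//; lra].
pose w := lc + t%:C.
have [L' L'0 hL'] := kms_poly_lipschitz n w (addr_ge0 nrc ler01).
pose d := Num.min 1 (t ^+ 2 * k / (2 * (L' + 1))).
have tk : 0 < t ^+ 2 * k by rewrite mulr_gt0// exprn_gt0.
have d0 : 0 < d by rewrite lt_min ltr01 divr_gt0// mulr_gt0//; lra.
exists t, d; split => // rho l1 l2 q hrho h1 h2 E l hl; apply/negP => /factor_theorem[g Eg].
have hr1 : N rho <= N rhoc + 1.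
  have := normc_triangleB rho rhoc; move: hrho; rewrite lt_min => /andP[]; lra.
have small : N (P rho).[w] <= 8 * t ^+ 3 * M.
  apply: le_trans (@three_roots_small (P rho) g lc l1 l2 l t t0 t1 h1 h2 hl _) _.
    by rewrite /P E Eg; ring.
  by rewrite ler_wpM2l ?hM// mulr_ge0// exprn_ge0// ltW.
have close : N ((P rho).[w] - (P rhoc).[w]) <= t ^+ 2 * k / 2.
  apply: le_trans (hL' _ _ hr1 _) _; first by lra.
  have : N (rho - rhoc) <= t ^+ 2 * k / (2 * (L' + 1)).
    by move: hrho; rewrite lt_min => /andP[_ /ltW].
  rewrite ler_pdivlMr; last by rewrite mulr_gt0//; lra.
  by have := normc_ge0 (rho - rhoc); nra.
have large : t ^+ 2 * k <= N (P rhoc).[w].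
  rewrite Eq0 hornerM horner_exp hornerXsubC (Normc.normcM q0.[w]) normcX mulrC.
  rewrite (_ : w - lc = t%:C); last by rewrite /w; ring.
  rewrite normc_real gtr0_norm// ler_wpM2r ?exprn_ge0 ?(ltW t0)//.
  have hw : N w <= N lc + 1.
    by apply: le_trans (normc_triangle _ _) _; rewrite normc_real gtr0_norm//; lra.
  have := hL lc w _ hw; rewrite lerDl ler01 => /(_ isT).
  rewrite (_ : lc - w = - t%:C); last by rewrite /w; ring.
  rewrite normcN normc_real gtr0_norm// => hq.
  by have := normc_triangleB q0.[lc] q0.[w]; rewrite /k in tL *; lra.
have := normc_triangleB (P rhoc).[w] (P rho).[w]; rewrite [N (_ - _)]normcB_sym.
exact: cubic_gap small close large.
Qed.

End Localisation.

(** * The coalescing pair and uniqueness of its Puiseux coefficients *)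

Section Pairs.
Context {R : realType}.
Local Notation C := R[i].

Lemma power_series_opp (c : nat -> C) f : power_series c f ->
  power_series (fun k => (-1) ^+ k * c k) (fun z => f (- z)).
Proof.
move=> [S [B [S0 B0 h]]]; exists S, B; split => // n z hz.
have -> : psum (fun k => (-1) ^+ k * c k) n z = psum c n (- z).
  by apply: eq_bigr => k _; rewrite [in RHS]exprNn; ring.
by rewrite -(normcN z) h// normcN.
Qed.

Lemma near0_opp (P : C -> Prop) : near0 P -> near0 (fun z => P (- z)).
Proof. by move=> [d d0 h]; exists d => // z hz; apply: h; rewrite normcN. Qed.

(** For [z] nonzero the two roots [lc * f z] and [lc * f (- z)] are distinct because [c 1] is
    nonzero, so both linear factors split off; at [z = 0] the multiplicity hypothesis supplies the
    square. Isolation does the rest. *)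
Lemma puiseux_pair n (rhoc lc : C) c f :
  lc != 0 -> mup lc (char_poly (KMS n rhoc)) = 2%N ->
  power_series c f -> c 0%N = 1 -> c 1%N != 0 ->
  near0 (fun z => root (char_poly (KMS n (rhoc + z ^+ 2))) (lc * f z)) ->
  exists2 eta : R, 0 < eta & near0 (fun z =>
    eigenvalue_pair_near n lc eta (rhoc + z ^+ 2) (lc * f z) (lc * f (- z))).
Proof.
move=> lc0 mu hf c0 c1 hroot.
have [t [d [t0 d0 iso]]] := kms_isolated mu.
exists t => //.
have e0 : 0 < t / N lc by rewrite divr_gt0// normc_gt0.
have hc := power_series_cont e0 hf.
have [M M0 hj] := power_series_jet 2 hf.
have nc1 : 0 < N (c 1%N) by rewrite normc_gt0.
have m0 : 0 < Num.min (Num.min 1 d) (N (c 1%N) / (M + 1)).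
  by rewrite !lt_min ltr01 d0 divr_gt0//; lra.
apply: near0W (near0_and (near0_lt m0) (near0_and (near0_and hroot (near0_opp hroot))
  (near0_and (near0_and hc (near0_opp hc)) (near0_and hj (near0_opp hj)))))
  => z [hz [[hr hr'] [[hcz hcz'] [hjz hjz']]]].
move: hz; rewrite !lt_min => /andP[/andP[z1 zd] zM].
have nz0 := normc_ge0 z.
have zd' : N (rhoc + z ^+ 2 - rhoc) < d.
  by rewrite (_ : rhoc + _ - _ = z ^+ 2); [rewrite normcX expr2; nra|ring].
have lt_t y : N (f y - c 0%N) < t / N lc -> N (lc * f y - lc) < t.
  rewrite c0 ltr_pdivlMr ?normc_gt0// => h.
  by rewrite (_ : lc * f y - lc = (f y - 1) * lc); [rewrite Normc.normcM|ring].
have h1 := lt_t _ hcz; have h2 := lt_t _ hcz'.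
suff [q Eq] : exists q, char_poly (KMS n (rhoc + z ^+ 2))
    = ('X - (lc * f z)%:P) * ('X - (lc * f (- z))%:P) * q.
  by split => //; exists q; split => // l hl; exact: iso Eq l hl.
have [->|z0] := eqVneq z 0.
  rewrite oppr0 (power_series_at0 hf) c0 mulr1 expr0n addr0.
  have := mup_geq lc 2 (monic_neq0 (char_poly_monic (KMS n rhoc))).
  by rewrite mu leqnn => /esym/dvdpP[q ->]; exists q; rewrite mulrC expr2.
(* Equality would force [2 |c 1| |z| <= 2 M |z|^2], against the bound imposed on [|z|]. *)
have ne : lc * f (- z) != lc * f z.
  rewrite (inj_eq (mulfI lc0)); apply/eqP => e.
  have nz : 0 < N z by rewrite normc_gt0.
  rewrite sqrrN in hr'.
  move: hjz hjz'; rewrite e /psum !big_ord_recr !big_ord0 /= !add0r !expr0 !expr1 normcN.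
  set A := f z => hA hB.
  have : N (2 * (c 1%N * z)) <= 2 * (M * N z ^+ 2).
    rewrite (_ : 2 * (c 1%N * z) = (A - (c 0%N * 1 + c 1%N * - z)) - (A - (c 0%N * 1 + c 1%N * z))).
      by apply: le_trans (normc_triangle _ _) _; rewrite normcN; lra.
    by ring.
  rewrite !Normc.normcM (_ : N 2 = 2); last first.
    by rewrite (_ : 2 = 2%:C) ?normc_real ?ger0_norm// rmorphMn rmorph1.
  rewrite ler_pM2l// expr2 mulrA ler_pM2r//.
  by move: zM; rewrite ltr_pdivlMr; [nra|lra].
have /factor_theorem[q1 E1] := hr.
have : root q1 (lc * f (- z)).
  move: hr'; rewrite sqrrN E1 rootM root_XsubC => /orP[//|/eqP e].
  by rewrite e eqxx in ne.
by move=> /factor_theorem[q E2]; exists q; rewrite E1 E2; ring.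
Qed.

(** Makes the choice of radius immaterial: [l1] and [l2] lie in the smaller disc, so they are not
    roots of the cofactor of the larger one. Cancelling linear factors one at a time respects
    multiplicity. *)
Lemma pair_near_unique n (lc : C) (eta eta' : R) (rho l1 l2 m1 m2 : C) :
  eigenvalue_pair_near n lc eta rho l1 l2 ->
  eigenvalue_pair_near n lc eta' rho m1 m2 ->
  (l1 = m1 /\ l2 = m2) \/ (l1 = m2 /\ l2 = m1).
Proof.
wlog: eta eta' l1 l2 m1 m2 / eta <= eta'.
  move=> wl hl hm; case: (leP eta eta') => [h|/ltW h]; first exact: wl h hl hm.
  by case: (wl _ _ _ _ _ _ h hm hl) => -[-> ->]; [left|right].
move=> le [hl1 hl2 [q [Eq _]]] [_ _ [q' [Eq' hq']]].
have nq' l : N (l - lc) < eta -> ~~ root q' l by move=> h; apply/hq'/(lt_le_trans h).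
have E : ('X - l1%:P) * (('X - l2%:P) * q) = ('X - m1%:P) * (('X - m2%:P) * q').
  by rewrite !mulrA -Eq.
have cancel p1 p2 (l : C) : ('X - l%:P) * p1 = ('X - l%:P) * p2 -> p1 = p2.
  by apply: mulfI; rewrite polyXsubC_eq0.
have step (m : C) : ('X - l2%:P) * q = ('X - m%:P) * q' -> l2 = m.
  move=> E2; have : root (('X - m%:P) * q') l2 by rewrite -E2 rootM root_XsubC eqxx.
  by rewrite rootM root_XsubC (negPf (nq' _ hl2)) orbF => /eqP.
have : root (('X - m1%:P) * (('X - m2%:P) * q')) l1 by rewrite -E rootM root_XsubC eqxx.
rewrite !rootM !root_XsubC (negPf (nq' _ hl1)) orbF => /orP[]/eqP e; subst l1.
  by left; split => //; apply: step; exact: cancel E.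
right; split => //; apply: step; apply: (cancel _ _ m2); rewrite E; ring.
Qed.

(** The two eigenvalues may be exchanged from one [z] to the next, so only symmetric functions of
    [f z] and [f (- z)] can be compared: the sum gives the second coefficient, then the product
    gives the square of the first. *)
Lemma puiseux_coef_unique n (rhoc lc : C) c c' : lc != 0 ->
  puiseux_series n rhoc lc c -> puiseux_series n rhoc lc c' ->
  c' 2%N = c 2%N /\ (c' 1%N = c 1%N \/ c' 1%N = - c 1%N).
Proof.
move=> lc0 [c0 [eta [del [f [eta0 del0 hf]]]]] [c0' [eta' [del' [f' [eta0' del0' hf']]]]].
have pf := cvg_power_series del0 (fun z hz => (hf z hz).1).
have pf' := cvg_power_series del0' (fun z hz => (hf' z hz).1).
have hz : near0 (fun z => (f z = f' z /\ f (- z) = f' (- z)) \/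
                          (f z = f' (- z) /\ f (- z) = f' z)).
  apply: near0W (near0_and (near0_lt del0) (near0_lt del0')) => z [/hf[_ h] /hf'[_ h']].
  by case: (pair_near_unique h h') => -[/(mulfI lc0) -> /(mulfI lc0) ->]; [left|right].
have hs : near0 (fun z => f z + f (- z) = f' z + f' (- z)).
  by apply: near0W hz => z [] [-> ->]//; rewrite addrC.
have hp : near0 (fun z => f z * f (- z) = f' z * f' (- z)).
  by apply: near0W hz => z [] [-> ->]//; rewrite mulrC.
have := power_series_uniq (power_series_near hs (power_seriesD pf (power_series_opp pf)))
  (power_seriesD pf' (power_series_opp pf')).
move=> /(_ 2%N) /= e2.
have := power_series_uniq (power_series_near hp (power_seriesM pf (power_series_opp pf)))
  (power_seriesM pf' (power_series_opp pf')).
move=> /(_ 2%N) /=; rewrite !cauchy2 c0 c0' => e1.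
have E2 : c' 2%N = c 2%N.
  have two : 2 != 0 :> C by rewrite pnatr_eq0.
  apply: (mulfI two).
  transitivity (c' 2%N + (-1) ^+ 2 * c' 2%N); first by ring.
  by rewrite -e2; ring.
split => //; have : c' 1%N ^+ 2 = c 1%N ^+ 2.
  move: e1; rewrite E2 => e1.
  transitivity (c 1%N ^+ 2 + ((1 * ((-1) ^+ 2 * c 2%N) + c 1%N * ((-1) ^+ 1 * c 1%N) + c 2%N * ((-1) ^+ 0 * 1))
   - (1 * ((-1) ^+ 2 * c 2%N) + c' 1%N * ((-1) ^+ 1 * c' 1%N) + c 2%N * ((-1) ^+ 0 * 1)))).
    by ring.
  by rewrite e1 subrr addr0.
by move/eqP; rewrite eqf_sqr => /orP[]/eqP; [left|right].
Qed.

End Pairs.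

(** * The Puiseux series *)

Section JetAlgebra.
Context {K : numFieldType}.
Implicit Types u V n : K.

(** For [u = exp alpha] and [V = exp (n alpha)] this is [sinh (n alpha) - sinh alpha]. Then [slope]
    is its quotient by [cosh alpha], the factor from the first coefficient of [log v] to that of the
    eigenvalue. *)
Definition sinh_gap u V := ((V - V^-1) - (u - u^-1)) / 2.
Definition slope u V := 2 * sinh_gap u V / ((u + u^-1) / 2) / 2.
(** This is [b_n]. The first summand is half of [a_n^2], the second a positive multiple of
    [sinh (n alpha) - n sinh alpha]; the split makes the comparison of [a_n^2] with [2 b_n]
    visible. *)
Definition curvature n u V :=
  sinh_gap u V * ((V / u + u / V) / 2 - 1) / (n * ((u + u^-1) / 2) ^+ 2)
  + (n - 1) / (3 * n) * ((V - V^-1) / 2 - n * ((u - u^-1) / 2)).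

(** The long hypotheses are Taylor coefficients: the third one of [phi (v, y - i z^2) = 0], and the
    first three of [f n (v^(n+1) + v^(n-1)) = v^(2n) + 1], which expresses the eigenvalue along the
    branch. *)
Lemma jet_algebra (n u V y ii d1 d2 d3 f0 f1 f2 : K) :
  u != 0 -> V != 0 -> u ^+ 2 + 1 != 0 -> V ^+ 2 + 1 != 0 -> V - u != 0 -> u * V + 1 != 0 ->
  d1 != 0 ->
  n = u * (V ^+ 2 + 1) / (V * (u ^+ 2 + 1)) -> y = (u * V + 1) / (V - u) ->
  n * (u * V + 1) * d1 ^+ 2 = - 2 * ii * (V - u) ->
  u * V * ((n + 1) * d3 + (n + 1) ^+ 2 * d1 * d2 + ((n + 1) * d1) ^+ 3 / 6)
    - (y * (V * (n * d3 + n ^+ 2 * d1 * d2 + (n * d1) ^+ 3 / 6)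
            - u * (d3 + d1 * d2 + d1 ^+ 3 / 6))
       - ii * (V * (n * d1) - u * d1)) = 0 ->
  f0 * (n * (u * V + V / u)) = V ^+ 2 + 1 ->
  f0 * (n * (u * V * ((n + 1) * d1) + V / u * ((n - 1) * d1)))
    + f1 * (n * (u * V + V / u)) = V ^+ 2 * (2 * n * d1) ->
  f0 * (n * (u * V * ((n + 1) * d2 + ((n + 1) * d1) ^+ 2 / 2)
             + V / u * ((n - 1) * d2 + ((n - 1) * d1) ^+ 2 / 2)))
    + f1 * (n * (u * V * ((n + 1) * d1) + V / u * ((n - 1) * d1)))
    + f2 * (n * (u * V + V / u)) = V ^+ 2 * (2 * n * d2 + (2 * n * d1) ^+ 2 / 2) ->
  [/\ f0 = 1, f1 = d1 * slope u V & f2 = - ii * curvature n u V].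
Proof.
move=> u0 V0 u1 V1 Vu uV d10 hn hy hd1 E3 F0 F1 F2.
have n0 : n != 0 by rewrite hn !mulf_neq0 ?invr_eq0 ?mulf_neq0.
have D0 : n * (u * V + V / u) = V ^+ 2 + 1.
  by rewrite hn; field; rewrite u0 V0 u1.
rewrite !D0 in F0 F1 F2.
have f01 : f0 = 1 by apply: (mulIf V1); rewrite F0 mul1r.
have f1E : f1 = d1 * slope u V.
  apply: (mulIf V1).
  transitivity (V ^+ 2 * (2 * n * d1)
    - f0 * (n * (u * V * ((n + 1) * d1) + V / u * ((n - 1) * d1)))).
    by rewrite -F1; ring.
  by rewrite f01 /slope /sinh_gap hn; field; rewrite ?u0 ?V0 ?u1.
pose k := (n * V - u) / (n * (u * V + 1))
  - ((n + 1) ^+ 3 * u * V - y * (n ^+ 3 * V - u)) * (V - u) / (3 * (n * (u * V + 1)) ^+ 2).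
have nn : n * (u * V + 1) != 0 by rewrite mulf_neq0.
have d1sq : d1 ^+ 2 = - 2 * ii * (V - u) / (n * (u * V + 1)).
  by rewrite -hd1; field; rewrite n0 uV.
(* The coefficient of [d3] is [u phi'(u)] and vanishes at a double zero; the third-order equation
   therefore determines [d2], with [c2] as its nonzero factor. *)
have c1 : (n + 1) * u * V - y * (n * V - u) = 0.
  by rewrite hn hy; field; rewrite ?u0 ?V0 ?u1 ?Vu.
have c2 : (n + 1) ^+ 2 * u * V - y * (n ^+ 2 * V - u) = n * (u * V + 1).
  by rewrite hn hy; field; rewrite ?u0 ?V0 ?u1 ?Vu.
have d2E : d2 = - ii * k.
  apply: (mulfI nn); apply: (mulfI d10).
  transitivity (- (d1 * (d1 ^+ 2 * ((n + 1) ^+ 3 * u * V - y * (n ^+ 3 * V - u)) / 6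
     + ii * (n * V - u)))).
    rewrite -c2; apply/eqP; rewrite -subr_eq0; apply/eqP.
    transitivity (0 - d3 * ((n + 1) * u * V - y * (n * V - u))); last by rewrite c1; ring.
    by rewrite -{1}E3; field.
  by rewrite d1sq /k; field; rewrite n0 uV.
split => //; apply: (mulIf V1).
transitivity (V ^+ 2 * (2 * n * d2 + (2 * n) ^+ 2 / 2 * d1 ^+ 2)
  - n * (u * V * ((n + 1) * d2 + (n + 1) ^+ 2 / 2 * d1 ^+ 2)
             + V / u * ((n - 1) * d2 + (n - 1) ^+ 2 / 2 * d1 ^+ 2))
  - slope u V * (n * (u * V * (n + 1) + V / u * (n - 1))) * d1 ^+ 2).
  transitivity (V ^+ 2 * (2 * n * d2 + (2 * n * d1) ^+ 2 / 2)
    - f0 * (n * (u * V * ((n + 1) * d2 + ((n + 1) * d1) ^+ 2 / 2)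
             + V / u * ((n - 1) * d2 + ((n - 1) * d1) ^+ 2 / 2)))
    - f1 * (n * (u * V * ((n + 1) * d1) + V / u * ((n - 1) * d1)))).
    by rewrite -F2; ring.
  by rewrite f01 f1E; field; rewrite u0.
rewrite d2E d1sq /k /curvature /slope /sinh_gap hy hn.
by field; rewrite ?u0 ?V0 ?u1 ?V1 ?Vu ?uV.
Qed.

End JetAlgebra.

(** Forgets the coefficients, for auxiliary functions of which only the existence of an expansion
    matters. *)
Definition analytic0 (R : realType) (f : R[i] -> R[i]) := exists c, power_series c f.

Section KMSSeries.
Context {R : realType}.
Local Notation C := R[i].
Implicit Types f g : C -> C.

Lemma analytic0_cst (a : C) : analytic0 (fun=> a).
Proof. by eexists; exact: power_series_cst. Qed.

Lemma analytic0_id : analytic0 (fun z : C => z).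
Proof. by eexists; exact: power_series_id. Qed.

Lemma analytic0D f g : analytic0 f -> analytic0 g -> analytic0 (fun z => f z + g z).
Proof. by move=> [c hc] [d hd]; eexists; exact: power_seriesD hc hd. Qed.

Lemma analytic0M f g : analytic0 f -> analytic0 g -> analytic0 (fun z => f z * g z).
Proof. by move=> [c hc] [d hd]; eexists; exact: power_seriesM hc hd. Qed.

Lemma analytic0N f : analytic0 f -> analytic0 (fun z => - f z).
Proof.
move=> h; have := analytic0M (analytic0_cst (-1)) h.
by congr analytic0; apply/funext => z; rewrite mulN1r.
Qed.

Lemma analytic0X f k : analytic0 f -> analytic0 (fun z => f z ^+ k).
Proof. by move=> [c hc]; eexists; exact: power_seriesX hc. Qed.

Lemma analytic0_sum n (F : nat -> C -> C) : (forall k, analytic0 (F k)) ->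
  analytic0 (fun z => \sum_(k < n) F k z).
Proof.
move=> h; elim: n => [|n IH].
  by under eq_fun do rewrite big_ord0; exact: analytic0_cst.
by under eq_fun do rewrite big_ord_recr; exact: analytic0D.
Qed.

Lemma analytic0_neq0 f : analytic0 f -> f 0 != 0 -> near0 (fun z => f z != 0).
Proof. by move=> [c hc]; rewrite (power_series_at0 hc) => h; exact: power_series_neq0 hc. Qed.

Context (n : nat) (u y d : C).
Context (on : odd n) (n2 : (1 < n)%N) (cr : critical n u y).
Context (hd : n%:R * (u * u ^+ n + 1) * d ^+ 2 = - 2 * 'i%C * (u ^+ n - u)).

Let n0 : n%:R != 0 :> C. Proof. by rewrite pnatr_eq0 -lt0n ltnW. Qed.

Let d0 : d != 0.
Proof.
have [[_ _ Vu _] _ _] := cr; apply: contraTneq Vu => d0; move/eqP: hd.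
rewrite d0 expr0n mulr0 eq_sym !mulf_eq0 oppr_eq0 pnatr_eq0 (negPf ic_neq0) /=.
by move=> ->.
Qed.

(** Since [i (y - i z^2) = i y + z^2], moving [rho] by [z^2] perturbs [y] by [- i z^2]. With
    [t = v - u] the equation becomes [t^2 Q(u + t) + i z^2 ((u + t)^n - (u + t)) = 0], and the
    condition on [d] is its leading term for [t = u d z]. *)
Lemma kms_branch : exists c v, [/\ power_series c v, c 0%N = u, c 1%N = u * d
  & near0 (fun z => phi n (v z) (y - 'i%C * z ^+ 2) = 0)].
Proof.
have [[u0 u1 Vu uV] _ hy] := cr.
have [Q [EQ Qu]] := phi_double n2 cr.
pose P : {poly C} := Q \Po ('X + u%:P).
pose S : {poly C} := 'i%C *: (('X^n - 'X) \Po ('X + u%:P)).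
have PE t : P.[t] = Q.[t + u] by rewrite /P horner_comp !hornerE.
have SE t : S.[t] = 'i%C * ((t + u) ^+ n - (t + u)).
  by rewrite /S hornerZ horner_comp !hornerE.
have P0 : P.[0] != 0.
  rewrite PE add0r; apply: contraTneq (mulf_neq0 n0 uV) => q0.
  by rewrite -Qu q0 !mulr0 eqxx.
have E0 : (u * d) ^+ 2 * P.[0] + S.[0] = 0.
  rewrite PE SE !add0r; have two : 2 != 0 :> C by rewrite pnatr_eq0.
  apply: (mulfI two); rewrite mulr0.
  transitivity (d ^+ 2 * (u ^+ 2 * (2 * Q.[u])) + 2 * 'i%C * (u ^+ n - u)); first by ring.
  by rewrite Qu [d ^+ 2 * _]mulrC hd; ring.
have [c [w [hw c0 hz]]] := branch_power_series (mulf_neq0 u0 d0) P0 E0.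
have hv := power_seriesD (power_series_cst u) (power_seriesM power_series_id hw).
eexists; eexists; split; first exact: hv.
- by rewrite /= cauchy0 /=; ring.
- by rewrite /= cauchy1 /= c0; ring.
apply: near0W hz => z; rewrite PE SE => hz.
have -> : phi n (u + z * w z) (y - 'i%C * z ^+ 2) =
    (phiP n y).[u + z * w z] + 'i%C * z ^+ 2 * ((u + z * w z) ^+ n - (u + z * w z)).
  by rewrite phiP_horner /phi; ring.
rewrite EQ hornerM horner_exp hornerXsubC [u + _]addrC.
set t := z * w z; transitivity (z ^+ 2 * (w z ^+ 2 * Q.[t + u]
    + 'i%C * ((t + u) ^+ n - (t + u)))); first by rewrite /t; ring.
by rewrite hz mulr0.
Qed.

Lemma kms_eigenvalue_series : exists c f, [/\ power_series c f,
  near0 (fun z => root (char_poly (KMS n ('i%C * y + z ^+ 2))) (- n%:R * f z)) &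
  [/\ c 0%N = 1, c 1%N = d * slope u (u ^+ n)
    & c 2%N = - 'i%C * curvature n%:R u (u ^+ n)]].
Proof.
have [[u0 u1 Vu uV] _ hy] := cr.
have V0 : u ^+ n != 0 by rewrite expf_neq0.
have [cv [v [hv cv0 cv1 hphi]]] := kms_branch.
have av : analytic0 v by exists cv.
have v0 : v 0 = u by rewrite (power_series_at0 hv).
pose Y z := y - 'i%C * z ^+ 2.
have aY : analytic0 Y.
  apply: analytic0D (analytic0_cst _) (analytic0N _).
  exact: analytic0M (analytic0_cst _) (analytic0X _ analytic0_id).
have Y0 : Y 0 = y by rewrite /Y expr0n mulr0 subr0.
(* Inverse of [v] without inverting a series: [phi = 0] reads [v (v^n - Y v^(n-1) + Y) = -1]. *)
pose r z := - (v z ^+ n - Y z * v z ^+ n.-1 + Y z).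
have ar : analytic0 r.
  apply: analytic0N; apply: analytic0D => //; apply: analytic0D; first exact: analytic0X.
  by apply: analytic0N; apply: analytic0M => //; exact: analytic0X.
(* On the branch the eigenvalue is [- (v^(2n) + 1) / (v^(n+1) + v^(n-1))]. For odd [n] the factor
   [v^2 + 1] cancels and leaves a geometric sum times [v^-(n-1)], so [f] is polynomial in [v] and
   [r]. *)
pose f z := n%:R^-1 * (\sum_(k < n) (- v z ^+ 2) ^+ k) * r z ^+ n.-1.
have [cf hf] : analytic0 f.
  apply: analytic0M; last exact: analytic0X.
  apply: analytic0M; first exact: analytic0_cst.
  apply: (@analytic0_sum n (fun k z => (- v z ^+ 2) ^+ k)) => k.
  by apply: analytic0X; apply: analytic0N; exact: analytic0X.
have Vn t : t ^+ n = t * t ^+ n.-1 :> C by rewrite -exprS prednK// ltnW.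
have hvr : near0 (fun z => v z * r z = 1).
  apply: near0W hphi => z; rewrite /phi exprS -/(Y z) /r => h.
  transitivity (1 - (v z * v z ^+ n + 1 - Y z * (v z ^+ n - v z))); last by rewrite h subr0.
  by rewrite (Vn (v z)); ring.
have hfv : near0 (fun z => f z * (n%:R * (v z ^+ n.+1 + v z ^+ n.-1)) = v z ^+ (n.*2) + 1).
  apply: near0W hvr => z h.
  have hr : r z ^+ n.-1 * v z ^+ n.-1 = 1 by rewrite -exprMn mulrC h expr1n.
  have hs := subrX1 (- v z ^+ 2) n.
  have sg : (- v z ^+ 2) ^+ n = - v z ^+ n.*2.
    by rewrite exprNn -signr_odd on expr1 mulN1r -exprM mul2n.
  rewrite sg in hs.
  transitivity ((\sum_(k < n) (- v z ^+ 2) ^+ k) * (v z ^+ 2 + 1) * (r z ^+ n.-1 * v z ^+ n.-1)).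
    by rewrite /f (exprS _ n) (Vn (v z)); field.
  rewrite hr mulr1; transitivity (- ((- v z ^+ 2 - 1) * \sum_(k < n) (- v z ^+ 2) ^+ k)).
    by ring.
  by rewrite -hs; ring.
exists cf, f; split => //.
  have nV : near0 (fun z => v z ^+ n - v z != 0).
    apply: analytic0_neq0; last by rewrite v0.
    by apply: analytic0D (analytic0N _) => //; exact: analytic0X.
  have nv : near0 (fun z => 1 + v z ^+ 2 != 0).
    apply: analytic0_neq0; last by rewrite v0 addrC.
    by apply: analytic0D (analytic0_cst _) _; exact: analytic0X.
  have nd : near0 (fun z => pencil_den (Y z) (v z) != 0).
    apply: (@analytic0_neq0 (fun z => pencil_den (Y z) (v z))).
      apply: analytic0D; apply: analytic0M => //.
        by apply: analytic0D (analytic0_cst _) (analytic0N _); exact: analytic0X.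
      apply: analytic0D (analytic0_cst _); exact: analytic0X.
    rewrite Y0 v0; apply/eqP => b0; have := critical_pencil cr.
    rewrite -/(pencil_den y u) b0 mulr0 => /eqP.
    by rewrite mulf_eq0 (negPf (critical_y1 n2 cr)) (negPf u0).
  apply: near0W (near0_and (near0_and hphi hvr) (near0_and hfv (near0_and nV (near0_and nv nd))))
    => z [[hp hr] [hfz [nVz [nvz ndz]]]].
  have vz0 : v z != 0
    by apply/eqP => vz; move/eqP: hr; rewrite vz mul0r eq_sym oner_eq0.
  have -> : 'i%C * y + z ^+ 2 = 'i%C * Y z.
    by rewrite /Y mulrBr mulrA -expr2 sqr_ic; ring.
  suff -> : - n%:R * f z = pencil_num (Y z) (v z) / pencil_den (Y z) (v z).
    exact: kms_root.
  have W0 : v z ^+ n.-1 != 0 by rewrite expf_neq0.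
  have YE : Y z = (v z * v z ^+ n + 1) / (v z ^+ n - v z).
    have : Y z * (v z ^+ n - v z) = v z * v z ^+ n + 1.
      by apply/eqP; rewrite eq_sym -subr_eq0; apply/eqP; rewrite -exprS.
    by move=> <-; field.
  have dd : n%:R * (v z ^+ n.+1 + v z ^+ n.-1) != 0.
    rewrite mulf_neq0// (exprS _ n) (Vn (v z)).
    rewrite (_ : _ + _ = v z ^+ n.-1 * (1 + v z ^+ 2)); last by ring.
    by rewrite mulf_neq0.
  apply: (mulIf dd); rewrite -mulrA hfz; apply: (mulIf ndz).
  rewrite [RHS](_ : _ = pencil_num (Y z) (v z) * (n%:R * (v z ^+ n.+1 + v z ^+ n.-1))).
    rewrite /pencil_num /pencil_den -mul2n mulnC exprM (exprS _ n).
    transitivity (n%:R * (- (v z ^+ n ^+ 2 + 1)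
       * ((1 - Y z ^+ 2) * v z + Y z * (v z ^+ 2 - 1)))); first by ring.
    rewrite YE (_ : v z ^+ n.-1 = v z ^+ n / v z); last by rewrite Vn; field.
    by field; rewrite nVz vz0.
  by rewrite mulrAC divfK// mulrC.
have cvn0 : cv 0%N != 0 by rewrite cv0.
have [d1 [d2 [d3 J1]]] := exp_jet_exists cvn0.
rewrite cv0 in J1.
have dE : d1 = d.
  by case: J1 => _ e _ _; move: e; rewrite cv1 mul1r => /(mulfI u0).
have pows k : exists p, power_series p (fun z => v z ^+ k) /\
    exp_jet (u ^+ k) k%:R d1 d2 d3 p.
  by exists (cpow cv k); split; [exact: power_seriesX|exact: exp_jet_pow].
have [p [hp [p0 p1 p2 p3]]] := pows n.+1.
have [q [hq [q0 q1 q2 q3]]] := pows n.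
have [s [hs [s0 s1 s2 s3]]] := pows n.-1.
have [w [hw [w0 w1 w2 w3]]] := pows n.*2.
have nS : n.+1%:R = n%:R + 1 :> C by rewrite natr1.
have nP : n.-1%:R = n%:R - 1 :> C by rewrite -[in RHS](prednK (ltnW n2)) -natr1 addrK.
have nD : n.*2%:R = 2 * n%:R :> C by rewrite -mul2n natrM.
have uS : u ^+ n.+1 = u * u ^+ n by rewrite exprS.
have uP : u ^+ n.-1 = u ^+ n / u by rewrite Vn; field.
have uD : u ^+ n.*2 = (u ^+ n) ^+ 2 by rewrite -mul2n mulnC exprM.
rewrite nS uS in p0 p1 p2 p3; rewrite nP uP in s0 s1 s2 s3; rewrite nD uD in w0 w1 w2 w3.
have hY := power_seriesD (power_series_cst y) (power_seriesM (power_series_cst (- 'i%C))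
  (power_seriesM power_series_id power_series_id)).
have hN (c : nat -> C) g (h : power_series c g) := power_seriesM (power_series_cst (-1)) h.
have hphi' := power_seriesD (power_seriesD hp (power_series_cst 1))
  (hN _ _ (power_seriesM hY (power_seriesD hq (hN _ _ hv)))).
have hz0 := power_series_uniq (power_series_near _ hphi') power_series0.
have {hz0} E3 : p 3%N - (y * (q 3%N - cv 3%N) - 'i%C * (q 1%N - cv 1%N)) = 0.
  rewrite -[RHS](hz0 _ 3%N) /=.
    by rewrite !(cauchy0, cauchy1, cauchy2, cauchy3) /=; ring.
  apply: near0W hphi => z; rewrite /phi => hz; rewrite -[RHS]hz; ring.
have hf' := power_seriesM hf (power_seriesM (power_series_cst n%:R) (power_seriesD hp hs)).
have hF := power_series_uniq (power_series_near hfv hf') (power_seriesD hw (power_series_cst 1)).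
have F0 := hF 0%N; have F1 := hF 1%N; have F2 := hF 2%N.
rewrite /= !(cauchy0, cauchy1, cauchy2) /= in F0 F1 F2.
case: J1 => _ cv1' cv2 cv3.
apply: (@jet_algebra _ n%:R u (u ^+ n) y 'i%C d d2 d3) => //.
- exact: (critical_V1 n2 cr).
- exact: (critical_n cr).
- exact: (critical_y cr).
- by rewrite -[RHS]E3 p3 q3 q1 cv3 cv1' dE; ring.
- by rewrite -w0 -[RHS]F0 p0 s0; ring.
- by rewrite -dE -w1 -[RHS]addr0 -F1 p0 p1 s0 s1; ring.
- by rewrite -dE -w2 -[RHS]addr0 -F2 p0 p1 p2 s0 s1 s2; ring.
Qed.

End KMSSeries.

(** * Chebyshev polynomials and the critical point *)

Section Chebyshev.
Context {R : realType}.
Implicit Types x v : R.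
Local Notation T k x := ((chebT R k).[x]).
Local Notation U k x := ((chebU R k).[x]).

Lemma chebT0 x : T 0 x = 1. Proof. exact: hornerC. Qed.
Lemma chebT1 x : T 1 x = x. Proof. exact: hornerX. Qed.
Lemma chebU0 x : U 0 x = 1. Proof. exact: hornerC. Qed.
Lemma chebU1 x : U 1 x = 2 * x. Proof. by rewrite hornerZ hornerX. Qed.

Lemma chebT_rec k x : T k.+2 x = 2 * x * T k.+1 x - T k x.
Proof.
rewrite -[chebT R k.+2]/(2 *: ('X * chebT R k.+1) - chebT R k).
by rewrite hornerD hornerN hornerZ hornerM hornerX mulrA.
Qed.

Lemma chebU_rec k x : U k.+2 x = 2 * x * U k.+1 x - U k x.
Proof.
rewrite -[chebU R k.+2]/(2 *: ('X * chebU R k.+1) - chebU R k).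
by rewrite hornerD hornerN hornerZ hornerM hornerX mulrA.
Qed.

Lemma nat_ind2 (P : nat -> Prop) : P 0%N -> P 1%N ->
  (forall k, P k -> P k.+1 -> P k.+2) -> forall k, P k.
Proof.
move=> P0 P1 PS k; suff [] : P k /\ P k.+1 by [].
by elim: k => [|k [h1 h2]]; split => //; exact: PS.
Qed.

Lemma chebT_exp k v : v != 0 -> T k ((v + v^-1) / 2) = (v ^+ k + v ^- k) / 2.
Proof.
move=> v0; elim/nat_ind2: k => [||k h0 h1].
- by rewrite hornerC expr0 invr1; field.
- by rewrite hornerX expr1.
- rewrite chebT_rec h0 h1 !exprS; have := expf_neq0 k v0; set w := v ^+ k => w0.
  by field; rewrite v0 w0.
Qed.

Lemma chebU_exp k v : v != 0 ->
  (v - v^-1) * U k ((v + v^-1) / 2) = v ^+ k.+1 - v ^- k.+1.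
Proof.
move=> v0; elim/nat_ind2: k => [||k h0 h1].
- by rewrite hornerC expr1 mulr1.
- by rewrite chebU1; field.
- rewrite chebU_rec; transitivity ((v + v^-1) * ((v - v^-1) * U k.+1 ((v + v^-1) / 2))
    - (v - v^-1) * U k ((v + v^-1) / 2)); first by field.
  rewrite h0 h1 !exprS; have := expf_neq0 k v0; set w := v ^+ k => w0.
  by field; rewrite v0 w0.
Qed.

Lemma chebU_step k x : U k.+1 x = x * U k x + T k.+1 x.
Proof.
elim/nat_ind2: k => [||k h0 h1].
- by rewrite chebU1 chebU0 chebT1; ring.
- by rewrite chebU_rec chebT_rec chebU1 chebU0 chebT1 ?chebT0; ring.
- have t1 : T k.+1 x = U k.+1 x - x * U k x by rewrite h0; ring.
  have t2 : T k.+2 x = U k.+2 x - x * U k.+1 x by rewrite h1; ring.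
  by rewrite (chebU_rec k.+1) (chebT_rec k.+1) t1 t2 (chebU_rec k); ring.
Qed.

Lemma chebT_step k x : T k.+2 x = x * T k.+1 x + (x ^+ 2 - 1) * U k x.
Proof.
elim/nat_ind2: k => [||k h0 h1].
- by rewrite chebT_rec chebT1 chebT0 ?chebU0; ring.
- by rewrite !chebT_rec chebT1 chebT0 chebU1; ring.
- have u0 : (x ^+ 2 - 1) * U k x = T k.+2 x - x * T k.+1 x by rewrite h0; ring.
  have u1 : (x ^+ 2 - 1) * U k.+1 x = T k.+3 x - x * T k.+2 x by rewrite h1; ring.
  rewrite (chebT_rec k.+2) (chebU_rec k).
  transitivity (x * T k.+3 x + 2 * x * ((x ^+ 2 - 1) * U k.+1 x) - (x ^+ 2 - 1) * U k x).
    by rewrite u0 u1 (chebT_rec k.+1); ring.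
  by ring.
Qed.

Lemma cheb_ge k x : 1 <= x -> x ^+ k.+1 <= T k.+1 x /\ k.+1%:R <= U k x.
Proof.
move=> x1; elim: k => [|k [hT hU]]; first by rewrite hornerX expr1 hornerC.
have x0 : 0 <= x by lra.
have xk : 1 <= x ^+ k.+1 by rewrite exprn_ege1.
have U0 : 0 <= U k x by apply: le_trans hU.
split.
  rewrite chebT_step exprS; apply: ler_wpDr; last exact: ler_wpM2l.
  by rewrite mulr_ge0// subr_ge0 exprn_ege1.
rewrite chebU_step -natr1; apply: lerD; last exact: le_trans xk hT.
by apply: le_trans hU _; rewrite ler_peMl.
Qed.

Lemma chebU_gt k x : 1 < x -> k.+2%:R < U k.+1 x.
Proof.
move=> x1; have [hT hU] := cheb_ge k (ltW x1).
rewrite chebU_step -natr1; apply: ler_ltD.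
  by apply: le_trans (hU) _; rewrite ler_peMl ?(ltW x1)//; exact: le_trans hU.
by apply: lt_le_trans hT; rewrite exprn_egt1.
Qed.

Lemma cheb_gt0 k x : 1 <= x -> 0 < T k x /\ 0 < U k x.
Proof.
move=> x1; have [_ hU] := cheb_ge k x1; split; last exact: lt_le_trans hU.
case: k {hU} => [|k]; first by rewrite hornerC.
have [hT _] := cheb_ge k x1; apply: lt_le_trans hT.
by rewrite exprn_gt0//; lra.
Qed.

Lemma cheb_mono k x x' : 1 <= x -> x <= x' ->
  T k.+1 x <= T k.+1 x' /\ U k x <= U k x'.
Proof.
move=> x1 xx; elim: k => [|k [hT hU]]; first by rewrite !hornerX !hornerC.
have [T0 _] := cheb_gt0 k.+1 x1; have [_ U0] := cheb_gt0 k x1.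
have h2 : x ^+ 2 <= x' ^+ 2 by rewrite lerXn2r// nnegrE; lra.
split.
  rewrite !chebT_step; apply: lerD; first by apply: ler_pM => //; [lra|exact: ltW].
  apply: ler_pM => //; [by rewrite subr_ge0 exprn_ege1|exact: ltW|by rewrite lerD2r].
by rewrite !chebU_step; apply: lerD => //; apply: ler_pM => //; [lra|exact: ltW].
Qed.

(** For odd index [T x / x] is strictly increasing: each step adds [2 (x^2 - 1) / x] times [U], a
    product of a strictly increasing and a positive nondecreasing factor. *)
Lemma chebT_ratio_mono j x x' : 1 <= x -> x < x' ->
  x' * T j.*2.+3 x < x * T j.*2.+3 x'.
Proof.
move=> x1 xx.
have step k : x' * T k x <= x * T k x' -> x' * T k.+2 x < x * T k.+2 x'.
  move=> h; have TE w : T k.+2 w = T k w + 2 * ((w ^+ 2 - 1) * U k w).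
    transitivity (2 * T k.+2 w - (2 * w * T k.+1 w - T k w)).
      by rewrite -chebT_rec; ring.
    by rewrite chebT_step; ring.
  rewrite !TE !mulrDr; apply: ler_ltD => //.
  rewrite !(mulrCA _ 2) ltr_pM2l// !mulrA.
  have [_ U0] := cheb_gt0 k x1; have [_ hU] := cheb_mono k x1 (ltW xx).
  apply: (@lt_le_trans _ _ (x * (x' ^+ 2 - 1) * U k x)).
    rewrite ltr_pM2r// -subr_gt0.
    rewrite (_ : _ - _ = (x' - x) * (x * x' + 1)); last by ring.
    by rewrite mulr_gt0 ?subr_gt0//; nra.
  by rewrite ler_wpM2l// mulr_ge0 ?subr_ge0 ?exprn_ege1//; lra.
elim: j => [|j IH]; first by apply: step; rewrite !hornerX mulrC.
by rewrite doubleS; apply: step; exact: ltW.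
Qed.

Lemma odd_ge3 n : odd n -> (3 <= n)%N -> exists j, n = j.*2.+3.
Proof. by move=> on n3; exists ((n - 3)./2); lia. Qed.

Lemma chebT_root_unique n : odd n -> (3 <= n)%N ->
  exists! x : R, 1 < x /\ T n x = n%:R * x.
Proof.
move=> on n3; have [j En] := odd_ge3 on n3.
have n_gt0 : 0 < n%:R :> R by rewrite ltr0n; lia.
have n1 : 1 < n%:R :> R by rewrite ltr1n; lia.
pose p : {poly R} := chebT R n - n%:R *: 'X.
have pE w : p.[w] = T n w - n%:R * w by rewrite /p !hornerE.
have p1 : p.[1] < 0.
  have := chebT_exp n (oner_neq0 R); rewrite invr1 expr1n invr1 pE.
  rewrite (_ : (1 + 1) / 2 = 1 :> R); last by field.
  by move=> ->; lra.
(* The right end of the interval is [n] itself: there [T] is at least [n^n], which dominates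
   [n * n]. *)
have pn : 0 <= p.[n%:R].
  rewrite pE subr_ge0; have [h _] := cheb_ge n.-1 (ltW n1).
  rewrite prednK in h; last by lia.
  by apply: le_trans h; rewrite -expr2 ler_eXn2l//; lia.
have [x /andP[x1 _] /eqP rx] := poly_ivt (ltW n1) (introT andP (conj (ltW p1) pn)).
exists x; split.
  split; last by apply/eqP; rewrite -subr_eq0 -pE rx.
  by rewrite lt_neqAle x1 andbT; apply/eqP => e; rewrite e rx ltxx in p1.
have uniq w w' : 1 < w -> T n w = n%:R * w -> T n w' = n%:R * w' -> w < w' -> False.
  move=> w1 h h' ww; have := chebT_ratio_mono j (ltW w1) ww.
  by rewrite -En h h' mulrCA [w' * w]mulrC mulrCA ltxx.
move=> w [w1 hw]; have [ww|ww|//] := ltgtP x w.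
  by case: (uniq _ _ _ _ hw ww) => //; [rewrite lt_neqAle x1 andbT; apply/eqP => e; rewrite e rx ltxx in p1|apply/eqP; rewrite -subr_eq0 -pE rx].
by case: (uniq _ _ w1 hw _ ww); apply/eqP; rewrite -subr_eq0 -pE rx.
Qed.

End Chebyshev.

(** * The critical point and the closed formulas for the parameters *)

Section CurvatureFormula.

(** The critical point is found among real numbers, where signs are available, while the spectral
    argument runs over the complex ones; the real embedding carries it across. *)
Lemma critical_map (K L : fieldType) (f : {rmorphism K -> L}) n (u y : K) :
  critical n u y -> critical n (f u) (f y).
Proof.
move=> [[u0 u1 Vu uV] h1 h2]; split.
- by rewrite -!rmorphXn -(rmorph1 f) -?rmorphM -?rmorphB -!rmorphD !fmorph_eq0.
- by have := congr1 f h1; rewrite !(rmorphM, rmorphD, rmorphXn, rmorph1, rmorph_nat).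
- by have := congr1 f h2; rewrite !(rmorphM, rmorphB, rmorphD, rmorphXn, rmorph1).
Qed.

Lemma slope_map (K L : numFieldType) (f : {rmorphism K -> L}) (u V : K) :
  f (slope u V) = slope (f u) (f V).
Proof.
by rewrite /slope /sinh_gap !(rmorphM, rmorphB, rmorphD, fmorphV, rmorph1, rmorph_nat).
Qed.

Lemma curvature_map (K L : numFieldType) (f : {rmorphism K -> L}) (n u V : K) :
  f (curvature n u V) = curvature (f n) (f u) (f V).
Proof.
by rewrite /curvature /sinh_gap
  !(rmorphM, rmorphB, rmorphD, rmorphXn, fmorphV, rmorph1, rmorph_nat).
Qed.

Lemma curvature_formula (K : numFieldType) (n u V x s U T : K) :
  u != 0 -> V != 0 -> u ^+ 2 + 1 != 0 -> u ^+ 2 - 1 != 0 -> V ^+ 2 + 1 != 0 ->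
  n = u * (V ^+ 2 + 1) / (V * (u ^+ 2 + 1)) ->
  x = (u + u^-1) / 2 -> s = (u - u^-1) / 2 ->
  U = (V - V^-1) / (u - u^-1) -> T = (V / u + u / V) / 2 ->
  6 * n * x ^+ 2 * s * (U - 1) * curvature n u V
  = 12 + 4 * (n + 1) * T ^+ 2
    - (5 * n ^+ 2 + 5 * n + 12) * x ^+ 2
    - 3 * (n - 7) * (x ^+ 2 - 1) * U
    + 4 * (n - 2) * (n ^+ 2 * x ^+ 2 - 1)
    + (n + 1) * (4 * x ^+ 2 - 3) * T.
Proof.
move=> u0 V0 u1 u1' V1 hn hx hs hU hT.
rewrite /curvature /sinh_gap hT hU hs hx hn.
by field; rewrite ?u0 ?V0 ?u1 ?u1' ?V1.
Qed.

End CurvatureFormula.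

Section CriticalPoint.
Context {R : realType} (n : nat) (x : R).
Context (on : odd n) (n3 : (3 <= n)%N) (x1 : 1 < x) (hx : (chebT R n).[x] = n%:R * x).
Let s : R := Num.sqrt (x ^+ 2 - 1).
(** With [x = cosh alpha] one has [s = sinh alpha] and [u = exp alpha]. *)
Let u : R := x + s.
Let V := u ^+ n.
Let y : R := s^-1 * ((chebT R (n.+1)./2).[x] / (chebU R (n - 3)./2).[x]).
Let U := (chebU R n.-1).[x].
Let T := (chebT R n.-1).[x].

Let s2 : s ^+ 2 = x ^+ 2 - 1.
Proof. by rewrite sqr_sqrtr// subr_ge0 exprn_ege1// ltW. Qed.

Let s0 : 0 < s.
Proof. by rewrite sqrtr_gt0 subr_gt0 exprn_egt1. Qed.

Let u_gt1 : 1 < u. Proof. by have := s0; have := x1; rewrite /u; lra. Qed.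
Let u0 : u != 0. Proof. by rewrite gt_eqF//; have := u_gt1; lra. Qed.
Let uV : u^-1 = x - s.
Proof.
apply: (mulfI u0); rewrite divff//; transitivity (x ^+ 2 - s ^+ 2); last by rewrite /u; ring.
by rewrite s2; ring.
Qed.
Let uu : u - u^-1 != 0.
Proof.
rewrite (_ : u - u^-1 = 2 * s); last by rewrite uV /u; ring.
by rewrite mulf_neq0 ?pnatr_eq0// gt_eqF.
Qed.
Let u21 : u ^+ 2 - 1 != 0.
Proof. by rewrite subr_eq0 gt_eqF// exprn_egt1. Qed.
Let xE : x = (u + u^-1) / 2. Proof. by rewrite uV /u; field. Qed.
Let sE : s = (u - u^-1) / 2. Proof. by rewrite uV /u; field. Qed.

Let n_gt0 : (0 < n)%N. Proof. exact: leq_trans n3. Qed.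
Let V_gt : u < V.
Proof. by rewrite /V -[ltLHS]expr1 ltr_eXn2l //; have := n3; lia. Qed.
Let V0 : V != 0. Proof. by rewrite expf_neq0. Qed.

Lemma critical_point : critical n u y.
Proof.
have hu := u_gt1; have hV := V_gt.
split.
- by split => //; rewrite gt_eqF//; rewrite -/V; nra.
- rewrite -/V; move: hx; rewrite {1 2}xE chebT_exp// -/V => h.
  transitivity (2 * u * V * ((V + V^-1) / 2)); first by field.
  by rewrite h; field.
(* With [n = 2 m + 1] and [W = u^m], [y] is [cosh ((m+1) alpha) / sinh (m alpha)]; the relation
   [u^n = u W^2] turns it into [(u V + 1) / (V - u)]. *)
have [m Em] : exists m, n = m.*2.+1 by exists n./2; rewrite -[LHS]odd_double_half on.
have m0 : (0 < m)%N by move: n3; rewrite Em; lia.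
have e1 : (n.+1)./2 = m.+1 by rewrite Em; lia.
have e2 : (n - 3)./2 = m.-1 by rewrite Em; lia.
have hU := chebU_exp m.-1 u0; rewrite -xE prednK// in hU.
have W1 : 1 < u ^+ m by rewrite exprn_egt1// -lt0n.
have W0 : u ^+ m != 0 by rewrite expf_neq0.
have sU : s * (chebU R m.-1).[x] = (u ^+ m - u ^- m) / 2.
  by rewrite sE -hU; field.
have hT := chebT_exp m.+1 u0; rewrite -xE in hT.
have -> : y = ((u ^+ m.+1 + u ^- m.+1) / 2) / ((u ^+ m - u ^- m) / 2).
  by rewrite /y e1 e2 hT -sU invfM; ring.
have VE : u ^+ n = u * (u ^+ m) ^+ 2 by rewrite Em exprS -mul2n mulnC exprM.
rewrite VE !exprS; move: W0 W1; set W := u ^+ m => W0 W1.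
have W2 : W ^+ 2 - 1 != 0 by rewrite subr_eq0 gt_eqF// exprn_egt1.
by field; rewrite u0 W0 W2.
Qed.

Lemma critical_point_gt0 : 0 < y.
Proof.
have [hT _] := cheb_gt0 (n.+1)./2 (ltW x1); have [_ hU] := cheb_gt0 (n - 3)./2 (ltW x1).
by rewrite /y mulr_gt0 ?invr_gt0// divr_gt0.
Qed.

Lemma chebU_pred : U = (V - V^-1) / (u - u^-1).
Proof.
have h := chebU_exp n.-1 u0; rewrite -xE prednK// in h.
by rewrite -h mulrAC divff// mul1r.
Qed.

Lemma chebT_pred : T = (V / u + u / V) / 2.
Proof.
rewrite /T {1}xE chebT_exp// (_ : u ^+ n.-1 = V / u) ?invfM ?invrK ?[u / V]mulrC//.
by rewrite /V -{2}(prednK n_gt0) exprS; field.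
Qed.

Lemma sinh_gapE : sinh_gap u V = s * (U - 1).
Proof.
rewrite chebU_pred sE /sinh_gap.
by field; rewrite u0 V0 u21.
Qed.

Lemma chebU_pred_gt : n%:R < U.
Proof.
have := chebU_gt n.-2 x1; have -> : n.-2.+1 = n.-1 by lia.
by rewrite prednK.
Qed.

Lemma chebT_pred_gt1 : 1 < T.
Proof.
have [h _] := cheb_ge n.-2 (ltW x1); have e : n.-2.+1 = n.-1 by lia.
rewrite e in h; apply: lt_le_trans h; rewrite exprn_egt1//; lia.
Qed.

Lemma amplitude_sqr (a := Num.sqrt (2 / n%:R) * (Num.sqrt s / x)
    * Num.sqrt ((U - 1) * (T - 1))) :
  [/\ 0 < a, a ^+ 2 = slope u V ^+ 2 * (2 * (V - u) / (n%:R * (u * V + 1))),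
      a ^+ 2 < 2 * curvature n%:R u V & 0 < slope u V].
Proof.
have nR : 0 < n%:R :> R by rewrite ltr0n.
have U1 : 0 < U - 1.
  have := chebU_pred_gt; have : 1 <= n%:R :> R by rewrite ler1n.
  lra.
have T1 : 0 < T - 1 by rewrite subr_gt0 chebT_pred_gt1.
have x0 : 0 < x by exact: lt_trans x1.
have g0 : 0 < sinh_gap u V by rewrite sinh_gapE mulr_gt0.
have a2 : a ^+ 2 = 2 * sinh_gap u V * (T - 1) / (n%:R * x ^+ 2).
  rewrite /a !exprMn exprVn !sqr_sqrtr.
  - by rewrite sinh_gapE; field; rewrite !gt_eqF.
  - by rewrite mulr_ge0// ltW.
  - exact: ltW.
  - by rewrite divr_ge0// ltW.
have hu := u_gt1; have hV := V_gt.
have u2 : u ^+ 2 + 1 != 0 by rewrite gt_eqF//; nra.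
have uV1 : u * V + 1 != 0 by rewrite gt_eqF//; nra.
split.
- rewrite mulr_gt0 ?sqrtr_gt0 ?(mulr_gt0 U1 T1)// mulr_gt0 ?sqrtr_gt0 ?divr_gt0//.
  by rewrite sqrtr_gt0.
- rewrite a2 chebT_pred /slope /sinh_gap xE.
  by field; rewrite u0 V0 u2 uV1 gt_eqF.
(* The excess of [2 b_n] over [a_n^2] is a positive multiple of [U - n], and [U_(n-1)(x) > n] for
   [x > 1]. *)
- have -> : 2 * curvature n%:R u V = a ^+ 2 + 2 * ((n%:R - 1) / (3 * n%:R) * (s * (U - n%:R))).
    rewrite a2 /curvature -xE -sE -chebT_pred -[(V - V^-1) / 2](_ : s * U = _).
      by field; rewrite !gt_eqF.
    by rewrite chebU_pred sE; field; rewrite u0 V0 u21.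
  rewrite ltrDl !mulr_gt0 ?invr_gt0 ?mulr_gt0 ?subr_gt0 ?chebU_pred_gt//.
  by rewrite ltr1n; exact: leq_trans n3.
- by rewrite /slope -xE; apply: divr_gt0 => //; apply: divr_gt0 => //; exact: mulr_gt0.
Qed.

Lemma critical_curvature :
  6 * n%:R * x ^+ 2 * s * (U - 1) * curvature n%:R u V
  = 12 + 4 * (n%:R + 1) * T ^+ 2
    - (5 * n%:R ^+ 2 + 5 * n%:R + 12) * x ^+ 2
    - 3 * (n%:R - 7) * (x ^+ 2 - 1) * U
    + 4 * (n%:R - 2) * (n%:R ^+ 2 * x ^+ 2 - 1)
    + (n%:R + 1) * (4 * x ^+ 2 - 3) * T.
Proof.
have hu := u_gt1; have hV := V_gt.
apply: curvature_formula; rewrite ?gt_eqF//; try nra.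
- exact: (critical_n critical_point).
- exact: chebU_pred.
- exact: chebT_pred.
Qed.

End CriticalPoint.

(** * Moduli and the local level curve *)

Section Modulus.
Context {R : realType}.
Local Notation C := R[i].

Lemma cisD (s t : R) : cis (s + t) = cis s * cis t.
Proof.
by rewrite /cis cosD sinD; simpc; congr (_ +i* _); rewrite addrC.
Qed.

Lemma normc_cis (t : R) : N (cis t) = 1.
Proof. by rewrite /= cos2Dsin2 sqrtr1. Qed.

Lemma normc_polar (r t : R) : 0 <= r -> N (r%:C * cis t) = r.
Proof. by move=> r0; rewrite Normc.normcM normc_real normc_cis mulr1 ger0_norm. Qed.

Lemma sqr_normcE (z : C) : N z ^+ 2 = complex.Re z ^+ 2 + complex.Im z ^+ 2.
Proof. by case: z => p q /=; rewrite sqr_sqrtr// addr_ge0 ?sqr_ge0. Qed.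

Lemma le0_of_linear (x K t0 : R) : 0 < t0 ->
  (forall t, 0 < t -> t < t0 -> x <= K * t) -> x <= 0.
Proof.
move=> t00 h; rewrite leNgt; apply/negP => x0.
pose t := Num.min (t0 / 2) (x / (2 * (`|K| + 1))).
have K1 : 0 < 2 * (`|K| + 1) by rewrite mulr_gt0// ltr_wpDl.
have tp : 0 < t by rewrite lt_min !divr_gt0.
have tt : t < t0 by rewrite gt_min; apply/orP; left; lra.
have : t <= x / (2 * (`|K| + 1)) by rewrite ge_min lexx orbT.
rewrite ler_pdivlMr// => h2; have h1 := h t tp tt.
have h3 : K * t <= `|K| * t by rewrite ler_wpM2r ?ler_norm// ltW.
have : 0 <= `|K| * t by rewrite mulr_ge0// ltW.
nra.
Qed.

(** The squares of [|1 + A + B|] and of the proposed value [T] differ by at most [K t^3], each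
    summand of [K] bounding one error term. For small [t] one has [T >= 1 / 2], so passing from
    squares to moduli only costs a factor 2. *)
Lemma modulus_approx (p q M : R) : 0 <= p -> 0 <= q -> exists t0 M' : R,
  [/\ 0 < t0, M <= M' & forall (w A B : C) t, 0 <= t -> t < t0 ->
    N (w - (1 + A + B)) <= M * t ^+ 3 -> N A <= p * t -> N B <= q * t ^+ 2 ->
    `|N w - (1 + complex.Re A + complex.Re B + complex.Im A ^+ 2 / 2)| <= M' * t ^+ 3].
Proof.
move=> p0 q0; pose K := 2 * p * q + q ^+ 2 + p ^+ 2 * (p + q) + p ^+ 4.
have K0 : 0 <= K by rewrite /K !addr_ge0 ?mulr_ge0 ?exprn_ge0 ?addr_ge0.
exists (Num.min 1 (4 * (p + q + 1))^-1), (M + 2 * K); split.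
- by rewrite lt_min ltr01 invr_gt0 mulr_gt0//; lra.
- by lra.
move=> w A B t t0; rewrite lt_min => /andP[t1 tpq] hw hA hB.
have {}tpq : (p + q) * t <= 4^-1.
  have : t * (4 * (p + q + 1)) <= 1.
    by rewrite -ler_pdivlMr ?mul1r ?ltW// mulr_gt0//; lra.
  nra.
have hA1 := le_trans (normc_ge_absRe A) hA; have hA2 := le_trans (normc_ge_absIm A) hA.
have hB1 := le_trans (normc_ge_absRe B) hB; have hB2 := le_trans (normc_ge_absIm B) hB.
set a1 := complex.Re A in hA1 *; set a2 := complex.Im A in hA2 *.
set b1 := complex.Re B in hB1 *; set b2 := complex.Im B in hB2.
pose T := 1 + a1 + b1 + a2 ^+ 2 / 2; rewrite -/T.
have t2 : t ^+ 2 <= t by rewrite expr2 ler_piMl// ltW.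
have T0 : 2^-1 <= T.
  have := ler_norm (- a1); have := ler_norm (- b1); rewrite !normrN.
  have : 0 <= a2 ^+ 2 by rewrite sqr_ge0.
  have : q * t ^+ 2 <= q * t by rewrite ler_wpM2l.
  by rewrite /T; lra.
pose W := 1 + A + B.
have W2 : N W ^+ 2 = (1 + a1 + b1) ^+ 2 + (a2 + b2) ^+ 2.
  rewrite sqr_normcE /W /a1 /a2 /b1 /b2; case: (A) => ? ?; case: (B) => ? ? /=.
  by rewrite add0r.
have dW : N W ^+ 2 - T ^+ 2 = 2 * (a2 * b2) + b2 ^+ 2 - a2 ^+ 2 * (a1 + b1) - a2 ^+ 4 / 4.
  by rewrite W2 /T; field.
have t3 : 0 <= t ^+ 3 by rewrite exprn_ge0.
have t4 : t ^+ 4 <= t ^+ 3 by rewrite exprS ler_piMl// ltW.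
have e1 : `|2 * (a2 * b2)| <= 2 * p * q * t ^+ 3.
  rewrite normrM ger0_norm// [leRHS](_ : _ = 2 * ((p * t) * (q * t ^+ 2))); last by ring.
  by rewrite ler_pM2l// normrM ler_pM.
have e2 : `|b2 ^+ 2| <= q ^+ 2 * t ^+ 3.
  apply: (@le_trans _ _ (q ^+ 2 * t ^+ 4)); last by rewrite ler_wpM2l ?exprn_ge0.
  rewrite normrX [leRHS](_ : _ = (q * t ^+ 2) ^+ 2); last by ring.
  by rewrite lerXn2r// nnegrE// mulr_ge0// exprn_ge0.
have e3 : `|a2 ^+ 2 * (a1 + b1)| <= p ^+ 2 * (p + q) * t ^+ 3.
  rewrite normrM normrX [leRHS](_ : _ = (p * t) ^+ 2 * ((p + q) * t)); last by ring.
  apply: ler_pM; rewrite ?exprn_ge0//.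
    by rewrite lerXn2r// nnegrE// mulr_ge0.
  apply: le_trans (ler_normD _ _) _; rewrite mulrDl lerD//.
  by apply: le_trans hB1 _; rewrite ler_wpM2l.
have e4 : `|a2 ^+ 4 / 4| <= p ^+ 4 * t ^+ 3.
  rewrite normrM normrX (ger0_norm (_ : 0 <= 4^-1)) ?invr_ge0//.
  have : `|a2| ^+ 4 <= p ^+ 4 * t ^+ 3.
    apply: (@le_trans _ _ (p ^+ 4 * t ^+ 4)); last by rewrite ler_wpM2l ?exprn_ge0.
    by rewrite -exprMn lerXn2r// nnegrE// mulr_ge0.
  have : 0 <= `|a2| ^+ 4 by rewrite exprn_ge0.
  lra.
have dK : `|N W ^+ 2 - T ^+ 2| <= K * t ^+ 3.
  rewrite dW; apply: le_trans (ler_normB _ _) _.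
  have := ler_normB (2 * (a2 * b2) + b2 ^+ 2) (a2 ^+ 2 * (a1 + b1)).
  have := ler_normD (2 * (a2 * b2)) (b2 ^+ 2).
  by rewrite /K; lra.
have WT : `|N W - T| <= 2 * K * t ^+ 3.
  have s0 : 2^-1 <= N W + T by have := normc_ge0 W; lra.
  have : `|N W - T| * (N W + T) <= K * t ^+ 3.
    rewrite -(ger0_norm (_ : 0 <= N W + T)); last by lra.
    by rewrite -normrM -subr_sqr.
  have := normr_ge0 (N W - T); nra.
have wW : `|N w - N W| <= M * t ^+ 3.
  rewrite ler_norml; have := normc_triangleB w W; have := normc_triangleB W w.
  by rewrite [N (W - w)]normcB_sym; lra.
have -> : N w - T = (N w - N W) + (N W - T) by ring.
by apply: le_trans (ler_normD _ _) _; lra.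
Qed.

Lemma powR_3half (r : R) : 0 <= r -> r `^ (3 / 2) = Num.sqrt r ^+ 3.
Proof. by move=> r0; rewrite mulrC powRrM powR12_sqrt// powR_mulrn ?sqrtr_ge0. Qed.

(** In terms of [t = sqrt r], adding the two moduli isolates [m2] and subtracting them isolates
    [m1]. The eigenvalues may come in either order at each [t], so only the square of [m1] is
    determined. *)
Lemma modulus_expansion_unique n (rhoc lc : C) m1 m2 m1' m2' : lc != 0 ->
  modulus_expansion n rhoc lc m1 m2 -> modulus_expansion n rhoc lc m1' m2' ->
  forall th : R, m2 th = m2' th /\ m1 th ^+ 2 = m1' th ^+ 2.
Proof.
move=> lc0 [eta [del [M [eta0 del0 h]]]] [eta' [del' [M' [eta0' del0' h']]]] th.
pose t0 := Num.min 1 (Num.min del del').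
have t00 : 0 < t0 by rewrite !lt_min ltr01 del0 del0'.
pose K : R := `|M| + `|M'|.
have key t : 0 < t -> t < t0 -> exists x1 x2 : R,
    [/\ `|x1 - (1 + t * m1 th + t ^+ 2 * m2 th)| <= `|M| * t ^+ 3,
        `|x2 - (1 - t * m1 th + t ^+ 2 * m2 th)| <= `|M| * t ^+ 3 &
      (`|x1 - (1 + t * m1' th + t ^+ 2 * m2' th)| <= `|M'| * t ^+ 3 /\
        `|x2 - (1 - t * m1' th + t ^+ 2 * m2' th)| <= `|M'| * t ^+ 3) \/
      (`|x2 - (1 + t * m1' th + t ^+ 2 * m2' th)| <= `|M'| * t ^+ 3 /\
        `|x1 - (1 - t * m1' th + t ^+ 2 * m2' th)| <= `|M'| * t ^+ 3)].
  move=> tp; rewrite !lt_min => /andP[t1 /andP[td td']].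
  have t2 : t ^+ 2 <= t by rewrite expr2 ler_piMl// ltW.
  have sq : Num.sqrt (t ^+ 2) = t by rewrite sqrtr_sqr gtr0_norm.
  have pw : (t ^+ 2) `^ (3 / 2) = t ^+ 3 by rewrite powR_3half ?exprn_ge0 ?sq ?ltW.
  have t3 : 0 <= t ^+ 3 by rewrite exprn_ge0// ltW.
  have [|l1 [l2 [pr e1 e2]]] := h (t ^+ 2) th.
    by rewrite exprn_gt0// (le_lt_trans t2).
  have [|k1 [k2 [pr' e1' e2']]] := h' (t ^+ 2) th.
    by rewrite exprn_gt0// (le_lt_trans t2).
  rewrite sq pw in e1 e2 e1' e2'.
  have W x (m k : R) : x <= m * t ^+ 3 -> x <= `|m| * t ^+ 3.
    by move=> hx; apply: le_trans hx _; rewrite ler_wpM2r// ler_norm.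
  exists (N (l1 / lc)), (N (l2 / lc)); split; [exact: W e1|exact: W e2|].
  by case: (pair_near_unique pr pr') => -[-> ->]; [left|right]; split; exact: W.
have m2E : `|m2 th - m2' th| <= 0.
  apply: (@le0_of_linear _ K t0 t00) => t tp tt.
  have [x1 [x2 [e1 e2 e3]]] := key t tp tt.
  rewrite -(ler_pM2r (exprn_gt0 2 tp)) -{1}(gtr0_norm (exprn_gt0 2 tp)) -normrM.
  rewrite -mulrA -exprS; move: e1 e2 e3; rewrite /K !ler_norml.
  by move=> /andP[? ?] /andP[? ?] [] [] /andP[? ?] /andP[? ?]; lra.
have m1E : `|m1 th ^+ 2 - m1' th ^+ 2| <= 0.
  apply: (@le0_of_linear _ (K * (`|m1 th| + `|m1' th|)) t0 t00) => t tp tt.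
  have [x1 [x2 [e1 e2 e3]]] := key t tp tt.
  have t1 : t < 1 by move: tt; rewrite lt_min => /andP[].
  have K0 : 0 <= K by rewrite addr_ge0.
  have s0 : 0 <= `|m1 th| + `|m1' th| by rewrite addr_ge0.
  have t2 : t ^+ 2 <= t by rewrite expr2 ler_piMl// ltW.
  have fin (e : R) : `|e| <= `|m1 th| + `|m1' th| -> forall g : R, `|g| <= K * t ^+ 2 ->
      `|g * e| <= K * (`|m1 th| + `|m1' th|) * t.
    move=> he g hg; rewrite normrM; apply: (@le_trans _ _ (K * t ^+ 2 * (`|m1 th| + `|m1' th|))).
      exact: ler_pM.
    rewrite [leRHS](_ : _ = K * t * (`|m1 th| + `|m1' th|)); last by ring.
    by rewrite ler_wpM2r// ler_wpM2l.
  have div (g : R) : `|t * g| <= K * t ^+ 3 -> `|g| <= K * t ^+ 2.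
    by rewrite normrM (gtr0_norm tp) exprS mulrCA ler_pM2l.
  case: e3 => -[e3 e4].
    rewrite subr_sqr; apply: fin; first exact: ler_normD.
    apply: div; move: e1 e2 e3 e4; rewrite /K !ler_norml.
    by move=> /andP[? ?] /andP[? ?] /andP[? ?] /andP[? ?]; lra.
  rewrite subr_sqr mulrC; apply: fin; first exact: ler_normB.
  apply: div; move: e1 e2 e3 e4; rewrite /K !ler_norml.
  by move=> /andP[? ?] /andP[? ?] /andP[? ?] /andP[? ?]; lra.
move: m2E m1E; rewrite !normr_le0 !subr_eq0 => /eqP ? /eqP ?.
by split.
Qed.

End Modulus.

(** * The equation of the local level curve *)

Section LevelCurve.
Context {R : realType}.
Local Notation C := R[i].
Context (n : nat) (rhoc lc : C) (c : nat -> C) (f : C -> C) (an bn eta : R).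
Context (lc0 : lc != 0) (hf : power_series c f) (c0 : c 0%N = 1)
  (c1 : c 1%N ^+ 2 = - 'i%C * (an ^+ 2)%:C) (c2 : c 2%N = - 'i%C * bn%:C)
  (eta0 : 0 < eta)
  (hpair : near0 (fun z =>
    eigenvalue_pair_near n lc eta (rhoc + z ^+ 2) (lc * f z) (lc * f (- z)))).

Lemma puiseux_local : exists del M : R, [/\ 0 < del, 0 <= M & forall z, N z < del ->
  [/\ eigenvalue_pair_near n lc eta (rhoc + z ^+ 2) (lc * f z) (lc * f (- z)),
      N (f z - (1 + c 1%N * z + c 2%N * z ^+ 2)) <= M * N z ^+ 3,
      `|N (f z) - (1 + complex.Re (c 1%N * z) + complex.Re (c 2%N * z ^+ 2)
          + complex.Im (c 1%N * z) ^+ 2 / 2)| <= M * N z ^+ 3 &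
      `|N (f (- z)) - (1 - complex.Re (c 1%N * z) + complex.Re (c 2%N * z ^+ 2)
          + complex.Im (c 1%N * z) ^+ 2 / 2)| <= M * N z ^+ 3]].
Proof.
have [M M0 hj] := power_series_jet 3 hf.
have [t0 [M' [t00 MM hm]]] := modulus_approx M (normc_ge0 (c 1%N)) (normc_ge0 (c 2%N)).
have [d d0 h] := near0_and (near0_and hpair (near0_lt t00)) (near0_and hj (near0_opp hj)).
exists d, M'; split => //; first exact: le_trans MM.
move=> z /h[[hp hz] [h1 h2]].
have jE w : psum c 3 w = 1 + c 1%N * w + c 2%N * w ^+ 2.
  by rewrite /psum !big_ord_recr big_ord0 /= c0 add0r expr0 expr1 mul1r.
rewrite jE in h1; rewrite jE normcN sqrrN mulrN in h2.
have z3 : 0 <= N z ^+ 3 by rewrite exprn_ge0 ?normc_ge0.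
have b1 : N (c 1%N * z) <= N (c 1%N) * N z by rewrite Normc.normcM.
have b2 : N (c 2%N * z ^+ 2) <= N (c 2%N) * N z ^+ 2 by rewrite Normc.normcM normcX.
split => //.
- by apply: le_trans h1 _; rewrite ler_wpM2r.
- exact: hm (normc_ge0 z) hz h1 b1 b2.
- have b1' : N (- (c 1%N * z)) <= N (c 1%N) * N z by rewrite normcN.
  have := hm _ _ _ _ (normc_ge0 z) hz h2 b1' b2.
  by case: (c 1%N * z) => p q /=; rewrite sqrrN.
Qed.

Lemma modulus_expansion_puiseux : modulus_expansion n rhoc lc
  (fun th => complex.Re (c 1%N * cis (th / 2)))
  (fun th => complex.Re (c 2%N * cis th) + complex.Im (c 1%N * cis (th / 2)) ^+ 2 / 2).
Proof.
have [del [M [del0 M0 h]]] := puiseux_local.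
exists eta, (Num.min 1 (del ^+ 2)), M; split => //.
  by rewrite lt_min ltr01 exprn_gt0.
move=> r th /andP[r0]; rewrite lt_min => /andP[r1 rd].
have s0 : 0 <= Num.sqrt r by rewrite sqrtr_ge0.
have sr : Num.sqrt r ^+ 2 = r by rewrite sqr_sqrtr// ltW.
pose z := (Num.sqrt r)%:C * cis (th / 2).
have Nz : N z = Num.sqrt r by rewrite normc_polar.
have z2 : z ^+ 2 = r%:C * cis th.
  by rewrite exprMn -rmorphXn /= sr expr2 -cisD; congr (_ * cis _); field.
have : N z < del by rewrite Nz -(ltr_pXn2r (n := 2)) ?nnegrE ?(ltW del0)// sr.
move=> /h[hp _ h1 h2]; exists (lc * f z), (lc * f (- z)).
have E (p : R) (w : C) : complex.Re (p%:C * w) = p * complex.Re w.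
  by case: w => ? ? /=; rewrite mul0r subr0.
have E' (p : R) (w : C) : complex.Im (p%:C * w) = p * complex.Im w.
  by case: w => ? ? /=; rewrite mul0r addr0.
have e1 : c 1%N * z = (Num.sqrt r)%:C * (c 1%N * cis (th / 2)) by rewrite mulrCA.
have e2 : c 2%N * z ^+ 2 = r%:C * (c 2%N * cis th) by rewrite z2 mulrCA.
rewrite e1 e2 !E E' exprMn sr Nz -(powR_3half (ltW r0)) in h1 h2.
rewrite -z2 ![lc * _]mulrC !mulfK// ; split; first by rewrite ![_ * lc]mulrC.
- rewrite [X in `|_ - X|](_ : _ = 1 + Num.sqrt r * complex.Re (c 1%N * cis (th / 2))
    + r * complex.Re (c 2%N * cis th) + r * complex.Im (c 1%N * cis (th / 2)) ^+ 2 / 2)//.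
  by ring.
- rewrite [X in `|_ - X|](_ : _ = 1 - Num.sqrt r * complex.Re (c 1%N * cis (th / 2))
    + r * complex.Re (c 2%N * cis th) + r * complex.Im (c 1%N * cis (th / 2)) ^+ 2 / 2)//.
  by ring.
Qed.

(* [w = c_1 cis (th / 2)] has [|w|^2 = an^2] and [w^2 = an^2 (sin th - i cos th)]. *)
Lemma local_level_curveP rho : local_level_curve n rhoc lc rho <->
  exists r th : R, [/\ 0 <= r, rho = rhoc + r%:C * cis th
    & r = 0 \/ 8 * an ^+ 2 * (1 + sin th)
               = r * (an ^+ 2 + (4 * bn - an ^+ 2) * sin th) ^+ 2].
Proof.
pose m1 th := complex.Re (c 1%N * cis (th / 2)).
pose m2 th := complex.Re (c 2%N * cis th) + complex.Im (c 1%N * cis (th / 2)) ^+ 2 / 2.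
have hw th : complex.Re (c 1%N * cis (th / 2)) ^+ 2 = an ^+ 2 * (1 + sin th) / 2 /\
    complex.Im (c 1%N * cis (th / 2)) ^+ 2 = an ^+ 2 * (1 - sin th) / 2.
  pose w := c 1%N * cis (th / 2).
  have w2 : w ^+ 2 = - 'i%C * (an ^+ 2)%:C * cis th.
    by rewrite exprMn c1 (expr2 (cis _)) -cisD; congr (_ * cis _); field.
  have Nw : N w ^+ 2 = an ^+ 2.
    rewrite -normcX w2 !Normc.normcM normc_cis normcN normc_real.
    by rewrite /= expr0n /= add0r expr1n sqrtr1 mul1r mulr1 ger0_norm ?sqr_ge0.
  have := sqr_normcE w; rewrite Nw; move: w2; rewrite -/w.
  case: w {Nw} => p q; rewrite expr2 /cis => /= e1 e2.
  have {}e1 : p * p - q * q = an ^+ 2 * sin th.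
    by have := congr1 (@complex.Re R) e1 => /=; rewrite !(mul0r, mulr0, subr0, sub0r, add0r, addr0, oppr0); move=> ->; ring.
  by split; rewrite expr2 in e2 *; lra.
have m1E th : m1 th ^+ 2 = an ^+ 2 * (1 + sin th) / 2 by have [] := hw th.
have m2E th : m2 th = (an ^+ 2 + (4 * bn - an ^+ 2) * sin th) / 4.
  rewrite /m2; have [_ ->] := hw th; rewrite c2 /cis /=.
  by rewrite !(mul0r, mulr0, subr0, sub0r, add0r, addr0, oppr0); field.
have exp0 := modulus_expansion_puiseux; rewrite -/m1 -/m2 in exp0.
(* The two sign choices multiply to [r (r x2^2 - x1^2)], so the disjunction becomes one equation
   between squares, insensitive to the sign of [m1]. *)
have rel (r x1 x2 : R) : 0 <= r ->
    (Num.sqrt r * x1 + r * x2 = 0 \/ - (Num.sqrt r * x1) + r * x2 = 0) <->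
    (r = 0 \/ x1 ^+ 2 = r * x2 ^+ 2).
  move=> r0; have s2 : Num.sqrt r ^+ 2 = r by exact: sqr_sqrtr.
  have E : (Num.sqrt r * x1 + r * x2) * (- (Num.sqrt r * x1) + r * x2)
     = r * (r * x2 ^+ 2 - x1 ^+ 2).
    transitivity (r ^+ 2 * x2 ^+ 2 - Num.sqrt r ^+ 2 * x1 ^+ 2); first by ring.
    by rewrite s2; ring.
  split=> h.
    have /eqP : r * (r * x2 ^+ 2 - x1 ^+ 2) = 0.
      by rewrite -E; case: h => ->; rewrite ?mul0r ?mulr0.
    by rewrite mulf_eq0 subr_eq0 => /orP[]/eqP ->; [left|right].
  have /eqP : (Num.sqrt r * x1 + r * x2) * (- (Num.sqrt r * x1) + r * x2) = 0.
    by rewrite E; case: h => ->; rewrite ?mul0r// subrr mulr0.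
  by rewrite mulf_eq0 => /orP[]/eqP; [left|right].
have fin r th : (8 * an ^+ 2 * (1 + sin th) = r * (an ^+ 2 + (4 * bn - an ^+ 2) * sin th) ^+ 2)
    <-> m1 th ^+ 2 = r * m2 th ^+ 2.
  rewrite m1E m2E; set x := an ^+ 2 + _; set y := an ^+ 2 * (1 + sin th).
  have -> : 8 * an ^+ 2 * (1 + sin th) = 8 * y by rewrite /y; ring.
  have -> : r * (x / 4) ^+ 2 = r * x ^+ 2 / 16 by field.
  by split; lra.
split.
  move=> [k1 [k2 [r [th [hexp r0 -> h]]]]]; exists r, th; split => //.
  have [e2 e1] := modulus_expansion_unique lc0 hexp exp0 th.
  have [h' _] := rel r (k1 th) (k2 th) r0.
  by case: (h' h) => [|h3]; [left|right; apply/fin; rewrite -e1 -e2].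
move=> [r [th [r0 -> h]]]; exists m1, m2, r, th; split => //.
by apply/rel => //; case: h => [|/fin]; [left|right].
Qed.

End LevelCurve.

(** * Arguments and the cusp bisector *)

Section Cis.
Context {R : realType}.
Local Notation C := R[i].

Lemma cis_pi : cis pi = - 1 :> C.
Proof. by rewrite /cis cospi sinpi; apply/eqP; rewrite eq_complex /= oppr0 !eqxx. Qed.

Lemma cisN_pihalf : cis (- (pi / 2)) = - 'i%C :> C.
Proof.
by rewrite /cis cosN sinN cos_pihalf sin_pihalf; apply/eqP; rewrite eq_complex /= oppr0 !eqxx.
Qed.

Lemma cisK (t : R) : cis t * cis (- t) = 1.
Proof. by rewrite -cisD subrr /cis cos0 sin0. Qed.

Lemma cis_neq0 (t : R) : cis t != 0.
Proof. by rewrite -normc_gt0 normc_cis. Qed.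

Lemma cis_3quarter_sqr : cis (3 * pi / 4) ^+ 2 = - 'i%C :> C.
Proof.
rewrite expr2 -cisD -cisN_pihalf.
rewrite (_ : 3 * pi / 4 + 3 * pi / 4 = pi + (pi + - (pi / 2))); last by field.
by rewrite (cisD pi (pi + _)) (cisD pi (- _)) cis_pi; ring.
Qed.

Lemma ray_cis (rhoc : C) (t t' : R) : cis t = cis t' -> ray rhoc t = ray rhoc t'.
Proof. by move=> e; rewrite /ray e. Qed.

(** The ray depends only on [2 * tha], hence on [a^2]. The last hypothesis supplies some argument of
    [a], without which the bisector could be empty. *)
Lemma cusp_bisector_down (rhoc a : C) (an : R) : 0 < an ->
  a ^+ 2 = - 'i%C * (an ^+ 2)%:C -> (exists t, a = (N a)%:C * cis t) ->
  cusp_bisector rhoc a = ray rhoc (- (pi / 2)).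
Proof.
move=> an0 a2 [t0 Et0].
have Na : N a = an.
  have : N a ^+ 2 = an ^+ 2.
    rewrite -normcX a2 Normc.normcM normcN normc_real.
    by rewrite /= expr0n /= add0r expr1n sqrtr1 mul1r ger0_norm ?sqr_ge0.
  move/eqP; rewrite eqf_sqr => /orP[/eqP//|/eqP e].
  by have := normc_ge0 a; rewrite e; lra.
have key t : a = (N a)%:C * cis t -> cis (pi - 2 * t) = cis (- (pi / 2)) :> C.
  move=> Et; have an0' : (an ^+ 2)%:C != 0 :> C.
    by rewrite -normc_gt0 normc_real normr_gt0 expf_neq0 ?gt_eqF.
  have e2 : cis (2 * t) = - 'i%C :> C.
    apply: (mulfI an0'); rewrite [RHS]mulrC -a2 Et Na exprMn -rmorphXn /=.
    by rewrite (expr2 (cis t)) -cisD; congr (_ * cis _); ring.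
  rewrite cisD cis_pi cisN_pihalf mulN1r; congr (- _).
  have i0 : - 'i%C != 0 :> C by rewrite oppr_eq0 ic_neq0.
  apply: (mulfI i0); rewrite -{1}e2 cisK mulNr -expr2 sqr_ic opprK//.
apply/seteqP; split => [rho [t /key e]|rho hr]; first by rewrite (ray_cis _ e).
by exists t0 => //; rewrite (ray_cis _ (key _ Et0)).
Qed.

End Cis.

(** * The sector near the bisector, the reflection, and the imaginary axis *)

Section Assembly.
Context {R : realType}.
Local Notation C := R[i].

Lemma sin_near_bottom (e : R) : 0 < e ->
  exists2 d : R, 0 < d & forall t, `|t - - (pi / 2)| < d -> sin t < -1 + e.
Proof.
move=> e0; have := @continuous_sin R (- (pi / 2)).
move=> /cvgrPdist_lt/(_ e e0)/nbhs_ballP[d /= d0 hd]; exists d => // t ht.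
have /hd /= : ball (- (pi / 2)) d t by rewrite /ball /= distrC.
by rewrite sinN sin_pihalf ltr_norml => /andP[]; lra.
Qed.

Lemma kms_critical_type n (u y : C) : odd n -> (1 < n)%N -> critical n u y ->
  ((n %% 4 = 1)%N -> type1_eigenvalue (KMS n ('i%C * y)) (- n%:R)) /\
  ((n %% 4 = 3)%N -> type2_eigenvalue (KMS n ('i%C * y)) (- n%:R)).
Proof.
move=> on n2 cr; have mu := kms_critical_mup on n2 cr.
have ev : eigenvalue (KMS n ('i%C * y)) (- n%:R).
  rewrite eigenvalue_root_char; apply/negPn/negP => /mupNroot.
  by rewrite mu.
have flip := fun v hv => @kms_critical_flip _ n u y v on n2 cr hv.
split => hn; split => // v /eigenspaceP hv j; rewrite flip//.
  have -> : (n./2 = (n %/ 4) * 2)%N by lia.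
  by rewrite mulnC exprM sqrrN expr1n expr1n mulN1r.
have -> : (n./2 = ((n %/ 4) * 2).+1)%N by lia.
by rewrite exprS mulnC exprM sqrrN expr1n expr1n mulr1 opprK mul1r.
Qed.

Lemma puiseux_series_intro n (rhoc lc : C) c f eta : c 0%N = 1 -> 0 < eta ->
  power_series c f ->
  near0 (fun z => eigenvalue_pair_near n lc eta (rhoc + z ^+ 2) (lc * f z) (lc * f (- z))) ->
  puiseux_series n rhoc lc c.
Proof.
move=> c0 eta0 hf hp; split => //.
have [d d0 h] := near0_and (power_series_cvg hf) hp.
by exists eta, d, f; split.
Qed.

Lemma level_curve_sector n (lc : C) (yn an bn : R) (rhoc := 0 +i* yn : C) :
  an ^+ 2 < 2 * bn -> 0 < an ->
  (forall rho, local_level_curve n rhoc lc rho <->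
    exists r th : R, [/\ 0 <= r, rho = rhoc + r%:C * cis th
      & r = 0 \/ 8 * an ^+ 2 * (1 + sin th)
                 = r * (an ^+ 2 + (4 * bn - an ^+ 2) * sin th) ^+ 2]) ->
  exists2 del : R, 0 < del &
    (forall th : R, `|th - - (pi / 2)| < del ->
       an ^+ 2 + (4 * bn - an ^+ 2) * sin th != 0) /\
    local_level_curve n rhoc lc `&` sector rhoc (- (pi / 2)) del
    = [set rhoc + (8 * an ^+ 2 * (1 + sin th)
                   / (an ^+ 2 + (4 * bn - an ^+ 2) * sin th) ^+ 2)%:C
                  * cis th
      | th in [set th : R | `|th - - (pi / 2)| < del]].
Proof.
move=> hab an0 hP; pose g := 4 * bn - an ^+ 2.
have a2 : 0 < an ^+ 2 by rewrite exprn_gt0.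
have g0 : 0 < g by rewrite /g; lra.
(* The margin is chosen so that [g * (-1 + margin) = - an^2]: within it the denominator is negative.
   It is positive because [an^2 < 2 bn]. *)
have e0 : 0 < (4 * bn - 2 * an ^+ 2) / g by rewrite divr_gt0//; lra.
have [d d0 hd] := sin_near_bottom e0; exists d => //.
have D0 th : `|th - - (pi / 2)| < d -> an ^+ 2 + g * sin th != 0.
  move=> /hd hs; rewrite lt_eqF//.
  have : g * sin th < g * (-1 + (4 * bn - 2 * an ^+ 2) / g) by rewrite ltr_pM2l.
  rewrite mulrDr [g * (_ / g)]mulrC divfK ?gt_eqF//.
  by rewrite /g; lra.
split => //; apply/seteqP; split => rho.
  move=> [/hP[r1 [th1 [r10 E1 h1]]] [r [th [r0 hth E]]]].
  have rr : r1 = r.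
    have := E1; rewrite E => /addrI e; have := congr1 (@Normc.normc R) e.
    by rewrite !normc_polar.
  (* The point [rhoc] carries no definite angle; it is matched with the angle of the bisector, where
     the polar radius vanishes. *)
  have [rz|rn] := eqVneq r 0.
    exists (- (pi / 2)); first by rewrite /= subrr normr0.
    by rewrite E rz sinN sin_pihalf subrr mulr0 mul0r !mul0r.
  exists th => //.
  have cc : cis th1 = cis th.
    have : r%:C != 0 :> C by rewrite -normc_gt0 normc_real normr_gt0.
    by move=> /mulfI; apply; move: E1; rewrite E rr => /addrI.
  have ss : sin th1 = sin th by have := congr1 (@complex.Im R) cc.
  case: h1 => [h1|h1]; first by rewrite -rr h1 eqxx in rn.
  by rewrite E -ss h1 ss rr mulfK// expf_neq0// D0.
move=> [th /= hth <-]; set D := an ^+ 2 + _.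
have Dn : D ^+ 2 != 0 by rewrite expf_neq0// D0.
have s1 : 0 <= 1 + sin th by have := sin_geN1 th; lra.
have r0 : 0 <= 8 * an ^+ 2 * (1 + sin th) / D ^+ 2.
  by rewrite divr_ge0 ?sqr_ge0// mulr_ge0// mulr_ge0// ltW.
split; last by exists (8 * an ^+ 2 * (1 + sin th) / D ^+ 2), th.
apply/hP; exists (8 * an ^+ 2 * (1 + sin th) / D ^+ 2), th; split => //.
by right; rewrite divfK.
Qed.

Lemma level_curve_symmetric n (lc : C) (yn an bn : R) (rhoc := 0 +i* yn : C) :
  (forall rho, local_level_curve n rhoc lc rho <->
    exists r th : R, [/\ 0 <= r, rho = rhoc + r%:C * cis th
      & r = 0 \/ 8 * an ^+ 2 * (1 + sin th)
                 = r * (an ^+ 2 + (4 * bn - an ^+ 2) * sin th) ^+ 2]) ->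
  forall rho : C, local_level_curve n rhoc lc rho <->
    local_level_curve n rhoc lc (- rho^*).
Proof.
move=> hP; suff H rho : local_level_curve n rhoc lc rho -> local_level_curve n rhoc lc (- rho^*).
  move=> rho; split; first exact: H.
  move/H; rewrite (_ : - (- rho^*)^* = rho)//; case: rho => p q.
  by apply/eqP; rewrite eq_complex /= !opprK !eqxx.
(* Reflection in the imaginary axis sends the angle [th] to [pi - th], and the equation involves
   only the sine. *)
move=> /hP[r [th [r0 -> h]]]; apply/hP; exists r, (pi - th).
have sE : sin (pi - th) = sin th by rewrite sinB cospi sinpi; ring.
have cE : cos (pi - th) = - cos th by rewrite cosD sinN cosN cospi sinpi; ring.
split => //; last by rewrite sE.
apply/eqP; rewrite /rhoc /cis sE cE eq_complex /=.
by rewrite !mul0r !subr0 !addr0 !add0r mulrN !eqxx /= opprK.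
Qed.

Lemma scaled_direction n (a : C) (an sg u V : R) :
  a ^+ 2 = - 'i%C * (an ^+ 2)%:C -> sg != 0 ->
  n%:R * (u * V + 1) * an ^+ 2 = 2 * (V - u) * sg ^+ 2 ->
  n%:R * (u%:C * V%:C + 1) * (a / sg%:C) ^+ 2 = - 2 * 'i%C * (V%:C - u%:C).
Proof.
move=> ha sg0 e; have s0 : sg%:C != 0 :> C by rewrite -normc_gt0 normc_real normr_gt0.
have {}e : n%:R * (u%:C * V%:C + 1) * (an ^+ 2)%:C = 2 * (V%:C - u%:C) * sg%:C ^+ 2 :> C.
  have := congr1 (real_complex R) e.
  by rewrite !rmorphM rmorphD rmorphB rmorphM rmorph1 !rmorph_nat.
have as2 : (a / sg%:C) ^+ 2 * sg%:C ^+ 2 = - 'i%C * (an ^+ 2)%:C by rewrite -exprMn divfK.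
apply: (mulIf (expf_neq0 2 s0)).
transitivity (n%:R * (u%:C * V%:C + 1) * ((a / sg%:C) ^+ 2 * sg%:C ^+ 2)); first by ring.
rewrite as2; transitivity (- 'i%C * (n%:R * (u%:C * V%:C + 1) * (an ^+ 2)%:C) : C).
  by ring.
by rewrite e; ring.
Qed.

Lemma imaginary_expansions n (c : nat -> C) (f : C -> C) (lc : C) (yn an bn eta : R)
    (rhoc := 0 +i* yn : C) :
  lc != 0 -> power_series c f -> c 0%N = 1 ->
  c 1%N = an%:C * cis (3 * pi / 4) -> c 2%N = - 'i%C * bn%:C ->
  near0 (fun z => eigenvalue_pair_near n lc eta (rhoc + z ^+ 2) (lc * f z) (lc * f (- z))) ->
  exists del M : R, 0 < del /\ forall y : R, `|y - yn| < del ->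
    let d : R := y - yn in
    let E : R := M * `|d| `^ (3 / 2) in
    let expansion (s : R) (l : R[i]) : Prop :=
      (d <= 0 ->
        [/\ `|complex.Re (l / lc) - (1 - `|d| * bn)| <= E,
            `|complex.Im (l / lc) - s * an * Num.sqrt `|d| | <= E
          & `|Normc.normc (l / lc)
              - (1 + `|d| * (2^-1 * (an ^+ 2 - 2 * bn)))| <= E]) /\
      (0 <= d ->
        [/\ `|complex.Re (l / lc) - (1 + s * an * Num.sqrt d + d * bn)| <= E,
            `|complex.Im (l / lc)| <= E
          & `|Normc.normc (l / lc)
              - (1 + s * an * Num.sqrt d + d * bn)| <= E]) in
    exists lp lm : R[i],
      [/\ eigenvalue_pair_near n lc eta (0 +i* y) lp lm,
          expansion 1 lp & expansion (-1) lm].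
Proof.
move=> lc0 hf c0 c1 c2 hp.
have [del [M [del0 M0 h]]] := puiseux_local hf c0 hp.
exists (del ^+ 2), M; split; first by rewrite exprn_gt0.
move=> y hy d E expansion; pose t := Num.sqrt `|d|.
have t0 : 0 <= t by rewrite sqrtr_ge0.
have t2 : t ^+ 2 = `|d| by rewrite sqr_sqrtr.
have td : t < del by rewrite -(ltr_pXn2r (n := 2)) ?nnegrE ?(ltW del0)// t2.
have EE : E = M * t ^+ 3 by rewrite /E powR_3half.
(* [w] is the square root of [i] that rotates [c 1] to the positive real [an]. Since
   [rho - rhoc = i d], the right [z] is [t w] for [d >= 0] and [i t w] for [d < 0], which makes
   [c 1 * z] real or purely imaginary. *)
pose w : C := cis (- (3 * pi / 4)).
have aw : c 1%N * w = an%:C by rewrite c1 -mulrA cisK mulr1.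
have w2 : w ^+ 2 = 'i%C.
  apply: (mulfI (expf_neq0 2 (cis_neq0 (3 * pi / 4)))).
  by rewrite -exprMn cisK expr1n cis_3quarter_sqr mulNr -expr2 sqr_ic opprK.
pose z : C := if 0 <= d then t%:C * w else 'i%C * (t%:C * w).
have Nw : N w = 1 by exact: normc_cis.
have Ni : N ('i%C : C) = 1 by rewrite /= expr0n /= add0r expr1n sqrtr1.
have Nz : N z = t.
  have : N (t%:C * w) = t by rewrite Normc.normcM Nw mulr1 normc_real ger0_norm.
  by move=> e; rewrite /z; case: ifP => _ //; rewrite Normc.normcM Ni mul1r.
have z2 : z ^+ 2 = 'i%C * d%:C.
  rewrite /z; case: (leP 0 d) => hd.
    by rewrite exprMn w2 -rmorphXn /= t2 ger0_norm// mulrC.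
  by rewrite !exprMn w2 sqr_ic -rmorphXn /= t2 ltr0_norm// rmorphN; ring.
have cz : c 1%N * z = if 0 <= d then (an * t)%:C else 'i%C * (an * t)%:C.
  rewrite /z rmorphM /= -aw; case: ifP => _; ring.
have c2z : c 2%N * z ^+ 2 = (bn * d)%:C.
  rewrite c2 z2 rmorphM /=; transitivity (- 'i%C ^+ 2 * (bn%:C * d%:C) : C); first by ring.
  by rewrite sqr_ic opprK mul1r.
have hr : rhoc + z ^+ 2 = 0 +i* y.
  rewrite z2 /rhoc /d; apply/eqP; rewrite eq_complex /=.
  by apply/andP; split; apply/eqP; ring.
have [hpz h1 h2 h3] := h z (eq_ind_r (fun r => r < del) td Nz).
have [|_ h1' _ _] := h (- z); first by rewrite normcN Nz.
rewrite normcN sqrrN mulrN in h1'.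
rewrite hr Nz in hpz h1 h2 h3 h1'.
rewrite -EE in h1 h2 h3 h1'; rewrite c2z in h1 h2 h3 h1'.
exists (lc * f z), (lc * f (- z)).
have key (s : R) (g : C) :
    N (g - (1 + s%:C * (c 1%N * z) + (bn * d)%:C)) <= E ->
    `|N g - (1 + s * complex.Re (c 1%N * z) + bn * d + complex.Im (c 1%N * z) ^+ 2 / 2)| <= E ->
    expansion s (lc * g).
  move=> k1 k2; rewrite /expansion [lc * g]mulrC mulfK//.
  have k3 := le_trans (normc_ge_absRe _) k1; have k4 := le_trans (normc_ge_absIm _) k1.
  rewrite cz in k2 k3 k4 {k1}; case: (leP 0 d) k2 k3 k4 => hd k2 k3 k4.
    have {}k3 : `|complex.Re g - (1 + s * an * t + d * bn)| <= E.
      case: g k3 {k2 k4} => p q /=; rewrite !mul0r !subr0.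
      by congr (`|_| <= _); ring.
    have {}k4 : `|complex.Im g| <= E.
      by case: g k4 {k2 k3} => p q /=; rewrite !mul0r !mulr0 !addr0 !subr0.
    have {}k2 : `|N g - (1 + s * an * t + d * bn)| <= E.
      move: k2; rewrite /= expr0n /= mul0r addr0.
      by congr (`|_| <= _); ring.
    have st : Num.sqrt d = t by rewrite /t ger0_norm.
    (* Here [0 <= d], so the formulas for [d <= 0] remain to be checked only at [d = 0], where both
       sets agree. *)
    split => hd'; last by rewrite st; split.
    have dz : d = 0 by apply/eqP; rewrite eq_le hd hd'.
    have tz : t = 0 by rewrite /t dz normr0 sqrtr0.
    rewrite tz dz in k2 k3; rewrite -/t tz dz normr0.
    by split; [move: k3|move: k4|move: k2]; congr (`|_| <= _); ring.
  have dE : `|d| = - d by rewrite ltr0_norm.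
  split => hd' //; split.
  - by case: g k3 {k2 k4} => p q /=; congr (`|_| <= _); rewrite dE; ring.
  - by case: g k4 {k2 k3} => p q /=; congr (`|_| <= _); rewrite -/t; ring.
  - move: k2 => /=; congr (`|_| <= _); rewrite dE.
    by rewrite !(mul0r, mul1r, add0r, oppr0, mulr0, addr0) exprMn t2 dE; field.
split => //.
- apply: key; first by rewrite rmorph1 mul1r.
  by move: h2; rewrite mul1r.
- apply: key; first by rewrite rmorphN rmorph1 mulN1r.
  by move: h3; rewrite mulN1r.
Qed.

End Assembly.

Theorem theorem6p4 (R : realType) (n : nat) (n_odd : odd n) (n_ge3 : (3 <= n)%N) :
  (exists! x : R, 1 < x /\ (chebT R n).[x] = n%:R * x) /\
  forall x : R, 1 < x -> (chebT R n).[x] = n%:R * x ->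
  let T (k : nat) : R := (chebT R k).[x] in
  let U (k : nat) : R := (chebU R k).[x] in
  let yn : R := (Num.sqrt (x ^+ 2 - 1))^-1 * (T (n.+1)./2 / U (n - 3)./2) in
  let rhoc : R[i] := 0 +i* yn in
  let lc : R[i] := - n%:R in
  0 < yn /\
  (* (1) *)
  [/\ double_eigenvalue (KMS n rhoc) lc,
      (n %% 4 = 1)%N -> type1_eigenvalue (KMS n rhoc) lc
    & (n %% 4 = 3)%N -> type2_eigenvalue (KMS n rhoc) lc] /\
  exists an bn : R,
  let tha : R := 3 * pi / 4 in
  let thb : R := - (pi / 2) in
  let Tha : R := thb - 2 * tha in
  let a : R[i] := an%:C * cis tha in
  let b : R[i] := bn%:C * cis thb in
  [/\
  (* (2) *)
  [/\ [/\ 0 < an, 0 < bn & Tha = - (2 * pi)],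
      an = Num.sqrt (2 / n%:R) * (Num.sqrt (Num.sqrt (x ^+ 2 - 1)) / x)
           * Num.sqrt ((U n.-1 - 1) * (T n.-1 - 1)),
      6 * n%:R * x ^+ 2 * Num.sqrt (x ^+ 2 - 1) * (U n.-1 - 1) * bn
      = 12 + 4 * (n%:R + 1) * T n.-1 ^+ 2
        - (5 * n%:R ^+ 2 + 5 * n%:R + 12) * x ^+ 2
        - 3 * (n%:R - 7) * (x ^+ 2 - 1) * U n.-1
        + 4 * (n%:R - 2) * (n%:R ^+ 2 * x ^+ 2 - 1)
        + (n%:R + 1) * (4 * x ^+ 2 - 3) * T n.-1,
      puiseux_parameters n rhoc lc a b
    & forall a' b' : R[i], puiseux_parameters n rhoc lc a' b' ->
        (a' = a \/ a' = - a) /\ b' = b],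
  (* (3) *)
  [/\ forall a' b' : R[i], puiseux_parameters n rhoc lc a' b' ->
        cusp_bisector rhoc a' = ray rhoc (- (pi / 2)),
      ray rhoc (- (pi / 2)) = [set 0 +i* (yn - t) | t in [set t : R | 0 <= t]],
      exists2 del : R, 0 < del &
        (forall th : R, `|th - - (pi / 2)| < del ->
           an ^+ 2 + (4 * bn - an ^+ 2) * sin th != 0) /\
        local_level_curve n rhoc lc `&` sector rhoc (- (pi / 2)) del
        = [set rhoc + (8 * an ^+ 2 * (1 + sin th)
                       / (an ^+ 2 + (4 * bn - an ^+ 2) * sin th) ^+ 2)%:C
                      * cis th
          | th in [set th : R | `|th - - (pi / 2)| < del]]
    & forall rho : R[i], local_level_curve n rhoc lc rho <->
        local_level_curve n rhoc lc (- rho^*)]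
  (* (4) *)
  & exists eta del M : R,
    [/\ 0 < eta, 0 < del
      & forall y : R, 0 < y -> `|y - yn| < del ->
        let d : R := y - yn in
        let E : R := M * `|d| `^ (3 / 2) in
        let expansion (s : R) (l : R[i]) : Prop :=
          (d <= 0 ->
            [/\ `|complex.Re (l / lc) - (1 - `|d| * bn)| <= E,
                `|complex.Im (l / lc) - s * an * Num.sqrt `|d| | <= E
              & `|Normc.normc (l / lc)
                  - (1 + `|d| * (2^-1 * (an ^+ 2 - 2 * bn)))| <= E]) /\
          (0 <= d ->
            [/\ `|complex.Re (l / lc) - (1 + s * an * Num.sqrt d + d * bn)| <= E,
                `|complex.Im (l / lc)| <= E
              & `|Normc.normc (l / lc)
                  - (1 + s * an * Num.sqrt d + d * bn)| <= E]) in
        exists lp lm : R[i],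
          [/\ eigenvalue_pair_near n lc eta (0 +i* y) lp lm,
              expansion 1 lp & expansion (-1) lm]]].
Proof.
split; first exact: chebT_root_unique.
move=> x x1 hx T U yn rhoc lc.
have n2 : (1 < n)%N by exact: leq_trans n_ge3.
pose u := x + Num.sqrt (x ^+ 2 - 1); pose V := u ^+ n.
have cr : critical n u yn := critical_point n_odd n_ge3 x1 hx.
have crC : critical n u%:C yn%:C := critical_map (real_complex R) cr.
have rE : rhoc = 'i%C * yn%:C.
  by apply/eqP; rewrite eq_complex /= !mul0r !mulr0 !mul1r subrr add0r !eqxx.
have n0 : n%:R != 0 :> R by rewrite pnatr_eq0 -lt0n ltnW.
have lc0 : lc != 0 by rewrite oppr_eq0 pnatr_eq0 -lt0n ltnW.
have mu : mup lc (char_poly (KMS n rhoc)) = 2%N by rewrite rE; exact: kms_critical_mup crC.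
have [ty1 ty2] := kms_critical_type n_odd n2 crC.
split; first exact: critical_point_gt0.
split; first by rewrite rE in mu *; split.
pose an : R := Num.sqrt (2 / n%:R) * (Num.sqrt (Num.sqrt (x ^+ 2 - 1)) / x)
           * Num.sqrt ((U n.-1 - 1) * (T n.-1 - 1)).
pose bn : R := curvature n%:R u V.
have [an0 an2 abn sl0] : [/\ 0 < an,
    an ^+ 2 = slope u V ^+ 2 * (2 * (V - u) / (n%:R * (u * V + 1))),
    an ^+ 2 < 2 * bn & 0 < slope u V] := amplitude_sqr n_odd n_ge3 x1.
have bn0 : 0 < bn by have := sqr_ge0 an; lra.
exists an, bn => tha thb Tha a b.
have aE2 : a ^+ 2 = - 'i%C * (an ^+ 2)%:C.
  by rewrite /a exprMn cis_3quarter_sqr -rmorphXn mulrC.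
have bE : b = - 'i%C * bn%:C by rewrite /b cisN_pihalf mulrC.
have VC : u%:C ^+ n = V%:C by rewrite -rmorphXn.
have sC : slope u V != 0 by rewrite gt_eqF.
have sC' : (slope u V)%:C != 0 :> R[i] by rewrite -normc_gt0 normc_real normr_gt0.
(* The eigenvalue series multiplies [d] by the slope, so this choice makes its first coefficient [a]
   itself and not [- a]. *)
pose d := a / (slope u V)%:C.
have uV0 : u * V + 1 != 0 by have [[_ _ _ ?] _ _] := cr.
have hd : n%:R * (u%:C * u%:C ^+ n + 1) * d ^+ 2 = - 2 * 'i%C * (u%:C ^+ n - u%:C).
  rewrite VC; apply: (@scaled_direction _ _ _ an) => //.
  by rewrite an2; field; rewrite n0 uV0.
have [c [f [hf hroot [c0 c1 c2]]]] := kms_eigenvalue_series n_odd n2 crC hd.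
have {}c1 : c 1%N = a by rewrite c1 VC -slope_map /d divfK.
have {}c2 : c 2%N = b.
  by rewrite c2 VC bE -(rmorph_nat (real_complex R)) -curvature_map.
have a0 : a != 0.
  by rewrite mulf_neq0 ?cis_neq0// -normc_gt0 normc_real normr_gt0 gt_eqF.
have c10 : c 1%N != 0 by rewrite c1.
rewrite -rE in hroot.
have [eta eta0 hp] := puiseux_pair lc0 mu hf c0 c10 hroot.
have hps := puiseux_series_intro c0 eta0 hf hp.
have uniq a' b' : puiseux_parameters n rhoc lc a' b' -> (a' = a \/ a' = - a) /\ b' = b.
  move=> [c' [hc' <- <-]]; have [e2 e1] := puiseux_coef_unique lc0 hps hc'.
  by rewrite e2 c2 -c1.
have c1' : c 1%N ^+ 2 = - 'i%C * (an ^+ 2)%:C by rewrite c1.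
have c2' : c 2%N = - 'i%C * bn%:C by rewrite c2.
have hP := local_level_curveP lc0 hf c0 c1' c2' eta0 hp.
split.
- split => //.
  + by split => //; rewrite /Tha /thb /tha; field.
  + exact: critical_curvature.
  + by exists c; split.
- split.
  + move=> a' b' /uniq[ha _]; apply: (@cusp_bisector_down _ _ _ an an0).
      by case: ha => ->; rewrite ?sqrrN.
    have Na : N a = an by rewrite normc_polar// ltW.
    case: ha => ->; first by exists tha; rewrite Na.
    by exists (tha + pi); rewrite normcN Na cisD cis_pi mulrN1 mulrN.
  + apply/seteqP; split => rho [r r0].
      move=> ->; exists r => //; rewrite cisN_pihalf /rhoc; apply/eqP; rewrite eq_complex /=.
      by apply/andP; split; apply/eqP; ring.
    move=> <-; exists r => //; rewrite cisN_pihalf /rhoc; apply/eqP; rewrite eq_complex /=.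
    by apply/andP; split; apply/eqP; ring.
  + exact: level_curve_sector.
  + exact: level_curve_symmetric.
- have [del [M [del0 h]]] := imaginary_expansions lc0 hf c0 c1 c2' hp.
  by exists eta, del, M; split => // y _; exact: h.
Qed.
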